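(* Let $C$ and $D$ be Banach lattices such that $C$ and $D^*$ each have the dyadic Hardy--Littlewood property. Let $\mu$ be a locally finite Borel measure on $\mathbb{R}^d$, and let $\lambda_Q:C\to D$ be positive operators indexed by the dyadic cubes $Q$ of $\mathbb{R}^d$. Then the operator $T_\lambda(\,\cdot\,\mu):L^p_C(\mu)\to L^p_D(\mu)$ is bounded for some $p\in(1,\infty)$ if and only if it is bounded for every $p\in(1,\infty)$. Here bounded (for a given $p$) means that $$\sup_{\mathcal{D}}\|T_{\lambda,\mathcal{D}}(\,\cdot\,\mu)\|_{L^p_C(\mu)\to L^p_D(\mu)}<\infty,\qquad T_{\lambda,\mathcal{D}}(f\mu):=\sum_{Q\in\mathcal{D}}\lambda_Q\Big(\int_Q f\,\mathrm{d}\mu\Big)1_Q,$$ where the supremum is over all finite collections $\mathcal{D}$ of dyadic cubes.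
   Context: A Banach lattice $(E,|\cdot|_E,\leq)$ is a real Banach space with a compatible lattice order; $E_+=\{e\in E:e\ge 0\}$. Its dual $E^*$ is a Banach lattice under the order $e^*\geq 0$ iff $e^*(e)\geq 0$ for all $e\in E_+$. A linear operator $\lambda:C\to D$ between Banach lattices is positive if $c\ge 0$ implies $\lambda c\ge 0$. $L^p_E(\mu)$ is the Lebesgue--Bochner space with norm $(\int |f|_E^p\,\mathrm{d}\mu)^{1/p}$; $L^p_E$ is the case of Lebesgue measure on $\mathbb{R}^d$. For a finite collection $\mathcal{D}$ of dyadic cubes, $\bar M_{\mathcal{D}}f:=\sup_{Q\in\mathcal{D}}\langle f\rangle_Q1_Q$, where $\langle f\rangle_Q=\frac1{|Q|}\int_Q f\,\mathrm{d}x$ and the supremum is taken in the lattice order of $E$. $E$ has the dyadic Hardy--Littlewood property if for some $p\in(1,\infty)$ one has $\sup_{\mathcal{D}}\|\bar M_{\mathcal{D}}\|_{L^p_E\to L^p_E}<\infty$, the supremum being over all finite collections of dyadic cubes (it is a known fact that then this holds for every $p\in(1,\infty)$). *)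

(* Defs.v *)
From HB Require Import structures.
From mathcomp Require Import all_boot all_order all_algebra finmap.
From mathcomp Require Import all_classical all_reals all_analysis.
From mathcomp Require Import lra.
Set Implicit Arguments.
Unset Strict Implicit.
Unset Printing Implicit Defensive.
Import Order.TTheory GRing.Theory Num.Theory.
Import numFieldNormedType.Exports.
Local Open Scope classical_set_scope.
Local Open Scope ring_scope.

(* The lattice order is a field of the mixin, not an inherited Order.Lattice
   structure: HB refuses a join of normed modules and lattices that does not
   sit below the existing numeric hierarchy. The library's order structures
   are derived just below, so that <=, Order.join and Order.meet are available
   on every Banach lattice. *)
HB.mixin Record isBanachLattice (R : realType) E
    of CompleteNormedModule R E := {
  bl_le : rel E ;
  bl_meet : E -> E -> E ;
  bl_join : E -> E -> E ;
  bl_refl : reflexive bl_le ;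
  bl_anti : antisymmetric bl_le ;
  bl_trans : transitive bl_le ;
  bl_meetP : forall x y z, bl_le x (bl_meet y z) = bl_le x y && bl_le x z ;
  bl_joinP : forall x y z, bl_le (bl_join x y) z = bl_le x z && bl_le y z ;
  bl_leD2r : forall x y z, bl_le x y -> bl_le (x + z) (y + z) ;
  bl_leZ2l : forall (a : R) x y,
    0 <= a -> bl_le x y -> bl_le (a *: x) (a *: y) ;
  (* bl_join x (- x) is the lattice modulus of x, whereas `|x| is its norm *)
  bl_norm_le : forall x y : E,
    bl_le (bl_join x (- x)) (bl_join y (- y)) -> `|x| <= `|y| }.

#[short(type="banachLatticeType")]
HB.structure Definition BanachLattice (R : realType) :=
  {E of CompleteNormedModule R E & isBanachLattice R E}.

#[non_forgetful_inheritance]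
HB.instance Definition _ (R : realType) (E : banachLatticeType R) :=
  Order.Le_isPOrder.Build ring_display (BanachLattice.sort E)
    bl_refl bl_anti bl_trans.
#[non_forgetful_inheritance]
HB.instance Definition _ (R : realType) (E : banachLatticeType R) :=
  Order.POrder_MeetJoin_isLattice.Build ring_display (BanachLattice.sort E)
    bl_meetP bl_joinP.

Section banach_lattice_theory.
Context {R : realType} {E : banachLatticeType R}.
Implicit Types x y z u v : E.

Lemma blD2r x y z : x <= y -> x + z <= y + z.
Proof. exact: bl_leD2r. Qed.

Lemma blZ2l (a : R) x y : 0 <= a -> x <= y -> a *: x <= a *: y.
Proof. exact: bl_leZ2l. Qed.

Lemma blD x y u v : x <= y -> u <= v -> x + u <= y + v.
Proof.
move=> xy uv; apply: (le_trans (blD2r u xy)).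
by rewrite addrC [leRHS]addrC; exact: blD2r.
Qed.

Lemma bl_subr_ge0 x y : (0 <= y - x) = (x <= y).
Proof.
apply/idP/idP => [/(blD2r x)|/(blD2r (- x))]; first by rewrite add0r subrK.
by rewrite subrr.
Qed.

Lemma blN x y : x <= y -> - y <= - x.
Proof. by rewrite -bl_subr_ge0 => xy; rewrite -bl_subr_ge0 opprK addrC. Qed.

Lemma blBr x y z : (x <= y - z) = (x + z <= y).
Proof. by rewrite -bl_subr_ge0 -[RHS]bl_subr_ge0 opprD addrAC addrA. Qed.

Definition blpos x : E := Order.join x 0.
Definition blabs x : E := Order.join x (- x).

Lemma blpos_ge0 x : 0 <= blpos x. Proof. exact: leUr. Qed.
Lemma blpos_ge x : x <= blpos x. Proof. exact: leUl. Qed.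
Lemma blpos_le x y : x <= y -> 0 <= y -> blpos x <= y.
Proof. by move=> xy y0; rewrite leUx xy. Qed.

Lemma blpos_id x : 0 <= x -> blpos x = x.
Proof. exact: join_l. Qed.

Lemma blpos_npos x : x <= 0 -> blpos x = 0.
Proof. exact: join_r. Qed.

Lemma blposB x : blpos x - blpos (- x) = x.
Proof.
apply/eqP; rewrite subr_eq; apply/eqP/le_anti/andP; split.
  apply: blpos_le.
    by rewrite -[leLHS]addr0; apply: blD => //; exact: blpos_ge0.
  by rewrite -(subrr x); apply: blD => //; exact: blpos_ge.
rewrite addrC -blBr; apply: blpos_le.
  by rewrite -[leLHS]add0r; apply: blD => //; exact: blpos_ge0.
by rewrite -(subrr x); apply: blD => //; exact: blpos_ge.
Qed.

Lemma blabs_ge x : x <= blabs x. Proof. exact: leUl. Qed.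
Lemma blabs_geN x : - x <= blabs x. Proof. exact: leUr. Qed.
Lemma blabs_le x y : x <= y -> - x <= y -> blabs x <= y.
Proof. by move=> xy Nxy; rewrite leUx xy. Qed.

Lemma blabs_ge0 x : 0 <= blabs x.
Proof.
have h : 0 <= blabs x + blabs x.
  by rewrite -(subrr x); apply: blD; [exact: blabs_ge|exact: blabs_geN].
have h2 : (0 : R) <= 2^-1 by rewrite invr_ge0.
have := blZ2l h2 h; rewrite scaler0 scalerDr -scalerDl.
have -> : 2^-1 + 2^-1 = 1 :> R by rewrite [RHS](splitr 1) !mul1r.
by rewrite scale1r.
Qed.

Lemma blabs_id x : 0 <= x -> blabs x = x.
Proof.
move=> x0; apply: join_l; apply: (le_trans _ x0).
by rewrite -oppr0; exact: blN.
Qed.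

Lemma blnorm_le x y : blabs x <= blabs y -> `|x| <= `|y|.
Proof. exact: bl_norm_le. Qed.

Lemma blnorm_abs x : `|blabs x| = `|x|.
Proof.
apply/eqP; rewrite eq_le; apply/andP.
by split; apply: blnorm_le; rewrite (blabs_id (blabs_ge0 x)).
Qed.

Lemma blnorm_mono x y : 0 <= x -> x <= y -> `|x| <= `|y|.
Proof.
move=> x0 xy; apply: blnorm_le.
by rewrite !blabs_id//; exact: le_trans xy.
Qed.

Lemma blnorm_pos x : `|blpos x| <= `|x|.
Proof.
rewrite -(blnorm_abs x); apply: blnorm_mono; first exact: blpos_ge0.
by apply: blpos_le; [exact: blabs_ge|exact: blabs_ge0].
Qed.

Lemma riesz_decomposition x y z : 0 <= x -> 0 <= y -> 0 <= z -> z <= x + y ->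
  exists z1 z2, [/\ z = z1 + z2, 0 <= z1 <= x & 0 <= z2 <= y].
Proof.
move=> x0 y0 z0 zxy; exists (z - blpos (z - x)), (blpos (z - x)).
split; first by rewrite subrK.
- rewrite bl_subr_ge0; apply/andP; split.
    by apply: blpos_le => //; rewrite -bl_subr_ge0 opprB addrC subrK.
  have := blpos_ge (z - x); rewrite -bl_subr_ge0 opprB addrCA => h.
  by rewrite -bl_subr_ge0 opprB.
- rewrite blpos_ge0; apply: blpos_le => //.
  by rewrite -bl_subr_ge0 opprB addrA bl_subr_ge0 addrC.
Qed.

End banach_lattice_theory.

Section dual.
Context {R : realType} (E : banachLatticeType R).

Definition is_functional : {pred E -> R^o} :=
  fun f => `[< linear f /\ continuous f >].

Lemma is_functionalP (f : E -> R^o) : linear f ->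
  reflect (exists M : R, forall x, `|f x| <= M * `|x|) (f \in is_functional).
Proof.
move=> lf.
pose g : {linear E -> R^o} := HB.pack f (GRing.isLinear.Build _ _ _ _ f lf).
apply: (iffP (asboolP _)) => [[_ cf]|[M fM]].
  have /linear_boundedP[M [_ fM]] : bounded_near g (nbhs 0).
    exact/linear_bounded_continuous.
  by exists (M + 1) => x; apply: fM; rewrite ltrDl.
split=> //; apply/(linear_bounded_continuous g)/linear_boundedP.
exists M; split=> [|r Mr x]; first exact: num_real.
by apply: le_trans (fM x) _; rewrite ler_wpM2r// ltW.
Qed.

Lemma is_functional_submod : submod_closed is_functional.
Proof.
split=> [|a f g].
  apply/is_functionalP => [b x y|]; first by rewrite /= scaler0 addr0.
  by exists 0 => x; rewrite normr0 mul0r.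
move=> /asboolP[lf cf] /asboolP[lg cg].
have /is_functionalP -/(_ lf)[M fM] : f \in is_functional by exact/asboolP.
have /is_functionalP -/(_ lg)[N gN] : g \in is_functional by exact/asboolP.
apply/is_functionalP => [b x y|].
  rewrite !fctE lf lg !scalerDr !scalerA (mulrC a b) -!addrA.
  by congr (_ + _); rewrite addrCA.
exists (`|a| * M + N) => x; rewrite !fctE mulrDl -mulrA.
by rewrite (le_trans (ler_normD _ _))// lerD// normrZ ler_wpM2l.
Qed.

HB.instance Definition _ :=
  GRing.isSubmodClosed.Build R (E -> R^o) is_functional is_functional_submod.

Record dual := Dual {
  dual_fun :> E -> R^o ; dual_funP : dual_fun \in is_functional }.
HB.instance Definition _ := [isSub for dual_fun].
HB.instance Definition _ := [Choice of dual by <:].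
HB.instance Definition _ := [SubChoice_isSubLmodule of dual by <:].

Implicit Types f g h : dual.

Lemma dual_linear f : linear f.
Proof. by case: f => f /= /asboolP[]. Qed.
HB.instance Definition _ f := GRing.isLinear.Build _ _ _ _ f (dual_linear f).

Lemma dualP f g : f =1 g -> f = g.
Proof. by move=> fg; apply/val_inj/funext. Qed.

Lemma dualDE f g x : (f + g) x = f x + g x. Proof. by []. Qed.
Lemma dualNE f x : (- f) x = - f x. Proof. by []. Qed.
Lemma dualBE f g x : (f - g) x = f x - g x. Proof. by []. Qed.
Lemma dualZE a f x : (a *: f) x = a * f x. Proof. by []. Qed.
Lemma dual0E x : (0 : dual) x = 0. Proof. by []. Qed.

Definition dual_norm f : R := sup [set `|f x| | x in [set x | `|x| <= 1]].

Lemma dual_has_sup f : has_sup [set `|f x| | x in [set x | `|x| <= 1]].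
Proof.
split; first by exists `|f 0|, 0 => //=; rewrite normr0.
have /(is_functionalP (@dual_linear f))[M fM] := dual_funP f.
exists `|M| => _ [x /= x1 <-]; apply: le_trans (fM x) _.
rewrite (le_trans (ler_norm _))// normrM normr_id ler_piMr//.
Qed.

Lemma dual_norm_ge0 f : 0 <= dual_norm f.
Proof.
apply: le_trans (normr_ge0 (f 0)) _; apply: (sup_upper_bound (dual_has_sup f)).
by exists 0 => //=; rewrite normr0.
Qed.

Lemma le_dual_norm f x : `|f x| <= dual_norm f * `|x|.
Proof.
have [->|x0] := eqVneq x 0; first by rewrite linear0 !normr0 mulr0.
have nx0 : 0 < `|x| by rewrite normr_gt0.
rewrite -ler_pdivrMr// -[X in X / _]mulr1 mulrC.
have -> : `|x|^-1 * (`|f x| * 1) = `|f (`|x|^-1 *: x)|.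
  by rewrite linearZ normrZ mulr1 ger0_norm// invr_ge0.
apply: (sup_upper_bound (dual_has_sup f)); exists (`|x|^-1 *: x) => //=.
by rewrite normrZ ger0_norm ?invr_ge0// mulVf// normr_eq0.
Qed.

Lemma dual_norm_le f (M : R) : 0 <= M -> (forall x, `|f x| <= M * `|x|) ->
  dual_norm f <= M.
Proof.
move=> M0 fM; apply: ge_sup; first exact: (dual_has_sup f).1.
by move=> _ [x /= x1 <-]; rewrite (le_trans (fM x))// ler_piMr.
Qed.

Let dual_normD f g : dual_norm (f + g) <= dual_norm f + dual_norm g.
Proof.
apply: dual_norm_le => [|x]; first by rewrite addr_ge0 ?dual_norm_ge0.
by rewrite dualDE (le_trans (ler_normD _ _))// mulrDl lerD ?le_dual_norm.
Qed.

Let dual_normZ_le a f : dual_norm (a *: f) <= `|a| * dual_norm f.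
Proof.
apply: dual_norm_le => [|x]; first by rewrite mulr_ge0 ?dual_norm_ge0.
by rewrite dualZE normrM -mulrA ler_wpM2l ?le_dual_norm.
Qed.

Let dual_normZ a f : dual_norm (a *: f) = `|a| * dual_norm f.
Proof.
apply/eqP; rewrite eq_le dual_normZ_le/=.
have [->|a0] := eqVneq a 0; first by rewrite normr0 mul0r dual_norm_ge0.
rewrite -ler_pdivlMl ?normr_gt0//.
by have := dual_normZ_le a^-1 (a *: f); rewrite scalerK// normfV.
Qed.

Let dual_norm0_eq0 f : dual_norm f = 0 -> f = 0.
Proof.
move=> f0; apply: dualP => x; apply/normr0_eq0/le_anti.
by rewrite normr_ge0 (le_trans (le_dual_norm f x))// f0 mul0r.
Qed.

HB.instance Definition _ :=
  Lmodule_isNormed.Build R dual dual_normD dual_normZ dual_norm0_eq0.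

Lemma dual_normE f : `|f| = dual_norm f. Proof. by []. Qed.

Let dual_complete (F : set_system dual) :
  ProperFilter F -> cauchy F -> cvg F.
Proof.
move=> FF /cauchyP Fc.
have Fball e : 0 < e -> exists f1, F (ball f1 e).
  exact: Fc.
have Fx x : cvg ((fun f : dual => f x : R^o) @ F).
  apply/cauchy_cvgP/cauchy_exP => _/posnumP[e].
  have [|f1 Ff1] := Fball (e%:num / (`|x| + 1)); first by rewrite divr_gt0// ltr_wpDl.
  exists (f1 x); suff : F [set f : dual | `|f1 x - f x| < e%:num].
    by rewrite -ball_normE.
  apply: filterS Ff1 => f; rewrite -ball_normE /= => ff1.
  rewrite -dualBE; apply: (@le_lt_trans _ _ (`|f1 - f| * (`|x| + 1))).
    apply: (le_trans (le_dual_norm _ _)); rewrite -dual_normE.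
    by rewrite ler_wpM2l// lerDl.
  by rewrite -ltr_pdivlMr.
pose g x : R^o := lim ((fun f : dual => f x : R^o) @ F).
have gE x : (fun f : dual => f x : R^o) @ F --> g x by exact: Fx.
have g_lin : linear g.
  move=> a x y; apply: (@cvg_unique _ _ ((fun f : dual => f (a *: x + y) : R^o) @ F)).
  - exact: norm_hausdorff.
  - exact: gE.
  - rewrite (_ : (fun f : dual => f (a *: x + y) : R^o) =
      (fun f : dual => a *: (f x : R^o) + f y)); last first.
      by apply/funext => f; exact: dual_linear.
    by apply: cvgD; [apply: cvgZr|]; exact: gE.
have g_ball f1 r : F (ball f1 r) -> forall x, `|g x - f1 x| <= r * `|x|.
  move=> Ff1 x; apply/ler_addgt0Pr => e e0.
  near F => f.
  apply: (le_trans (ler_distD (f x) _ _)); rewrite [leRHS]addrC lerD//.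
    by near: f; have /cvgrPdist_le := gE x; exact.
  have : ball f1 r f by near: f.
  rewrite -ball_normE /= distrC => /ltW fr.
  by rewrite -dualBE (le_trans (le_dual_norm _ _))// ler_wpM2r.
have gP : g \in is_functional.
  apply/is_functionalP => //; have [f1 /g_ball Ff1] := Fball 1 ltr01.
  exists (1 + dual_norm f1) => x.
  rewrite -(subrK (f1 x) (g x)) (le_trans (ler_normD _ _))// mulrDl.
  by rewrite lerD ?le_dual_norm.
apply/cvg_ex; exists (Dual gP); apply/cvgrPdist_le => e e0.
have e20 : 0 < e / 2 by rewrite divr_gt0.
have [f1 Ff1] := Fball _ e20.
near=> f; apply: dual_norm_le => [|x]; first exact: ltW.
rewrite dualBE /= (le_trans (ler_distD (f1 x) _ _))//.
rewrite [e]splitr mulrDl lerD//; first exact: g_ball.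
have : ball f1 (e / 2) f by near: f.
rewrite -ball_normE /= => /ltW fr.
by rewrite -dualBE (le_trans (le_dual_norm _ _))// ler_wpM2r.
Unshelve. all: by end_near. Qed.

HB.instance Definition _ := Uniform_isComplete.Build dual dual_complete.
End dual.

Section dual_order.
Context {R : realType} {E : banachLatticeType R}.
Implicit Types (f g h : dual E) (x y z u v : E).

Definition dual_le f g := `[< forall x, 0 <= x -> f x <= g x >].

Lemma dual_leP f g :
  reflect (forall x, 0 <= x -> f x <= g x) (dual_le f g).
Proof. exact: asboolP. Qed.

Let dual_le_refl : reflexive dual_le.
Proof. by move=> f; apply/dual_leP. Qed.

Let dual_le_anti : antisymmetric dual_le.
Proof.
move=> f g /andP[/dual_leP fg /dual_leP gf]; apply: dualP => x.
rewrite -(blposB x) !linearB/=; congr (_ - _); apply/le_anti.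
  by rewrite fg ?gf// blpos_ge0.
by rewrite fg ?gf// blpos_ge0.
Qed.

Let dual_le_trans : transitive dual_le.
Proof.
move=> g f h /dual_leP fg /dual_leP gh; apply/dual_leP => x x0.
exact: le_trans (fg x x0) (gh x x0).
Qed.

Let dual_leD2r f g h : dual_le f g -> dual_le (f + h) (g + h).
Proof. by move=> /dual_leP fg; apply/dual_leP => x x0; rewrite lerD2r fg. Qed.

Let dual_leZ2l (a : R) f g : 0 <= a -> dual_le f g -> dual_le (a *: f) (a *: g).
Proof.
move=> a0 /dual_leP fg; apply/dual_leP => x x0.
by rewrite ler_wpM2l ?fg.
Qed.

(* Riesz-Kantorovich formula for the positive part of a functional *)
Definition dual_pos_cone f x : R := sup [set f y | y in [set y | 0 <= y <= x]].
Definition dual_pos_fun f x : R^o :=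
  dual_pos_cone f (blpos x) - dual_pos_cone f (blpos (- x)).

Section positive_part.
Variable f : dual E.
Let p := dual_pos_cone f.

Let has_sup_p x : 0 <= x -> has_sup [set f y | y in [set y | 0 <= y <= x]].
Proof.
move=> x0; split; first by exists (f 0), 0 => //=; rewrite lexx.
exists (dual_norm f * `|x|) => _ [y /= /andP[y0 yx] <-].
rewrite (le_trans (ler_norm _))// (le_trans (le_dual_norm f y))//.
by rewrite ler_wpM2l ?dual_norm_ge0// blnorm_mono.
Qed.

Let le_p x y : 0 <= y -> y <= x -> f y <= p x.
Proof.
move=> y0 yx; apply: sup_upper_bound; last by exists y => //=; rewrite y0.
exact/has_sup_p/le_trans/yx.
Qed.

Let p_le x (M : R) : 0 <= x -> (forall y, 0 <= y -> y <= x -> f y <= M) ->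
  p x <= M.
Proof.
move=> x0 fM; apply: ge_sup; first exact: (has_sup_p x0).1.
by move=> _ [y /= /andP[y0 yx] <-]; exact: fM.
Qed.

Let p_ge0 x : 0 <= x -> 0 <= p x.
Proof. by move=> x0; rewrite -(linear0 f); exact: le_p. Qed.

Let pD x y : 0 <= x -> 0 <= y -> p (x + y) = p x + p y.
Proof.
move=> x0 y0; have xy0 : 0 <= x + y by rewrite -(addr0 0) blD.
apply/le_anti/andP; split.
  apply: p_le => // z z0 /(riesz_decomposition x0 y0 z0).
  move=> [z1 [z2 [-> /andP[z10 z1x] /andP[z20 z2y]]]].
  by rewrite linearD/= lerD// le_p.
rewrite -lerBrDr; apply: p_le => // u u0 ux.
rewrite lerBrDr -lerBrDl; apply: p_le => // v v0 vy.
by rewrite lerBrDl -linearD/= le_p ?blD// -(addr0 0) blD.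
Qed.

Let pZ_le (a : R) x : 0 < a -> 0 <= x -> p (a *: x) <= a * p x.
Proof.
move=> a0 x0; apply: p_le => [|y y0 yx].
  by rewrite -(scaler0 _ a) blZ2l// ltW.
have a10 : 0 <= a^-1 by rewrite invr_ge0 ltW.
rewrite -ler_pdivrMl// -[a^-1 * f y]/(a^-1 *: (f y : R^o)) -linearZ/=.
apply: le_p; first by rewrite -(scaler0 _ a^-1) blZ2l.
by rewrite -(scalerK (lt0r_neq0 a0) x) blZ2l.
Qed.

Let pZ (a : R) x : 0 <= a -> 0 <= x -> p (a *: x) = a * p x.
Proof.
rewrite le_eqVlt => /predU1P[<- x0|a0 x0].
  rewrite scale0r mul0r; apply/le_anti; rewrite p_ge0// andbT.
  apply: p_le => // y y0 yx.
  by have -> : y = 0; [apply/le_anti; rewrite yx|rewrite linear0].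
apply/le_anti; rewrite pZ_le//=.
have ax0 : 0 <= a *: x by rewrite -(scaler0 _ a) blZ2l// ltW.
have := @pZ_le a^-1 (a *: x); rewrite invr_gt0 => /(_ a0 ax0).
by rewrite scalerK ?gt_eqF// -ler_pdivlMl ?invr_gt0// invrK.
Qed.

Let q := dual_pos_fun f.

Let qE u v : 0 <= u -> 0 <= v -> q (u - v) = p u - p v.
Proof.
move=> u0 v0; have h : blpos (u - v) + v = u + blpos (- (u - v)).
  have /eqP := blposB (u - v); rewrite subr_eq => /eqP ->.
  by rewrite addrAC subrK.
have := congr1 p h; rewrite !pD ?blpos_ge0// => e.
by rewrite /q /dual_pos_fun -/p -[X in X - _](addrK (p v)) e addrAC addrK.
Qed.

Let q_lin : linear q.
Proof.
have qZ (a : R) x : 0 <= a -> q (a *: x) = a *: q x.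
  move=> a0; have aP z : 0 <= z -> 0 <= a *: z.
    by move=> z0; rewrite -(scaler0 _ a) blZ2l.
  rewrite -{1}(blposB x) scalerBr qE ?aP ?blpos_ge0//.
  by rewrite !pZ ?blpos_ge0// -mulrBr.
have qN x : q (- x) = - q x by rewrite /q /dual_pos_fun opprK opprB.
have qD x y : q (x + y) = q x + q y.
  rewrite -{1}(blposB x) -{1}(blposB y) addrACA -opprD qE; last 2 first.
  - by rewrite -(addr0 0) blD ?blpos_ge0.
  - by rewrite -(addr0 0) blD ?blpos_ge0.
  by rewrite !pD ?blpos_ge0// opprD addrACA.
move=> a x y; rewrite qD; congr (_ + _).
have [a0|a0] := leP 0 a; first exact: qZ.
by rewrite -{1}[a]opprK scaleNr qN qZ ?oppr_ge0 ?ltW// scaleNr opprK.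
Qed.

Let q_is_functional : q \in @is_functional R E.
Proof.
apply/is_functionalP => //; exists (dual_norm f + dual_norm f) => x.
have pN z : 0 <= z -> `|p z| <= dual_norm f * `|z|.
  move=> z0; rewrite ger0_norm ?p_ge0//; apply: p_le => // y y0 yz.
  rewrite (le_trans (ler_norm _))// (le_trans (le_dual_norm f y))//.
  by rewrite ler_wpM2l ?dual_norm_ge0// blnorm_mono.
rewrite (le_trans (ler_normB _ _))// mulrDl.
apply: lerD; rewrite (le_trans (pN _ (blpos_ge0 _)))//;
  rewrite ler_wpM2l ?dual_norm_ge0//.
  exact: blnorm_pos.
by rewrite -(normrN x) blnorm_pos.
Qed.

Definition dual_pos : dual E := Dual q_is_functional.

Lemma dual_posE x : 0 <= x -> dual_pos x = dual_pos_cone f x.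
Proof.
move=> x0; have := qE x0 (lexx 0); rewrite subr0 -/p => /= ->.
by rewrite -[X in _ - p X](scale0r 0) pZ// mul0r subr0.
Qed.

Lemma dual_pos_ge0 : dual_le 0 dual_pos.
Proof. by apply/dual_leP => x x0; rewrite dual_posE// p_ge0. Qed.

Lemma dual_pos_ge : dual_le f dual_pos.
Proof. by apply/dual_leP => x x0; rewrite dual_posE// le_p. Qed.

Lemma dual_pos_le h : dual_le 0 h -> dual_le f h -> dual_le dual_pos h.
Proof.
move=> /dual_leP h0 /dual_leP fh; apply/dual_leP => x x0.
rewrite dual_posE//; apply: p_le => // y y0 yx.
rewrite (le_trans (fh _ y0))// -subr_ge0 -linearB/= h0//.
by rewrite bl_subr_ge0.
Qed.

Lemma dual_pos_cone_le x (M : R) : 0 <= x ->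
  (forall y, 0 <= y -> y <= x -> f y <= M) -> dual_pos x <= M.
Proof. by move=> x0 fM; rewrite dual_posE//; exact: p_le. Qed.

End positive_part.

Definition dual_join f g : dual E := f + dual_pos (g - f).
Definition dual_meet f g : dual E := - dual_join (- f) (- g).

Let dual_leB f g h : dual_le f (g - h) = dual_le (f + h) g.
Proof.
by apply/idP/idP => [/(dual_leD2r h)|/(dual_leD2r (- h))]; rewrite ?subrK ?addrK.
Qed.

Let dual_leN f g : dual_le (- f) (- g) = dual_le g f.
Proof.
by apply/dual_leP/dual_leP => fg x /fg; rewrite ?dualNE lerN2.
Qed.

Let dual_joinP f g h : dual_le (dual_join f g) h = dual_le f h && dual_le g h.
Proof.
rewrite /dual_join addrC -dual_leB; apply/idP/andP => [fgh|[fh gh]].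
  split.
    have := dual_le_trans (dual_pos_ge0 _) fgh.
    by rewrite dual_leB add0r.
  by have := dual_le_trans (dual_pos_ge _) fgh; rewrite dual_leB subrK.
by apply: dual_pos_le; rewrite dual_leB ?add0r ?subrK.
Qed.

Let dual_meetP f g h : dual_le f (dual_meet g h) = dual_le f g && dual_le f h.
Proof.
by rewrite /dual_meet -dual_leN opprK dual_joinP !dual_leN.
Qed.

Let dual_norm_mono f g :
  dual_le (dual_join f (- f)) (dual_join g (- g)) -> `|f| <= `|g|.
Proof.
move=> /[dup]; rewrite {1}dual_joinP => /andP[fG NfG] _.
set G := dual_join g (- g) in fG NfG.
have Gle x : 0 <= x -> G x <= dual_norm g * `|x|.
  move=> x0; rewrite /G /dual_join dualDE -lerBrDl.
  apply: dual_pos_cone_le => // y y0 yx.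
  rewrite lerBrDl dualBE dualNE addrA -!linearB/=.
  rewrite (le_trans (ler_norm _))// (le_trans (le_dual_norm g _))//.
  rewrite ler_wpM2l ?dual_norm_ge0//; apply: blnorm_le.
  rewrite (blabs_id x0); apply: blabs_le.
    have Ny : - y <= 0 by rewrite -oppr0 blN.
    by rewrite -[leRHS]addr0 blD// -[leRHS]addr0 blD.
  rewrite !opprB addrA -blBr opprK; exact: blD.
clearbody G; apply: dual_norm_le => [|z]; first exact: dual_norm_ge0.
have fz : `|f z| <= G (blabs z).
  have wz : 0 <= blabs z - z by rewrite bl_subr_ge0 blabs_ge.
  have wNz : 0 <= blabs z + z.
    by rewrite -[z in _ + z]opprK bl_subr_ge0 blabs_geN.
  move/dual_leP : (fG) => /(_ _ wz); move/dual_leP : (fG) => /(_ _ wNz).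
  move/dual_leP : (NfG) => /(_ _ wz); move/dual_leP : (NfG) => /(_ _ wNz).
  rewrite !dualNE !linearB !linearD/=.
  rewrite ler_norml; lra.
rewrite (le_trans fz)// (le_trans (Gle _ (blabs_ge0 z)))//.
by rewrite blnorm_abs.
Qed.

HB.instance Definition _ := isBanachLattice.Build R (dual E)
  dual_le_refl dual_le_anti dual_le_trans dual_meetP dual_joinP
  dual_leD2r dual_leZ2l dual_norm_mono.
HB.instance Definition _ := Order.Le_isPOrder.Build ring_display (dual E)
  bl_refl bl_anti bl_trans.
HB.instance Definition _ :=
  Order.POrder_MeetJoin_isLattice.Build ring_display (dual E)
    bl_meetP bl_joinP.
End dual_order.

Section bochner.
Context {d} {T : measurableType d} {R : realType} {E : completeNormedModType R}.
Variable mu : {measure set T -> \bar R}.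
Implicit Types (f s : T -> E) (A : set T).

Definition simple_fun s :=
  finite_set (range s) /\ forall e : E, measurable (s @^-1` [set e]).

(* Pointwise limit of simple functions everywhere: every class of L^p_E(mu)
   has such a representative, so no mu-a.e. clause is needed. *)
Definition strongly_measurable f :=
  exists2 s : (T -> E)^nat, forall n, simple_fun (s n) &
    forall x, s n x @[n --> \oo] --> f x.

(* On the value e = 0 the measure may be infinite; fine +oo = 0 is harmless
   there because the term is scaled by e. *)
Definition simple_integral A s : E :=
  \sum_(e \in range s) fine (mu (A `&` s @^-1` [set e])) *: e.

Definition is_bochner_integral A f (v : E) :=
  strongly_measurable f /\
  exists s : (T -> E)^nat,
    [/\ forall n, simple_fun (s n),
        forall n, (\int[mu]_(x in A) `|s n x|%:E < +oo)%E,
        (\int[mu]_(x in A) `|f x - s n x|%:E)%E @[n --> \oo] --> 0%E &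
        simple_integral A (s n) @[n --> \oo] --> v].

(* 0 when f is not Bochner integrable on A *)
Definition bochner_integral A f : E := xget 0 (is_bochner_integral A f).

Definition Lp_norm (p : R) f : \bar R := Lnorm mu p%:E (fun x => `|f x|%:E).

Definition Lp (p : R) f := strongly_measurable f /\ (Lp_norm p f < +oo)%E.

End bochner.

(* The product sigma-algebra of n.-tuple is the Borel sigma-algebra of R^n. *)
Notation Rn R n := (n.-tuple (measurableTypeR R)).

Section lebesgue_Rn.
Context {R : realType}.

Definition Rn_cons n (x : measurableTypeR R * Rn R n) : Rn R n.+1 :=
  [tuple of x.1 :: x.2].

Lemma measurable_Rn_cons n : measurable_fun setT (@Rn_cons n).
Proof. by apply: measurable_cons; [exact: measurable_fst|exact: measurable_snd]. Qed.
HB.instance Definition _ n :=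
  isMeasurableFun.Build _ _ _ _ (@Rn_cons n) (@measurable_Rn_cons n).

Section cons.
Context n (mu : {sigma_finite_measure set (Rn R n) -> \bar R}).

Definition lebesgue_cons : set (Rn R n.+1) -> \bar R :=
  pushforward (@lebesgue_measure R \x mu)%E (@Rn_cons n).

Let lebesgue_cons0 : lebesgue_cons set0 = 0%E.
Proof. exact: measure0. Qed.

Let lebesgue_cons_ge0 A : (0 <= lebesgue_cons A)%E.
Proof. exact: measure_ge0. Qed.

Let lebesgue_cons_sigma_additive : semi_sigma_additive lebesgue_cons.
Proof. exact: measure_semi_sigma_additive. Qed.

HB.instance Definition _ := isMeasure.Build _ _ _ lebesgue_cons
  lebesgue_cons0 lebesgue_cons_ge0 lebesgue_cons_sigma_additive.

Let uncons (t : Rn R n.+1) : measurableTypeR R * Rn R n :=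
  (thead t, [tuple of behead t]).

Let measurable_uncons : measurable_fun setT uncons.
Proof.
apply/measurable_fun_pairP; split.
  exact: (measurable_tnth ord0).
exact: measurable_behead.
Qed.

Let uncons_consK : cancel (@Rn_cons n) uncons.
Proof.
by move=> [x t]; rewrite /uncons theadE; congr pair; exact/val_inj.
Qed.

Let lebesgue_cons_sigma_finite : sigma_finite setT lebesgue_cons.
Proof.
have /sigma_finiteP[F [FT ndF Foo]] := sigma_finiteT (@lebesgue_measure R).
have /sigma_finiteP[G [GT ndG Goo]] := sigma_finiteT mu.
exists (fun k => uncons @^-1` (F k `*` G k)).
  rewrite -preimage_bigcup (_ : \bigcup_k _ = setT) ?preimage_setT//.
  apply/seteqP; split=> // -[x t] _.
  have [i _ Fi] : (\bigcup_k F k) x by rewrite -FT.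
  have [j _ Gj] : (\bigcup_k G k) t by rewrite -GT.
  exists (maxn i j) => //; split.
  - by move: x Fi; exact/subsetPset/ndF/leq_maxl.
  - by move: t Gj; exact/subsetPset/ndG/leq_maxr.
move=> k; have [mF Fk] := Foo k; have [mG Gk] := Goo k; split.
  rewrite -[X in measurable X]setTI; apply: measurable_uncons => //.
  exact: measurableX.
rewrite /lebesgue_cons /pushforward -comp_preimage.
rewrite (_ : uncons \o _ = id); last exact/funext/uncons_consK.
by rewrite preimage_id product_measure1E// lte_mul_pinfty// ge0_fin_numE.
Qed.

HB.instance Definition _ :=
  Measure_isSigmaFinite.Build _ _ _ lebesgue_cons lebesgue_cons_sigma_finite.

End cons.

Fixpoint lebesgue_Rn n : {sigma_finite_measure set (Rn R n) -> \bar R} :=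
  if n is m.+1 then lebesgue_cons (lebesgue_Rn m)
  else dirac ([tuple] : Rn R 0).

Lemma measurable_box n (a b : 'I_n -> R) :
  measurable [set x : Rn R n | forall i, a i <= (tnth x i : R) < b i].
Proof.
rewrite (_ : mkset _ = \bigcap_(i in [set: 'I_n])
  ((fun x : Rn R n => tnth x i) @^-1` `[a i, b i[%classic)).
  apply: fin_bigcap_measurable => // i _.
  by rewrite -[X in measurable X]setTI; apply: measurable_tnth.
apply/seteqP; split=> x /= h i; first by move=> _; rewrite /= in_itv; exact: h.
by have := h i I; rewrite /= in_itv.
Qed.

Lemma lebesgue_Rn_box n (a b : 'I_n -> R) : (forall i, a i <= b i) ->
  lebesgue_Rn n [set x | forall i, a i <= (tnth x i : R) < b i] =
  (\prod_i (b i - a i))%:E.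
Proof.
elim: n a b => [|n ih] a b ab.
  rewrite big_ord0 /= diracE mem_set//= => -[].
  by [].
rewrite big_ord_recl /= /lebesgue_cons /pushforward.
rewrite (_ : _ @^-1` _ = `[a ord0, b ord0[%classic `*`
  [set x : Rn R n | forall i,
    a (lift ord0 i) <= (tnth x i : R) < b (lift ord0 i)]); last first.
  apply/seteqP; split=> -[x t] /=.
    move=> h; split=> [|i]; first by have := h ord0; rewrite in_itv.
    by have := h (lift ord0 i); rewrite tnthS.
  rewrite in_itv => -[hx ht] i.
  by case: (unliftP ord0 i) => [j|] ->; rewrite ?tnthS.
rewrite product_measure1E//=; last exact: measurable_box.
rewrite ih// lebesgue_measure_itv/= lte_fin -EFinD.
have [_|] := ltP; first by rewrite EFinM.
by move=> ba; rewrite mul0e (_ : b ord0 = a ord0) ?subrr ?mul0r//; apply/le_anti/andP.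
Qed.
End lebesgue_Rn.

Definition locally_finite {R : realType} {n : nat}
    (mu : {measure set (Rn R n) -> \bar R}) :=
  forall x : Rn R n, exists2 e : R, 0 < e &
    (mu [set y | forall i, `|(tnth y i : R) - tnth x i| < e]%R < +oo)%E.

Definition cube_index (n : nat) : choiceType := (int * n.-tuple int)%type.

(* (k, m) stands for the cube 2^-k (m + [0,1)^n) *)
Definition cube {R : realType} {n : nat} (Q : cube_index n) : set (Rn R n) :=
  [set x | forall i : 'I_n,
     (tnth Q.2 i)%:~R * 2 ^ (- Q.1) <= (tnth x i : R)
       < ((tnth Q.2 i)%:~R + 1) * 2 ^ (- Q.1)].

Section hardy_littlewood.
Context {R : realType} {n : nat} {E : banachLatticeType R}.
Implicit Types (f : Rn R n -> E) (Q : cube_index n) (F : {fset cube_index n}).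

Definition average Q f : E :=
  (fine (lebesgue_Rn n (cube Q)))^-1 *: bochner_integral (lebesgue_Rn n) (cube Q) f.

(* The head of s is the initial value: taking 0 there would put 0 into every
   supremum. The supremum of the empty family is 0 by convention. *)
Definition lattice_sup (s : seq E) : E :=
  if s is a :: s' then \big[Order.join/a]_(b <- s') b else 0.

Definition dyadic_maximal F f (x : Rn R n) : E :=
  lattice_sup [seq \1_(cube Q) x *: average Q f | Q <- enum_fset F].

End hardy_littlewood.

Definition dyadic_HL {R : realType} (n : nat) (E : banachLatticeType R) :=
  exists2 p : R, 1 < p & exists K : R,
    forall (F : {fset cube_index n}) (f : Rn R n -> E),
      Lp (lebesgue_Rn n) p f ->
      (Lp_norm (lebesgue_Rn n) p (dyadic_maximal F f)
         <= K%:E * Lp_norm (lebesgue_Rn n) p f)%E.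

Definition positive_op {R : realType} {C D : banachLatticeType R}
    (l : {linear C -> D}) :=
  forall c : C, 0 <= c -> 0 <= l c.

Section dyadic_operator.
Context {R : realType} {n : nat} {C D : banachLatticeType R}.
Variables (lam : cube_index n -> {linear C -> D}).
Variable mu : {measure set (Rn R n) -> \bar R}.

Definition dyadic_op (F : {fset cube_index n}) (f : Rn R n -> C)
    (x : Rn R n) : D :=
  \sum_(Q <- F) (\1_(cube Q) x : R) *: lam Q (bochner_integral mu (cube Q) f).

Definition dyadic_op_bounded (p : R) :=
  exists K : R, forall (F : {fset cube_index n}) (f : Rn R n -> C),
    Lp mu p f -> (Lp_norm mu p (dyadic_op F f) <= K%:E * Lp_norm mu p f)%E.

End dyadic_operator.

(* Main.v *)
Require Import Defs.
From HB Require Import structures.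
From mathcomp Require Import all_boot all_order all_algebra finmap.
From mathcomp Require Import all_classical all_reals all_analysis.
From mathcomp Require Import measurable_realfun lra ring.
Set Implicit Arguments.
Unset Strict Implicit.
Unset Printing Implicit Defensive.
Import Order.TTheory GRing.Theory Num.Theory.
Import numFieldNormedType.Exports.
Local Open Scope classical_set_scope.
Local Open Scope ring_scope.

(** A positive operator that is bounded for one exponent satisfies a testing
    condition that does not refer to the exponent: on a cube, a function of norm
    at most [1] has an image whose norm has mean at most a constant. From this
    condition boundedness follows for every exponent, by a sparse domination of
    the bilinear form of the operator.

    Let [f] and [g] be positive functions with values in [C] and in the dual of
    [D]. Below a cube one stops, and selects a new principal cube, as soon as the
    lattice join of the averages of [f] since the last principal cube has a norm
    larger than a multiple of the average of [`|f|] over it, or likewise for [g].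
    If the lattice maximal operators are of weak type (1,1) with respect to the
    given measure, the principal cubes are sparse [principal_sparse]. Between two
    generations the averages of [f] and [g] are dominated by functions whose
    norms do not exceed the thresholds, to which the testing condition applies.
    Hence the bilinear form is at most a constant times the integral of the
    product of the scalar maximal functions of [`|f|] and [`|g|]
    [bilinear_sparse_bound]. Doob's inequality, applied with [g] norming the image
    of [f], concludes [level_op_bounded].

    It remains to see that the Hardy--Littlewood property, an inequality of
    strong type for one exponent and for Lebesgue measure, yields the weak type
    inequality for an arbitrary measure. Lebesgue measure is doubling: in terms
    of finite trees, which represent dyadic step functions of one variable, the
    Calderon--Zygmund decomposition gives the weak type inequality
    [tree_weak_of_strong]. For a general measure the children of a cube have
    arbitrary proportions. The Bellman function of the weak type inequality for
    trees is midpoint concave because two trees can be put side by side. Being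
    bounded from below on segments, it is concave [bellman_concave], and hence it
    decreases along any filtration [maximal_weak_type].

    For a finite set of cubes only the atoms of the algebra that they generate
    matter: averaging over the atoms keeps the integrals over the cubes and does
    not increase the norm. An atom is encoded by the set of cubes that contain
    it, the cubes of bounded scale then define the filtration, and all the sums
    are finite [dyadic_op_bounded_extrapolation]. *)

(** * Norming functionals *)
Section sublinear.
Context {R : realType} {V : lmodType R}.
Implicit Types (p q : V -> R) (x y v : V).

Definition sublinear q :=
  (forall x y, q (x + y) <= q x + q y) /\
  (forall a x, 0 <= a -> q (a *: x) = a * q x).

Lemma sublinear0 q : sublinear q -> q 0 = 0.
Proof. by move=> [_ /(_ 0 0 (lexx _))]; rewrite scaler0 mul0r. Qed.

Lemma sublinear_geN q x : sublinear q -> - q (- x) <= q x.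
Proof.
move=> qs; rewrite lerNl -subr_ge0 opprK addrC -(sublinear0 qs) -(subrr x).
exact: qs.1.
Qed.

(** The last two conditions say that the family is closed under sums and
    dilations up to domination, so that its infimum is sublinear. They hold for
    chains and for shifts, the two families needed below. *)
Lemma sublinear_inf I (A : set I) (F : I -> V -> R) p :
  A !=set0 ->
  (forall i, A i -> forall x, - p (- x) <= F i x) ->
  (forall i, A i -> 0 <= F i 0) -> (exists2 i, A i & F i 0 <= 0) ->
  (forall i j x y, A i -> A j -> exists2 k, A k & F k (x + y) <= F i x + F j y) ->
  (forall i a x, A i -> 0 < a -> exists2 k, A k & F k (a *: x) <= a * F i x) ->
  let q x := inf [set F i x | i in A] in
  sublinear q /\ forall i x, A i -> q x <= F i x.
Proof.
move=> A0 Fp F0 F0' FD FZ q.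
have qF i x : A i -> q x <= F i x.
  move=> Ai; apply: ge_inf; last by exists i.
  by exists (- p (- x)) => _ [j Aj <-]; exact: Fp.
have leq x (M : R) : (forall i, A i -> M <= F i x) -> M <= q x.
  move=> MF; apply: lb_le_inf; last by move=> _ [i Ai <-]; exact: MF.
  by have [i Ai] := A0; exists (F i x), i.
have q0 : q 0 = 0.
  apply/le_anti; rewrite leq// andbT.
  by have [i Ai Fi] := F0'; exact: le_trans (qF _ _ Ai) Fi.
have qZ a x : 0 < a -> q (a *: x) <= a * q x.
  move=> a0; rewrite -ler_pdivrMl//; apply: leq => i Ai.
  rewrite ler_pdivrMl//; have [k Ak Fk] := FZ i a x Ai a0.
  exact: le_trans (qF _ _ Ak) Fk.
split; last exact: qF.
split=> [x y|a x].
  rewrite -lerBlDr; apply: (leq x) => i Ai; rewrite lerBlDr -lerBlDl.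
  apply: (leq y) => j Aj; rewrite lerBlDl.
  have [k Ak Fk] := FD i j x y Ai Aj.
  exact: le_trans (qF _ _ Ak) Fk.
rewrite le_eqVlt => /predU1P[<-|a0]; first by rewrite scale0r mul0r.
apply/le_anti; rewrite qZ//= -ler_pdivlMl//.
have := qZ a^-1 (a *: x); rewrite invr_gt0 scalerK ?gt_eqF//.
exact.
Qed.

(** The modification of a sublinear functional that is as negative as possible
    at [- v]; it is the device by which minimality forces linearity. *)
Definition sublinear_shift q v x : R :=
  inf [set q (x + t *: v) - t * q v | t in [set t | 0 <= t]].

Lemma sublinear_shiftP q v : sublinear q ->
  [/\ sublinear (sublinear_shift q v),
      forall x, sublinear_shift q v x <= q x &
      sublinear_shift q v (- v) <= - q v].
Proof.
move=> qs; have [qD qZ] := qs.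
have [] := @sublinear_inf R [set t | 0 <= t]
  (fun t x => q (x + t *: v) - t * q v) q.
- by exists 0 => /=.
- move=> t /= t0 x; rewrite lerBrDr -lerBrDl opprK -qZ//.
  by rewrite -{1}(addKr x (t *: v)) [leRHS]addrC qD.
- by move=> t /= t0; rewrite add0r qZ// subrr.
- by exists 0 => //=; rewrite scale0r mul0r addr0 (sublinear0 qs) subr0.
- move=> t s x y /= t0 s0; exists (t + s); rewrite /= ?addr_ge0//.
  rewrite scalerDl addrACA mulrDl.
  by have := qD (x + t *: v) (y + s *: v); lra.
- move=> t a x /= t0 a0; exists (a * t); rewrite /= ?mulr_ge0 ?(ltW a0)//.
  by rewrite -scalerA -scalerDr qZ ?(ltW a0)// -mulrA -mulrBr.
rewrite -/(sublinear_shift q v) => ss sq; split=> //.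
  by move=> x; have := sq 0 x (lexx _); rewrite scale0r mul0r addr0 subr0.
have := sq 1 (- v) ler01.
by rewrite scale1r addNr (sublinear0 qs) mul1r sub0r.
Qed.

Lemma exists_minimal_sublinear p : sublinear p ->
  exists q, [/\ sublinear q, forall x, q x <= p x &
    forall r, sublinear r -> (forall x, r x <= q x) -> r = q].
Proof.
move=> ps; pose T := {q | sublinear q /\ forall x, q x <= p x}.
pose le (s t : T) := `[< forall x, sval t x <= sval s x >].
have [|||A Atot|t tmin] := @Zorn T le.
- by move=> t; apply/asboolP.
- move=> r s t /asboolP rs /asboolP st; apply/asboolP => x.
  exact: le_trans (st x) (rs x).
- move=> [s sP] [t tP] /asboolP/= st /asboolP/= ts; apply: eq_exist.
  by apply/funext => x; apply/le_anti; rewrite st ts.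
- have [A0|A0] := pselect (A !=set0); last first.
    exists (exist _ p (conj ps (fun x => lexx _))) => s As.
    by exfalso; apply: A0; exists s.
  have [|||||qs qle] := @sublinear_inf T A (fun s x => sval s x) p A0.
  + move=> [s [ss sp]] _ x /=; apply: le_trans (sublinear_geN x ss).
    by rewrite lerN2.
  + by move=> [s [ss sp]] _ /=; rewrite (sublinear0 ss).
  + by have [[s [ss sp]] As] := A0; exists (exist _ s (conj ss sp)) => //=;
      rewrite (sublinear0 ss).
  + move=> s t x y As At; have [/asboolP st|/asboolP ts] := Atot s t As At.
      exists t => //; apply: le_trans ((svalP t).1.1 x y) _.
      by rewrite lerD2r; exact: st.
    exists s => //; apply: le_trans ((svalP s).1.1 x y) _.
    by rewrite lerD2l; exact: ts.
  + by move=> s a x As a0; exists s => //; rewrite (svalP s).1.2// ltW.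
  set q := (fun x => inf _) in qs qle.
  have qp x : q x <= p x.
    by have [s As] := A0; exact: le_trans (qle _ x As) ((svalP s).2 x).
  exists (exist _ q (conj qs qp)) => s As; apply/asboolP => x /=; exact: qle.
exists (sval t); have [ts tp] := svalP t; split=> // r rs rt.
have rp x : r x <= p x by exact: le_trans (rt x) (tp x).
by have /(congr1 sval) : exist _ r (conj rs rp) = t by apply/tmin/asboolP.
Qed.

(** A minimal sublinear functional [q] coincides with each of its shifts,
    hence is odd, hence linear. *)
Lemma hahn_banach_sublinear p v : sublinear p ->
  exists f : V -> R, [/\ forall a x y, f (a *: x + y) = a * f x + f y,
    forall x, f x <= p x & f v = p v].
Proof.
move=> ps; have [pvs pvp pvv] := sublinear_shiftP v ps.
have [q [qs qp qmin]] := exists_minimal_sublinear pvs.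
have qN x : q (- x) = - q x.
  have [xs xq xx] := sublinear_shiftP x qs.
  apply/le_anti/andP; split; first by rewrite -{1}(qmin _ xs xq).
  by rewrite lerNl; exact: sublinear_geN.
have qD x y : q (x + y) = q x + q y.
  apply/le_anti; rewrite qs.1/= -lerN2 opprD -!qN opprD; exact: qs.1.
exists q; split.
- move=> a x y; rewrite qD; congr (_ + _).
  have [a0|a0] := leP 0 a; first exact: qs.2.
  by rewrite -{1}[a]opprK scaleNr qN qs.2 ?oppr_ge0 ?ltW// mulNr opprK.
- by move=> x; exact: le_trans (qp x) (pvp x).
- apply/le_anti; rewrite (le_trans (qp v) (pvp v))/= -lerN2 -qN.
  exact: le_trans (qp _) pvv.
Qed.

End sublinear.

Section banach_lattice_extra.
Context {R : realType}.

(** Hahn--Banach applied to [x |-> `|x^+|], which vanishes on the negative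
    cone: the functional that it dominates is automatically positive. *)
Lemma exists_norming_functional (D : banachLatticeType R) (v : D) : 0 <= v ->
  exists f : dual D, [/\ 0 <= f, `|f| <= 1 & f v = `|v|].
Proof.
move=> v0; have ps : sublinear (fun x : D => `|blpos x|).
  split=> [x y|a x a0].
    apply: le_trans (ler_normD _ _); apply: blnorm_mono (blpos_ge0 _) _.
    apply: blpos_le; first by apply: blD; exact: blpos_ge.
    by rewrite -[leLHS]addr0; apply: blD; exact: blpos_ge0.
  rewrite -[in RHS](ger0_norm a0) -normrZ; congr (`| _ |).
  have aZ (z : D) : 0 <= z -> 0 <= a *: z by move=> z0; rewrite -(scaler0 _ a) blZ2l.
  apply/le_anti/andP; split.
    by apply: blpos_le; [exact/blZ2l/blpos_ge|exact/aZ/blpos_ge0].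
  have [->|an0] := eqVneq a 0; first by rewrite !scale0r blpos_ge0.
  have a'0 : 0 <= a^-1 by rewrite invr_ge0.
  rewrite -[leRHS](scalerKV an0); apply: blZ2l => //.
  apply: blpos_le; last by rewrite -(scaler0 _ a^-1) blZ2l// blpos_ge0.
  by rewrite -{1}(scalerK an0 x); apply: blZ2l => //; exact: blpos_ge.
have [f [fl fp fv]] := hahn_banach_sublinear v ps.
have flin : linear (f : D -> R^o) by move=> a x y; exact: fl.
have fb (x : D) : `|f x : R^o| <= 1 * `|x|.
  have fN (z : D) : f (- z) = - f z.
    have f0 : f 0 = 0 by have := fl 1 0 0; rewrite scaler0 addr0 mul1r; lra.
    have /eqP := fl 1 (- z) z; rewrite scale1r addNr mul1r f0 eq_sym addr_eq0.
    by move=> /eqP.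
  rewrite mul1r ler_norml (le_trans (fp x) (blnorm_pos x)) andbT lerNl -fN.
  by apply: le_trans (fp _) _; rewrite -[leRHS]normrN blnorm_pos.
have fF : (f : D -> R^o) \in @is_functional R D.
  by apply/is_functionalP => //; exists 1.
exists (Dual fF); split=> /=.
- apply/dual_leP => x x0 /=.
  have := fp (- x); rewrite blpos_npos; last by rewrite -oppr0 blN.
  rewrite normr0 -scaleN1r -[-1 *: x]addr0 fl mulN1r.
  have f0 : f 0 = 0 by have := fl 1 0 0; rewrite scaler0 addr0 mul1r; lra.
  by rewrite f0 addr0 oppr_le0.
- by apply: dual_norm_le.
- by rewrite fv blpos_id.
Qed.

End banach_lattice_extra.

(** * The weak type inequality for dyadic step functions *)
Section lattice_extra.
Context {R : realType} {E : banachLatticeType R}.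
Implicit Types x y : E.

Lemma bl_add_ge0 x y : 0 <= x -> 0 <= y -> 0 <= x + y.
Proof. by move=> x0 y0; rewrite -(addr0 0); exact: blD. Qed.

Lemma bl_scale_ge0 (a : R) x : 0 <= a -> 0 <= x -> 0 <= a *: x.
Proof. by move=> a0 x0; rewrite -(scaler0 _ a); exact: blZ2l. Qed.

Lemma bl_sum_ge0 I (r : seq I) (P : pred I) (F : I -> E) :
  (forall i, P i -> 0 <= F i) -> 0 <= \sum_(i <- r | P i) F i.
Proof. by move=> F0; elim/big_ind: _ => //; exact: bl_add_ge0. Qed.

Lemma bl_join_ge0 x y : 0 <= x -> 0 <= Order.join x y.
Proof. by move=> x0; rewrite (le_trans x0)// leUl. Qed.

Lemma join0_pos x : 0 <= x -> Order.join (0 : E) x = x.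
Proof. exact: join_r. Qed.

End lattice_extra.

Section tree.
Context {R : realType} {E : banachLatticeType R}.

(** A function on the unit interval that is constant on dyadic intervals,
    together with the way these intervals arise by successive halving. *)
Inductive tree := Leaf of E | Node of tree & tree.

Implicit Types (s x : E) (t l r : tree) (g h : E -> R).

Fixpoint tree_mean t : E :=
  match t with
  | Leaf x => x
  | Node l r => 2^-1 *: (tree_mean l + tree_mean r)
  end.

Fixpoint tree_pos t : Prop :=
  match t with Leaf x => 0 <= x | Node l r => tree_pos l /\ tree_pos r end.

Fixpoint tree_avg g t : R :=
  match t with
  | Leaf x => g x
  | Node l r => 2^-1 * (tree_avg g l + tree_avg g r)
  end.

(** The mean of [g] composed with the lattice maximal function, joined with [s].
    The accumulator [s] makes the recursion possible: it stores the join of the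
    averages over the larger intervals. *)
Fixpoint tree_max g s t : R :=
  match t with
  | Leaf x => g (Order.join s x)
  | Node l r =>
    let s' := Order.join s (2^-1 *: (tree_mean l + tree_mean r)) in
    2^-1 * (tree_max g s' l + tree_max g s' r)
  end.

(** With this integrand [tree_max] is the measure of a superlevel set of the
    lattice maximal function. *)
Definition norm_gt (lambda : R) x : R := ((lambda < `|x|)%R : bool)%:R.

Lemma tree_mean_ge0 t : tree_pos t -> 0 <= tree_mean t.
Proof.
elim: t => //= l IHl r IHr [/IHl l0 /IHr r0].
by apply: bl_scale_ge0; [rewrite invr_ge0|exact: bl_add_ge0].
Qed.

Lemma tree_avg_ge0 g t : (forall x, 0 <= g x) -> 0 <= tree_avg g t.
Proof.
by move=> g0; elim: t => //= l IHl r IHr; rewrite mulr_ge0 ?invr_ge0// addr_ge0.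
Qed.

Lemma le_tree_max g h s t :
  (forall x, g x <= h x) -> tree_max g s t <= tree_max h s t.
Proof.
move=> gh; elim: t s => [x|l IHl r IHr] s //=.
by rewrite ler_wpM2l ?invr_ge0// lerD.
Qed.

Lemma tree_maxZ (a : R) g s t :
  tree_max (fun x => a * g x) s t = a * tree_max g s t.
Proof.
elim: t s => [x|l IHl r IHr] s //=.
by rewrite IHl IHr -mulrDr mulrCA.
Qed.

Lemma tree_max_ge0 g s t : (forall x, 0 <= g x) -> 0 <= tree_max g s t.
Proof.
move=> g0; elim: t s => [x|l IHl r IHr] s //=.
by rewrite mulr_ge0 ?invr_ge0// addr_ge0.
Qed.

Lemma tree_max_le1 g s t : (forall x, g x <= 1) -> tree_max g s t <= 1.
Proof.
move=> g1; elim: t s => [x|l IHl r IHr] s //=.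
by rewrite ler_pdivrMl// mulr1 -[leRHS]/(1 + 1) lerD.
Qed.

Lemma tree_max_homo g s s' t :
  (forall x y, 0 <= x -> x <= y -> g x <= g y) ->
  0 <= s -> s <= s' -> tree_max g s t <= tree_max g s' t.
Proof.
move=> gh; elim: t s s' => [x|l IHl r IHr] s s' s0 ss' /=.
  by apply: gh; [exact: bl_join_ge0|exact: leU2].
rewrite ler_wpM2l ?invr_ge0// lerD//.
  by apply: IHl; [exact: bl_join_ge0|exact: leU2].
by apply: IHr; [exact: bl_join_ge0|exact: leU2].
Qed.

Lemma tree_max_join_mean g s t :
  tree_max g (Order.join s (tree_mean t)) t = tree_max g s t.
Proof. by case: t => [x|l r] /=; rewrite -joinA joinxx. Qed.

Lemma norm_gt_ge0 lambda x : 0 <= norm_gt lambda x.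
Proof. exact: ler0n. Qed.

Lemma norm_gt_le1 lambda x : norm_gt lambda x <= 1.
Proof. by rewrite /norm_gt; case: ltP => // _; rewrite ler01. Qed.

Lemma norm_gt_homo lambda x y : 0 <= x -> x <= y ->
  norm_gt lambda x <= norm_gt lambda y.
Proof.
move=> x0 xy; rewrite /norm_gt; case: (ltP lambda `|x|) => [lx|_ //].
by rewrite (lt_le_trans lx)// blnorm_mono.
Qed.

Lemma norm_tree_mean t : `|tree_mean t| <= tree_avg Num.norm t.
Proof.
elim: t => //= l IHl r IHr; rewrite normrZ ger0_norm ?invr_ge0//.
by rewrite ler_wpM2l ?invr_ge0// (le_trans (ler_normD _ _))// lerD.
Qed.

(** The good part of the Calderon--Zygmund decomposition at height
    [lambda]. *)
Fixpoint tree_good (lambda : R) t : tree :=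
  if lambda < tree_avg Num.norm t then Leaf (tree_mean t) else
  match t with
  | Leaf x => Leaf x
  | Node l r => Node (tree_good lambda l) (tree_good lambda r)
  end.

(** The measure of the exceptional set, where the good part differs from the
    original function. *)
Fixpoint tree_bad (lambda : R) t : R :=
  if lambda < tree_avg Num.norm t then 1 else
  match t with
  | Leaf x => 0
  | Node l r => 2^-1 * (tree_bad lambda l + tree_bad lambda r)
  end.

Lemma tree_good_mean lambda t : tree_mean (tree_good lambda t) = tree_mean t.
Proof. by elim: t => [x|l IHl r IHr] /=; case: ifPn => //= _; rewrite IHl IHr. Qed.

Lemma tree_good_pos lambda t : tree_pos t -> tree_pos (tree_good lambda t).
Proof.
elim: t => [x|l IHl r IHr] /=; first by case: ifP.
move=> [l0 r0]; case: ifP => _ /=; last by split; [exact: IHl|exact: IHr].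
exact: (@tree_mean_ge0 (Node l r)).
Qed.

Lemma tree_bad_le lambda t : 0 <= lambda ->
  lambda * tree_bad lambda t <= tree_avg Num.norm t.
Proof.
move=> l0; elim: t => [x|l IHl r IHr] /=.
  by case: ltP => [/ltW|_]; rewrite ?mulr1// mulr0.
case: ltP => [/ltW|_]; rewrite ?mulr1//.
by rewrite mulrCA ler_wpM2l ?invr_ge0// mulrDr lerD.
Qed.

Lemma tree_max_good lambda mu s t :
  tree_max (norm_gt mu) s t <=
  tree_max (norm_gt mu) s (tree_good lambda t) + tree_bad lambda t.
Proof.
have m0 s' t' := @tree_max_ge0 (norm_gt mu) s' t' (norm_gt_ge0 mu).
have m1 s' t' := @tree_max_le1 (norm_gt mu) s' t' (norm_gt_le1 mu).
elim: t s => [x|l IHl r IHr] s /=.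
  by case: ifP => _ /=; rewrite ?addr0// lerDl.
case: ifP => _; first by rewrite -[leLHS]add0r lerD//; exact: (@m1 s (Node l r)).
rewrite /= !tree_good_mean -mulrDr ler_wpM2l ?invr_ge0//.
by rewrite addrACA lerD.
Qed.

(** A node that is not stopped has average at most [lambda], so that its halves
    have averages at most [2 * lambda]: this is where the doubling property of
    halvings enters. *)
Lemma tree_good_powR (p lambda : R) t : 1 < p -> 0 < lambda ->
  tree_avg Num.norm t <= 2 * lambda ->
  tree_avg (fun x => `|x| `^ p) (tree_good lambda t) <=
  (2 * lambda) `^ (p - 1) * tree_avg Num.norm t.
Proof.
move=> p1 l0.
have p0 : 0 < p by exact: lt_trans p1.
have pw x (a : R) : `|x| <= a -> a <= 2 * lambda ->
    `|x| `^ p <= (2 * lambda) `^ (p - 1) * a.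
  move=> xa a2; rewrite -mulr_powRB1// mulrC; apply: ler_pM => //.
  apply: ge0_ler_powR; rewrite ?nnegrE ?subr_ge0 ?(ltW p1) ?mulr_ge0 ?(ltW l0)//.
  exact: le_trans a2.
elim: t => [x|l IHl r IHr] /= h; first by case: ifP => _ /=; exact: pw.
case: ltP => /= h'; first by apply: pw => //; exact: (@norm_tree_mean (Node l r)).
rewrite mulrCA ler_wpM2l ?invr_ge0// mulrDr.
have l0' := @tree_avg_ge0 Num.norm l (@normr_ge0 _ _).
have r0' := @tree_avg_ge0 Num.norm r (@normr_ge0 _ _).
by rewrite lerD ?IHl ?IHr//; lra.
Qed.

Definition tree_strong_type (p K : R) := forall t, tree_pos t ->
  tree_max (fun x => `|x| `^ p) 0 t <= K * tree_avg (fun x => `|x| `^ p) t.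

Definition tree_weak_type (A : R) := forall (lambda : R) t, 0 < lambda -> tree_pos t ->
  tree_max (norm_gt lambda) 0 t <= A / lambda * tree_avg Num.norm t.

(** Off the exceptional set the maximal function only sees the good part,
    which is bounded by twice the height. *)
Lemma tree_weak_of_strong (p K : R) : 1 < p -> 0 <= K ->
  tree_strong_type p K -> tree_weak_type (K * 2 `^ (p - 1) + 1).
Proof.
move=> p1 K0 HK lambda t l0 t0.
have p0 : 0 < p by exact: lt_trans p1.
have A1 : 1 <= K * 2 `^ (p - 1) + 1 by rewrite lerDr mulr_ge0// powR_ge0.
set a := tree_avg _ t; have [al|la] := leP a lambda; last first.
  apply: le_trans (@tree_max_le1 _ _ _ (norm_gt_le1 lambda)) _.
  rewrite mulrAC ler_pdivlMr// mul1r (le_trans (ltW la))//.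
  by apply: ler_peMl => //; apply: ltW; exact: lt_trans la.
rewrite (le_trans (@tree_max_good lambda _ _ _))//.
rewrite !mulrDl div1r lerD//; last first.
  by rewrite ler_pdivlMl//; apply: tree_bad_le; exact: ltW.
have lp0 : 0 < lambda `^ p by rewrite powR_gt0.
have Markov : tree_max (norm_gt lambda) 0 (tree_good lambda t) <=
    (lambda `^ p)^-1 * tree_max (fun x => `|x| `^ p) 0 (tree_good lambda t).
  rewrite -tree_maxZ; apply: le_tree_max => x; rewrite /norm_gt ler_pdivlMl//.
  case: ltP => [lx|_]; last by rewrite mulr0 powR_ge0.
  by rewrite mulr1; apply: ge0_ler_powR; rewrite ?nnegrE ?(ltW p0) ?(ltW l0) ?(ltW lx).
apply: le_trans Markov _; rewrite ler_pdivrMl//.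
apply: le_trans (HK _ (tree_good_pos _ t0)) _.
have := @tree_good_powR p lambda t p1 l0; rewrite -/a => h.
apply: le_trans (ler_wpM2l K0 (h _)) _; first by rewrite (le_trans al)// ler_peMl ?(ltW l0)// ler1n.
rewrite powRM ?(ltW l0)// -(@mulr_powRB1 _ lambda p) ?(ltW l0)//.
rewrite le_eqVlt; apply/predU1P; left.
by field; rewrite gt_eqF.
Qed.

(** * The Bellman function *)
Section bellman.
Variables (lambda c : R).
Hypothesis c0 : 0 <= c.
Hypothesis weak : forall t, tree_pos t ->
  tree_max (norm_gt lambda) 0 t <= c * tree_avg Num.norm t.

(** The Bellman function of the weak type inequality: the largest excess over
    the claimed bound among all dyadic functions of mean [x], when the maximal
    function has already reached [s]. *)
Definition bellman s x : R :=
  sup [set tree_max (norm_gt lambda) s t - c * tree_avg Num.norm t |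
       t in [set t | tree_pos t /\ tree_mean t = x]].

Lemma bellman_ge s t : tree_pos t ->
  tree_max (norm_gt lambda) s t - c * tree_avg Num.norm t <=
  bellman s (tree_mean t).
Proof.
move=> t0; apply: ub_le_sup; last by exists t.
exists 1 => _ [u [u0 _] <-]; rewrite lerBlDr -[leLHS]addr0 lerD//.
  exact/tree_max_le1/norm_gt_le1.
by rewrite mulr_ge0// tree_avg_ge0.
Qed.

Lemma bellman_le s x (M : R) : 0 <= x ->
  (forall t, tree_pos t -> tree_mean t = x ->
    tree_max (norm_gt lambda) s t - c * tree_avg Num.norm t <= M) ->
  bellman s x <= M.
Proof.
move=> x0 tM; apply: ge_sup; last by move=> _ [t [t0 tx] <-]; exact: tM.
by eexists; exists (Leaf x); split.
Qed.

Lemma bellman_diag_le0 x : 0 <= x -> bellman x x <= 0.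
Proof.
move=> x0; apply: bellman_le => // t t0 tx.
by rewrite -tx -{1}(join0_pos (tree_mean_ge0 t0)) tree_max_join_mean subr_le0 weak.
Qed.

(** The mean of a function belongs to its lattice maximal function anyway. *)
Lemma bellman_join s x : bellman (Order.join s x) x = bellman s x.
Proof.
rewrite /bellman; congr sup; apply/seteqP.
by split=> _ [t [t0 tx] <-]; exists t => //; rewrite -{1}tx tree_max_join_mean.
Qed.

Lemma bellman_lower s x : 0 <= s -> 0 <= x ->
  norm_gt lambda s - c * `|x| <= bellman s x.
Proof.
move=> s0 x0; apply: le_trans (@bellman_ge s (Leaf x) x0); rewrite /= lerD2r.
by apply: norm_gt_homo => //; exact: leUl.
Qed.

(** Nearly extremal trees for [x] and [y], placed side by side, form a competitor
    for the midpoint. *)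
Lemma bellman_midpoint s x y : 0 <= s -> 0 <= x -> 0 <= y ->
  2^-1 * (bellman s x + bellman s y) <= bellman s (2^-1 *: (x + y)).
Proof.
move=> s0 x0 y0; rewrite ler_pdivrMl// -lerBrDr.
apply: bellman_le => // t t0 tx; rewrite lerBrDr -lerBrDl.
apply: bellman_le => // u u0 uy; rewrite lerBrDl -ler_pdivrMl//.
have := @bellman_ge s (Node t u) (conj t0 u0); rewrite /= tx uy.
apply: le_trans; set s' := Order.join s _.
have tt : tree_max (norm_gt lambda) s t <= tree_max (norm_gt lambda) s' t.
  by apply: tree_max_homo (leUl _ _) => //; exact: norm_gt_homo.
have uu : tree_max (norm_gt lambda) s u <= tree_max (norm_gt lambda) s' u.
  by apply: tree_max_homo (leUl _ _) => //; exact: norm_gt_homo.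
lra.
Qed.

(** The defect of concavity along a segment vanishes at the ends; midpoint
    concavity bounds its value at a point from below by half of its value at
    another point, so that its infimum is nonnegative. *)
Lemma bellman_concave s x y (a : R) : 0 <= s -> 0 <= x -> 0 <= y -> 0 <= a <= 1 ->
  a * bellman s x + (1 - a) * bellman s y <= bellman s (a *: x + (1 - a) *: y).
Proof.
move=> s0 x0 y0 a01.
pose z (b : R) : E := b *: x + (1 - b) *: y.
pose phi b := bellman s (z b) - (b * bellman s x + (1 - b) * bellman s y).
have z0 b : 0 <= b <= 1 -> 0 <= z b.
  move=> /andP[b0 b1]; apply: bl_add_ge0; apply: bl_scale_ge0 => //.
  by rewrite subr_ge0.
pose S := [set phi b | b in [set b | 0 <= b <= 1]].
have lbS : has_lbound S.
  exists (- (c * (`|x| + `|y|)) - (`|bellman s x| + `|bellman s y|)).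
  move=> _ [b /= b01 <-].
  have b1 : `|b| <= 1 by rewrite ler_norml; lra.
  have b1' : `|1 - b| <= 1 by rewrite ler_norml; lra.
  apply: lerD.
    apply: le_trans (bellman_lower s0 (z0 _ b01)).
    rewrite -[leLHS]add0r lerD ?norm_gt_ge0// lerN2 ler_wpM2l//.
    by rewrite (le_trans (ler_normD _ _))// !normrZ lerD// ler_piMl.
  rewrite lerN2 (le_trans (ler_norm _))// (le_trans (ler_normD _ _))//.
  by rewrite !normrM lerD// ler_piMl.
have phi_ge b : 0 <= b <= 1 -> inf S <= phi b.
  by move=> b01; apply: ge_inf => //; exists b.
have half b : 0 <= b <= 1 -> 2^-1 * inf S <= phi b.
  move=> /[dup] b01 /andP[b0 b1]; have [b2|b2] := leP b 2^-1.
    have b'01 : 0 <= 2 * b <= 1 by lra.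
    have := phi_ge _ b'01; have := bellman_midpoint s0 (z0 _ b'01) y0.
    have -> : 2^-1 *: (z (2 * b) + y) = z b.
      rewrite /z -[X in _ + X]scale1r -addrA -scalerDl scalerDr !scalerA.
      by congr (_ *: _ + _ *: _); field.
    rewrite /phi; lra.
  have b'01 : 0 <= 2 * b - 1 <= 1 by lra.
  have := phi_ge _ b'01; have := bellman_midpoint s0 (z0 _ b'01) x0.
  have -> : 2^-1 *: (z (2 * b - 1) + x) = z b.
    rewrite /z -[X in _ + X]scale1r addrAC -scalerDl scalerDr !scalerA.
    by congr (_ *: _ + _ *: _); field.
  rewrite /phi; lra.
have : 2^-1 * inf S <= inf S.
  apply: lb_le_inf; first by exists (phi 0), 0 => //=; rewrite lexx ler01.
  by move=> _ [b b01 <-]; exact: half.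
by have := phi_ge _ a01; rewrite /phi /z; lra.
Qed.

End bellman.

End tree.

(** Jensen's inequality; the weights are masses instead of probabilities, hence
    the normalization by their sum. *)
Lemma concave_jensen (R : realType) (E : banachLatticeType R) (G : E -> R)
    (I : Type) (r : seq I) (P : pred I) (m : I -> R) (x : I -> E) :
  (forall u v (a : R), 0 <= u -> 0 <= v -> 0 <= a <= 1 ->
    a * G u + (1 - a) * G v <= G (a *: u + (1 - a) *: v)) ->
  (forall i, 0 <= m i) -> (forall i, 0 <= x i) ->
  \sum_(i <- r | P i) m i * G (x i) <=
  (\sum_(i <- r | P i) m i) *
  G ((\sum_(i <- r | P i) m i)^-1 *: \sum_(i <- r | P i) m i *: x i).
Proof.
move=> Gc m0 x0.
suff [] : [/\ 0 <= \sum_(i <- r | P i) m i, 0 <= \sum_(i <- r | P i) m i *: x i,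
  (\sum_(i <- r | P i) m i = 0 -> \sum_(i <- r | P i) m i *: x i = 0) &
  \sum_(i <- r | P i) m i * G (x i) <= (\sum_(i <- r | P i) m i) *
  G ((\sum_(i <- r | P i) m i)^-1 *: \sum_(i <- r | P i) m i *: x i)] by [].
elim: r => [|i r [M0 S0 MS IH]]; first by rewrite !big_nil mul0r.
rewrite !big_cons; case: ifP => // _.
set M := \sum_(i <- r | P i) m i in M0 MS IH *.
set S := \sum_(i <- r | P i) m i *: x i in S0 MS IH *.
set T := \sum_(i <- r | P i) _ in IH *.
split; [exact: addr_ge0|by apply: bl_add_ge0 => //; exact: bl_scale_ge0| |].
  move=> /eqP; rewrite paddr_eq0// => /andP[/eqP -> /eqP/MS ->].
  by rewrite scale0r addr0.
have [mi0|mi0] := eqVneq (m i) 0.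
  by rewrite mi0 !mul0r scale0r !add0r.
have mip : 0 < m i by rewrite lt_neqAle eq_sym mi0 m0.
have M'0 : 0 < m i + M by rewrite ltr_wpDr.
have M'n : m i + M != 0 by rewrite gt_eqF.
have := Gc (x i) (M^-1 *: S) (m i / (m i + M)) (x0 i).
have -> : 1 - m i / (m i + M) = M / (m i + M) by field.
rewrite bl_scale_ge0 ?invr_ge0// divr_ge0 ?(ltW M'0)// ler_pdivrMr// mul1r lerDl M0.
move=> /(_ isT isT); rewrite scalerA.
have -> : (m i / (m i + M)) *: x i + (M / (m i + M) / M) *: S =
    (m i + M)^-1 *: (m i *: x i + S).
  rewrite scalerDr scalerA; congr (_ + _); first by rewrite mulrC.
  have [/[dup] M00 /MS ->|Mn] := eqVneq M 0; first by rewrite !scaler0.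
  by congr (_ *: _); field; rewrite M'n Mn.
rewrite -(ler_pM2l M'0) => h; apply: le_trans h.
rewrite mulrDr [X in _ <= X + _]mulrA [X in _ <= _ + X]mulrA.
by rewrite ![(m i + M) * (_ / _)]mulrC !divfK// lerD2l.
Qed.

(** * Filtrations of finite measure spaces *)
Section pos_join.
Context {R : realType} {E : banachLatticeType R}.
Implicit Types (P Q : pred nat) (a b : nat -> E).

(** A Banach lattice has no bottom; among nonnegative elements [0] takes its
    place. *)
Fixpoint pos_join (P : pred nat) (a : nat -> E) n : E :=
  if n is k.+1 then
    if P k then Order.join (pos_join P a k) (a k) else pos_join P a k
  else 0.

Lemma pos_join_ge0 P a n : 0 <= pos_join P a n.
Proof. by elim: n => //= n IH; case: ifP => // _; exact: bl_join_ge0. Qed.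

Lemma pos_join_ub P a n i : (i < n)%N -> P i -> a i <= pos_join P a n.
Proof.
elim: n => // n IH; rewrite ltnS leq_eqVlt => /predU1P[->|/IH {}IH] /= Pi.
  by rewrite Pi leUr.
by case: ifP => _; [exact: le_trans (IH Pi) (leUl _ _)|exact: IH].
Qed.

Lemma pos_join_le P a n (b : E) : 0 <= b ->
  (forall i, (i < n)%N -> P i -> a i <= b) -> pos_join P a n <= b.
Proof.
move=> b0; elim: n => //= n IH ab.
have {}IH : pos_join P a n <= b by apply: IH => i /ltnW; exact: ab.
by case: ifP => // Pn; rewrite leUx IH ab.
Qed.

Lemma eq_pos_join P Q a b n : (forall i, (i < n)%N -> P i = Q i) ->
  (forall i, (i < n)%N -> P i -> a i = b i) -> pos_join P a n = pos_join Q b n.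
Proof.
elim: n => //= n IH PQ ab; rewrite (PQ n)// IH.
- by case: ifPn => // Qn; rewrite ab// PQ.
- by move=> i /ltnW; exact: PQ.
- by move=> i /ltnW; exact: ab.
Qed.

End pos_join.

(** The points of [X] are atoms, [anc k x] is the cube of level [k] that contains
    the atom [x], and all sums over a cube are sums over the atoms with the same
    ancestor. *)
Section filtration.
Context {R : realType} {X : finType} {I : eqType}.
Variables (m : X -> R) (anc : nat -> X -> I).
Hypothesis m0 : forall x, 0 <= m x.
Hypothesis anc_nested : forall k x y, anc k.+1 x = anc k.+1 y -> anc k x = anc k y.

Lemma anc_le j k x y : (j <= k)%N -> anc k x = anc k y -> anc j x = anc j y.
Proof.
move=> jk; rewrite -(subnKC jk); elim: (k - j)%N => [|d IH]; first by rewrite addn0.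
by rewrite addnS => /anc_nested.
Qed.

(** Measurability with respect to the algebra of the given level. *)
Definition adapted k {Y : Type} (u : X -> Y) :=
  forall x y, anc k x = anc k y -> u x = u y.

Lemma adapted_le j k Y (u : X -> Y) : (j <= k)%N -> adapted j u -> adapted k u.
Proof. by move=> jk uj x y /(anc_le jk); exact: uj. Qed.

Lemma adapted_class j x : adapted j (fun y => anc j y == anc j x).
Proof. by move=> y z ->. Qed.

Definition mass k x : R := \sum_(y | anc k y == anc k x) m y.

Section vector.
Context {V : lmodType R}.
Implicit Types u v : X -> V.

Definition wsum k v x : V := \sum_(y | anc k y == anc k x) m y *: v y.

Definition avg k v x : V := (mass k x)^-1 *: wsum k v x.

Lemma wsum_adapted k v : adapted k (wsum k v).
Proof. by move=> x y xy; rewrite /wsum xy. Qed.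

Lemma mass_adapted k : adapted k (mass k).
Proof. by move=> x y xy; rewrite /mass xy. Qed.

Lemma avg_adapted k v : adapted k (avg k v).
Proof. by move=> x y xy; rewrite /avg (mass_adapted xy) (wsum_adapted v xy). Qed.

Lemma mass_ge0 k x : 0 <= mass k x.
Proof. exact: sumr_ge0. Qed.

Lemma mass0 k x y : mass k x = 0 -> anc k y = anc k x -> m y = 0.
Proof.
move=> /eqP; rewrite psumr_eq0// => /allP/(_ y (mem_index_enum _)) /implyP h.
by move=> /eqP/h/eqP.
Qed.

Lemma mass_avg k v x : mass k x *: avg k v x = wsum k v x.
Proof.
have [M0|M0] := eqVneq (mass k x) 0; last by rewrite /avg scalerA divff ?scale1r.
rewrite M0 scale0r /wsum big1// => y /eqP yx.
by rewrite (mass0 M0 yx) scale0r.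
Qed.

Lemma eq_wsum k u v x :
  (forall y, anc k y = anc k x -> u y = v y) -> wsum k u x = wsum k v x.
Proof. by move=> uv; apply: eq_bigr => y /eqP/uv ->. Qed.

Lemma wsumZ k (w : X -> R) v x : adapted k w ->
  wsum k (fun y => w y *: v y) x = w x *: wsum k v x.
Proof.
move=> wk; rewrite /wsum scaler_sumr; apply: eq_bigr => y /eqP /wk ->.
by rewrite !scalerA mulrC.
Qed.

(** The tower property of conditional expectations. *)
Lemma sum_avg k (P : pred X) v : adapted k P ->
  \sum_(y | P y) m y *: avg k v y = \sum_(y | P y) m y *: v y.
Proof.
move=> Pk; under eq_bigr do rewrite /avg /wsum 2!scaler_sumr.
rewrite (exchange_big_dep P)/=; last by move=> y z Py /eqP /Pk ->.
apply: eq_bigr => z Pz.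
transitivity ((\sum_(y | anc k y == anc k z) m y / mass k z) *: (m z *: v z)).
  rewrite scaler_suml; apply: eq_big => y.
    by rewrite eq_sym; case: eqP => yz; rewrite ?andbF// andbT (Pk _ _ yz).
  by move=> /andP[_ /eqP zy]; rewrite (mass_adapted zy) !scalerA.
rewrite -mulr_suml -/(mass k z).
have [M0|M0] := eqVneq (mass k z) 0; last by rewrite divff// scale1r.
by rewrite (mass0 M0 erefl) scale0r scaler0.
Qed.

Lemma wsum_avg j k v x : (j <= k)%N -> wsum j (avg k v) x = wsum j v x.
Proof. by move=> jk; apply: sum_avg; exact: adapted_le (adapted_class x). Qed.

Lemma avg_avg j k v x : (j <= k)%N -> avg j (avg k v) x = avg j v x.
Proof. by move=> jk; rewrite /avg -/(avg k v) wsum_avg. Qed.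

End vector.

Definition ravg k (u : X -> R) : X -> R := @avg R^o k u.

Lemma ravgE k u x : ravg k u x = (mass k x)^-1 * \sum_(y | anc k y == anc k x) m y * u y.
Proof. by []. Qed.

Lemma ravg_ge0 k u x : (forall y, 0 <= u y) -> 0 <= ravg k u x.
Proof.
move=> u0; rewrite ravgE mulr_ge0 ?invr_ge0 ?mass_ge0// sumr_ge0// => y _.
exact: mulr_ge0.
Qed.

Lemma mass_ravg k u x :
  mass k x * ravg k u x = \sum_(y | anc k y == anc k x) m y * u y.
Proof. exact: (@mass_avg R^o). Qed.

Lemma sum_ravg k (P : pred X) u : adapted k P ->
  \sum_(y | P y) m y * ravg k u y = \sum_(y | P y) m y * u y.
Proof. exact: (@sum_avg R^o). Qed.

(** Both sides are unchanged when the integrands are replaced by their averages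
    over cubes. *)
Lemma sum_le_classwise k (P : pred X) (u v : X -> R) : adapted k P ->
  (forall x, P x -> \sum_(y | anc k y == anc k x) m y * u y <=
                    \sum_(y | anc k y == anc k x) m y * v y) ->
  \sum_(y | P y) m y * u y <= \sum_(y | P y) m y * v y.
Proof.
move=> Pk uv; rewrite -(sum_ravg u Pk) -(sum_ravg v Pk); apply: ler_sum => x Px.
by rewrite ler_wpM2l// !ravgE ler_wpM2l ?invr_ge0 ?mass_ge0// uv.
Qed.

Lemma sum_ravg_adapted k (P : pred X) (u w : X -> R) : adapted k P -> adapted k w ->
  \sum_(y | P y) m y * (ravg k u y * w y) = \sum_(y | P y) m y * (u y * w y).
Proof.
move=> Pk wk; rewrite -(@sum_ravg k P (fun y => u y * w y))//.
apply: eq_bigr => y _; congr (_ * _).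
transitivity (w y * ravg k u y); first by rewrite mulrC.
rewrite !ravgE mulrCA; congr (_ * _); rewrite mulr_sumr.
by apply: eq_bigr => z /eqP /wk ->; rewrite mulrCA [w y * _]mulrC.
Qed.

Section lattice_valued.
Context {E : banachLatticeType R}.
Implicit Types u v : X -> E.

Lemma wsum_ge0 k v x : (forall y, 0 <= v y) -> 0 <= wsum k v x.
Proof. by move=> v0; apply: bl_sum_ge0 => y _; exact: bl_scale_ge0. Qed.

Lemma avg_ge0 k v x : (forall y, 0 <= v y) -> 0 <= avg k v x.
Proof.
by move=> v0; apply: bl_scale_ge0; rewrite ?invr_ge0 ?mass_ge0//; exact: wsum_ge0.
Qed.

Lemma bl_ler_sum J (r : seq J) (P : pred J) (F G : J -> E) :
  (forall i, P i -> F i <= G i) -> \sum_(i <- r | P i) F i <= \sum_(i <- r | P i) G i.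
Proof. by move=> FG; elim/big_ind2: _ => // x1 y1 x2 y2; exact: blD. Qed.

Lemma le_wsum k u v x : (forall y, anc k y = anc k x -> u y <= v y) ->
  wsum k u x <= wsum k v x.
Proof. by move=> uv; apply: bl_ler_sum => y /eqP /uv; exact: blZ2l. Qed.

Lemma norm_avg k v x : `|avg k v x| <= ravg k (fun y => `|v y|) x.
Proof.
rewrite /avg normrZ ger0_norm ?invr_ge0 ?mass_ge0// ravgE.
rewrite ler_wpM2l ?invr_ge0 ?mass_ge0// (le_trans (ler_norm_sum _ _ _))//.
by apply: ler_sum => y _; rewrite normrZ ger0_norm.
Qed.

Definition chain_join v j k x : E :=
  pos_join (leq j) (fun i => avg i v x) k.+1.

Lemma chain_join_adapted v j k : adapted k (chain_join v j k).
Proof.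
move=> x y xy; apply: eq_pos_join => // i; rewrite ltnS => ik _.
exact/avg_adapted/(anc_le ik xy).
Qed.

Lemma chain_join_diag v j x : (forall y, 0 <= v y) ->
  chain_join v j j x = avg j v x.
Proof.
move=> v0; rewrite /chain_join /= leqnn.
suff -> : pos_join (leq j) (fun i => avg i v x) j = 0 by rewrite join0_pos// avg_ge0.
apply/le_anti; rewrite pos_join_ge0 andbT; apply: pos_join_le => // i ij.
by rewrite leqNgt ij.
Qed.

Lemma chain_join_homo v j k l x : (k <= l)%N -> chain_join v j k x <= chain_join v j l x.
Proof.
move=> kl; apply: pos_join_le => [|i ik ji]; first exact: pos_join_ge0.
by apply: pos_join_ub => //; exact: leq_trans kl.
Qed.

(** The Bellman function is concave, so that it decreases along the filtration:
    this transfers the weak type inequality from halvings to arbitrary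
    proportions. *)
Lemma maximal_weak_type (A lambda : R) v j N x : 0 <= A -> 0 < lambda ->
  @tree_weak_type R E A -> (forall y, 0 <= v y) -> (j <= N)%N ->
  \sum_(y | anc j y == anc j x) m y * norm_gt lambda (chain_join v j N y) <=
  A / lambda * \sum_(y | anc j y == anc j x) m y * `|v y|.
Proof.
move=> A0 l0 weak v0 jN.
set c := A / lambda; have c0 : 0 <= c by rewrite divr_ge0// ltW.
have {}weak t : tree_pos t -> tree_max (norm_gt lambda) 0 t <= c * tree_avg Num.norm (t : @tree R E).
  by move=> t0; exact: weak.
pose G := @bellman R E lambda c.
pose S n y := pos_join (leq j) (fun i => avg i v y) n.
have S0 n y : 0 <= S n y by exact: pos_join_ge0.
have SE n y : (j <= n)%N -> S n.+1 y = Order.join (S n y) (avg n v y).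
  by move=> jn; rewrite /S /= jn.
have Sad n : adapted n (S n.+1) by exact: chain_join_adapted.
have jensen n (u : X -> E) : (j <= n)%N -> (forall y, 0 <= u y) ->
    \sum_(y | anc j y == anc j x) m y * G (S n.+1 y) (u y) <=
    \sum_(y | anc j y == anc j x) m y * G (S n.+1 y) (avg n u y).
  move=> jn u0; apply: (@sum_le_classwise n).
    exact: adapted_le (adapted_class x).
  move=> z _.
  rewrite (eq_bigr (fun y => m y * G (S n.+1 z) (u y))); last first.
    by move=> y /eqP yz; rewrite (Sad _ _ _ yz).
  rewrite [leRHS](eq_bigr (fun y => m y * G (S n.+1 z) (avg n u z))); last first.
    by move=> y /eqP yz; rewrite (Sad _ _ _ yz) (avg_adapted u yz).
  rewrite -mulr_suml; apply: concave_jensen => // a b t a0 b0 t01.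
  exact: bellman_concave.
have start : \sum_(y | anc j y == anc j x) m y * G (S j.+1 y) (avg j v y) <= 0.
  apply: sumr_le0 => y _; rewrite mulr_ge0_le0//.
  have -> : S j.+1 y = avg j v y by exact: chain_join_diag.
  by apply: bellman_diag_le0 => //; exact: avg_ge0.
have step n : (j <= n)%N ->
    \sum_(y | anc j y == anc j x) m y * G (S n.+1 y) (avg n v y) <= 0.
  move=> jn; rewrite -(subnKC jn); elim: (n - j)%N => [|d IH]; first by rewrite addn0.
  have jd : (j <= j + d)%N by exact: leq_addr.
  apply: le_trans IH; rewrite addnS.
  under eq_bigr do rewrite SE ?leqW// /G bellman_join.
  apply: le_trans (jensen _ _ jd _) _; first by move=> y; exact: avg_ge0.
  by under eq_bigr do rewrite avg_avg//.
have := le_trans (jensen N v jN v0) (step N jN); rewrite -subr_ge0 sub0r -sumrN => h.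
rewrite -subr_ge0 mulr_sumr -sumrB; apply: le_trans h _.
apply: ler_sum => y _; rewrite mulrCA -mulrBr -mulrN ler_wpM2l// lerNl opprB.
exact: (bellman_lower _ c0 (S0 N.+1 y) (v0 y)).
Qed.

(** The choice of the threshold behind the principal cubes: its exceptional set
    fills at most a quarter of the cube. Where the average of the norm vanishes,
    so do all the averages over smaller cubes. *)
Lemma maximal_weak_type_avg (A : R) v j N x : 0 < A ->
  @tree_weak_type R E A -> (forall y, 0 <= v y) -> (j <= N)%N ->
  \sum_(y | anc j y == anc j x) m y *
    norm_gt (4 * A * ravg j (fun z => `|v z|) x) (chain_join v j N y) <=
  4^-1 * mass j x.
Proof.
move=> A0 weak v0 jN; set t := ravg _ _ _.
have t0 : 0 <= t by exact: ravg_ge0.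
have [t00|tn0] := eqVneq t 0.
  have z0 : \sum_(y | anc j y == anc j x) m y * `|v y| = 0.
    by rewrite -mass_ravg -/t t00 mulr0.
  rewrite big1 ?mulr_ge0 ?invr_ge0 ?mass_ge0// => y /eqP yx.
  have vz z : anc j z = anc j x -> m z *: v z = 0.
    move=> /eqP zx; move/eqP: z0; rewrite psumr_eq0; last by move=> w _; exact: mulr_ge0.
    move=> /allP/(_ z (mem_index_enum _)); rewrite zx /= mulf_eq0 normr_eq0.
    by move=> /orP[/eqP ->|/eqP ->]; rewrite ?scale0r ?scaler0.
  have -> : chain_join v j N y = 0.
    apply/le_anti; rewrite pos_join_ge0 andbT; apply: pos_join_le => // i _ ji.
    rewrite /avg /wsum big1 ?scaler0// => z /eqP zy; apply: vz.
    by rewrite -yx; exact: anc_le zy.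
  by rewrite /norm_gt t00 mulr0 normr0 ltxx mulr0.
have tp : 0 < t by rewrite lt_neqAle eq_sym tn0.
have l0 : 0 < 4 * A * t by rewrite mulr_gt0 ?tp// mulr_gt0.
apply: le_trans (@maximal_weak_type A _ v j N x (ltW A0) l0 weak v0 jN) _.
rewrite -mass_ravg -/t le_eqVlt; apply/predU1P; left; field.
by rewrite !gt_eqF.
Qed.

End lattice_valued.
End filtration.

(** * Doob's maximal inequality *)
Section young.
Context {R : realType}.
Implicit Types a b p q d : R.

Lemma young_powR q a b : 1 < q -> 0 <= a -> 0 <= b ->
  q * (a * b `^ (q - 1)) <= a `^ q + (q - 1) * b `^ q.
Proof.
move=> q1 a0 b0; have q0 : 0 < q by exact: lt_trans q1.
have q10 : 0 < q - 1 by rewrite subr_gt0.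
have := @conjugate_powR R a (b `^ (q - 1)) q (q / (q - 1)) a0 (powR_ge0 _ _) q0.
rewrite divr_gt0// -powRrM mulrCA divff ?gt_eqF// mulr1 => /(_ isT).
have -> : q^-1 + (q / (q - 1))^-1 = 1 by field; rewrite !gt_eqF.
move=> /(_ erefl); rewrite -(ler_pM2l q0) => /le_trans; apply.
rewrite le_eqVlt; apply/predU1P; left; field; by rewrite !gt_eqF.
Qed.

Lemma young_delta_powR q a b d : 1 < q -> 0 <= a -> 0 <= b -> 0 < d ->
  a * b `^ (q - 1) <= d * b `^ q + d^-1 `^ (q - 1) * a `^ q.
Proof.
move=> q1 a0 b0 d0; have q0 : 0 < q by exact: lt_trans q1.
have q10 : 0 <= q - 1 by rewrite subr_ge0 ltW.
rewrite -(@mulr_powRB1 _ b q)// -(@mulr_powRB1 _ a q)//.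
have [ad|da] := leP a (d * b).
  rewrite -[leLHS]addr0 lerD//; last by rewrite !mulr_ge0 ?powR_ge0.
  by rewrite mulrA ler_wpM2r ?powR_ge0.
rewrite -[leLHS]add0r lerD//; first by rewrite !mulr_ge0 ?powR_ge0// ltW.
rewrite mulrCA ler_wpM2l// -powRM ?invr_ge0 ?(ltW d0)//.
apply: ge0_ler_powR; rewrite ?nnegrE ?mulr_ge0 ?invr_ge0 ?(ltW d0)//.
by rewrite ler_pdivlMl// ltW.
Qed.

(** The form that is fit for absorption, as [d] can be chosen small. *)
Lemma young_delta_conj q a b d : 1 < q -> 0 <= a -> 0 <= b -> 0 < d ->
  a * b <= d * b `^ (q / (q - 1)) + d^-1 `^ (q - 1) * a `^ q.
Proof.
move=> q1 a0 b0 d0; have q10 : 0 < q - 1 by rewrite subr_gt0.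
have := @young_delta_powR q a (b `^ (q - 1)^-1) d q1 a0 (powR_ge0 _ _) d0.
by rewrite -!powRrM mulVf ?gt_eqF// powRr1// [_^-1 * q]mulrC.
Qed.

End young.

Section doob.
Context {R : realType} {X : finType} {I : eqType}.
Variables (m : X -> R) (anc : nat -> X -> I).
Hypothesis m0 : forall x, 0 <= m x.
Hypothesis anc_nested : forall k x y, anc k.+1 x = anc k.+1 y -> anc k x = anc k y.

Fixpoint doob_max (h : X -> R) k x : R :=
  if k is j.+1 then Num.max (doob_max h j x) (ravg m anc k h x)
  else ravg m anc 0 h x.

Lemma doob_max_ge h i k x : (i <= k)%N -> ravg m anc i h x <= doob_max h k x.
Proof.
elim: k => [|k IH]; first by rewrite leqn0 => /eqP ->.
rewrite leq_eqVlt => /predU1P[->|/IH ih] /=; first by rewrite le_max lexx orbT.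
by rewrite le_max ih.
Qed.

Lemma doob_max_ge0 h k x : (forall y, 0 <= h y) -> 0 <= doob_max h k x.
Proof.
by move=> h0; apply: le_trans (doob_max_ge h x (leq0n k)); exact: ravg_ge0.
Qed.

Lemma doob_max_adapted h k : adapted anc k (doob_max h k).
Proof.
elim: k => [|k IH] x y xy /=; first exact: (@avg_adapted _ _ _ _ _ R^o).
by congr Num.max; [exact/IH/anc_nested|exact: (@avg_adapted _ _ _ _ _ R^o)].
Qed.

(** When the maximal function increases, its new value is the current average,
    so that the increment of its power is controlled by a martingale
    transform. *)
Lemma doob_step q (a b : R) : 1 < q -> 0 <= a -> 0 <= b ->
  Num.max a b `^ q - a `^ q <=
  q / (q - 1) * (b * (Num.max a b `^ (q - 1) - a `^ (q - 1))).
Proof.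
move=> q1 a0 b0; have q0 : 0 < q by exact: lt_trans q1.
have q10 : 0 < q - 1 by rewrite subr_gt0.
have [ba|ab] := leP b a; first by rewrite !subrr !mulr0.
rewrite mulrAC ler_pdivlMr// [b * _]mulrBr mulr_powRB1//.
have := young_powR q1 b0 a0; lra.
Qed.

(** Summation of the one-step inequality: the current average may be replaced by
    [h], because its cofactor is adapted. *)
Lemma doob_inequality_aux q h k : 1 < q -> (forall y, 0 <= h y) ->
  \sum_y m y * doob_max h k y `^ q <=
  q / (q - 1) * \sum_y m y * (h y * doob_max h k y `^ (q - 1)).
Proof.
move=> q1 h0; have q0 : 0 < q by exact: lt_trans q1.
have q10 : 0 < q - 1 by rewrite subr_gt0.
have c1 : 1 <= q / (q - 1) by rewrite ler_pdivlMr// mul1r gerBl.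
have ad j : adapted anc j xpredT by [].
have pow_ad j r : adapted anc j (fun y => doob_max h j y `^ r).
  by move=> x y xy; rewrite (doob_max_adapted h xy).
have S0 k' : 0 <= \sum_y m y * (h y * doob_max h k' y `^ (q - 1)).
  by apply: sumr_ge0 => y _; rewrite !mulr_ge0 ?powR_ge0.
elim: k => [|k IH].
  rewrite -[leLHS]mul1r; apply: ler_pM => //; rewrite ?ler01//.
    by apply: sumr_ge0 => y _; rewrite mulr_ge0// powR_ge0.
  rewrite -(sum_ravg_adapted m0 h (ad 0%N) (pow_ad 0%N (q - 1))).
  by apply: ler_sum => y _; rewrite ler_wpM2l//= mulr_powRB1// ravg_ge0.
have step : \sum_y m y * doob_max h k.+1 y `^ q <=
    \sum_y m y * doob_max h k y `^ q + q / (q - 1) *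
    \sum_y m y * (ravg m anc k.+1 h y *
      (doob_max h k.+1 y `^ (q - 1) - doob_max h k y `^ (q - 1))).
  rewrite mulr_sumr -big_split/=; apply: ler_sum => y _.
  rewrite mulrCA -mulrDr ler_wpM2l// -lerBlDl.
  by apply: doob_step => //; [exact: doob_max_ge0|exact: ravg_ge0].
apply: le_trans step _; rewrite sum_ravg_adapted//; last first.
  move=> x y xy; rewrite (pow_ad _ _ _ _ xy); congr (_ - _).
  exact/(pow_ad k)/anc_nested.
apply: le_trans (lerD IH (lexx _)) _; rewrite -mulrDr -big_split/=.
rewrite ler_wpM2l ?(le_trans ler01)//; apply: ler_sum => y _.
by rewrite -mulrDr -mulrDr addrC subrK.
Qed.

(** Half of the left-hand side is absorbed by means of Young's inequality; all
    the sums are finite. *)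
Lemma doob_inequality q h k : 1 < q -> (forall y, 0 <= h y) ->
  \sum_y m y * doob_max h k y `^ q <=
  (2 * (q / (q - 1))) `^ q * \sum_y m y * h y `^ q.
Proof.
move=> q1 h0; have q0 : 0 < q by exact: lt_trans q1.
have q10 : 0 < q - 1 by rewrite subr_gt0.
set c := q / (q - 1); have c0 : 0 < c by exact: divr_gt0.
have d0 : 0 < (2 * c)^-1 by rewrite invr_gt0 mulr_gt0.
set S := \sum_y _; set H := \sum_y _.
have : S <= 2^-1 * S + c * ((2 * c) `^ (q - 1) * H).
  apply: le_trans (doob_inequality_aux k q1 h0) _.
  have -> : 2^-1 * S = c * ((2 * c)^-1 * S) by field; rewrite gt_eqF.
  rewrite -/c -mulrDr ler_wpM2l ?(ltW c0)// /S /H !mulr_sumr -big_split/=.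
  apply: ler_sum => y _.
  rewrite [X in _ <= X + _]mulrCA [X in _ <= _ + X]mulrCA -mulrDr ler_wpM2l//.
  rewrite -[X in _ <= _ + X `^ (q - 1) * _]invrK.
  by apply: young_delta_powR => //; exact: doob_max_ge0.
have c20 : 0 <= 2 * c by rewrite mulr_ge0// ltW.
by rewrite -(mulr_powRB1 c20 q0); move: ((2 * c) `^ (q - 1)) => w; lra.
Qed.

End doob.

(** * Principal cubes *)
Section stopping.
Context {R : realType} {X : finType} {I : eqType}.
Variables (anc : nat -> X -> I).
Hypothesis anc_nested : forall k x y, anc k.+1 x = anc k.+1 y -> anc k x = anc k y.
Variable crit : nat -> nat -> X -> bool.
Hypothesis crit_adapted : forall j k, (j <= k)%N -> adapted anc k (crit j k).

(** A principal cube is encoded by its level and one of its points. This is the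
    level of the smallest principal cube that contains the cube of level [k]
    around [y]; [crit j k] tells whether to stop at level [k] below a principal
    cube of level [j]. *)
Fixpoint principal k y : nat :=
  if k is i.+1 then if crit (principal i y) k y then k else principal i y else 0%N.

Lemma principal_le k y : (principal k y <= k)%N.
Proof. by elim: k => //= k IH; case: ifP => // _; exact: leqW. Qed.

Lemma principal_adapted k : adapted anc k (principal k).
Proof.
elim: k => [|k IH] x y xy //=; rewrite (IH x y (anc_nested xy)).
by rewrite (crit_adapted (leqW (principal_le k y)) xy).
Qed.

Lemma principal_homo i k y : (i <= k)%N -> (principal i y <= principal k y)%N.
Proof.
move=> ik; rewrite -(subnKC ik); elim: (k - i)%N => [|d IH]; first by rewrite addn0.
rewrite addnS /=; case: ifP => // _; apply: leqW.
by rewrite (leq_trans (principal_le i y))// leq_addr.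
Qed.

Lemma principal_idem k y : principal (principal k y) y = principal k y.
Proof. by elim: k => //= k IH; case: ifPn => //= ->. Qed.

Lemma principal_between j i k y : principal k y = j -> (j <= i <= k)%N ->
  principal i y = j.
Proof.
move=> kj /andP[ji ik]; apply/eqP; rewrite eqn_leq -{1}kj principal_homo//=.
have jj : principal j y = j by rewrite -kj principal_idem.
by rewrite -{1}jj principal_homo.
Qed.

Lemma principal_ncrit j k y : principal k y = j -> (j < k)%N -> ~~ crit j k y.
Proof.
case: k => // k /=; case: ifPn => [_ <-|nc <- //]; by rewrite ltnn.
Qed.

Lemma principal_exit j N y : principal j y = j -> (j <= N)%N ->
  principal N y != j -> exists k, [/\ (j < k)%N, (k <= N)%N & crit j k y].
Proof.
move=> jj; elim: N => [|N IH]; first by rewrite leqn0 => /eqP <-; rewrite jj eqxx.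
rewrite leq_eqVlt => /predU1P[<-|]; first by rewrite jj eqxx.
rewrite ltnS => jN; have [Nj|Nj _] := eqVneq (principal N y) j.
  by rewrite /= Nj; case: ifPn => [c _|_]; [exists N.+1|rewrite eqxx].
by have [k [jk kN c]] := IH jN Nj; exists k; split=> //; exact: leqW.
Qed.

End stopping.

Section principal_cubes.
Context {R : realType} {X : finType} {I : eqType} {C D : banachLatticeType R}.
Variables (m : X -> R) (anc : nat -> X -> I).
Hypothesis m0 : forall x, 0 <= m x.
Hypothesis anc_nested : forall k x y, anc k.+1 x = anc k.+1 y -> anc k x = anc k y.
Variables (A B : R).
Hypotheses (A1 : 1 <= A) (B1 : 1 <= B).
Hypothesis weakA : @tree_weak_type R C A.
Hypothesis weakB : @tree_weak_type R D B.
Variables (f : X -> C) (g : X -> D) (N : nat).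
Hypotheses (f0 : forall x, 0 <= f x) (g0 : forall x, 0 <= g x).

Definition threshold {E : banachLatticeType R} (A : R) (u : X -> E) j x : R :=
  4 * A * ravg m anc j (fun y => `|u y|) x.

(** Stopping for the two functions at once yields a single family of principal
    cubes. *)
Definition large_join j k x : bool :=
  (threshold A f j x < `|chain_join m anc f j k x|) ||
  (threshold B g j x < `|chain_join m anc g j k x|).

Let st := principal large_join.

Lemma threshold_adapted (E : banachLatticeType R) (a : R) (u : X -> E) j :
  adapted anc j (threshold a u j).
Proof.
move=> x y xy; congr (_ * _); exact: (@avg_adapted _ _ _ _ _ R^o).
Qed.

Lemma threshold_ge0 (E : banachLatticeType R) (a : R) (u : X -> E) j x :
  1 <= a -> 0 <= threshold a u j x.
Proof.
move=> a1; rewrite mulr_ge0//; last exact: ravg_ge0.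
by rewrite mulr_ge0// (le_trans ler01).
Qed.

Lemma large_join_adapted j k : (j <= k)%N -> adapted anc k (large_join j k).
Proof.
move=> jk x y xy; have xyj := anc_le anc_nested jk xy.
by rewrite /large_join !(threshold_adapted _ _ xyj) !(chain_join_adapted m anc_nested _ _ xy).
Qed.

Let st_adapted k : adapted anc k (st k).
Proof. exact: principal_adapted large_join_adapted _. Qed.

(** The part of the lattice maximal function of [u] that comes from the cubes
    whose principal cube has level [j]. It majorizes the averages of [u] over
    these cubes, and yet its norm stays below the threshold. *)
Definition block {E : banachLatticeType R} (u : X -> E) j x : E :=
  pos_join (fun i => (j <= i)%N && (st i x == j)) (fun i => avg m anc i u x) N.+1.

Lemma block_ge (E : banachLatticeType R) (u : X -> E) j k x : (k <= N)%N ->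
  st k x = j -> avg m anc k u x <= block u j x.
Proof.
move=> kN kj; apply: (pos_join_ub (fun i => avg m anc i u x)) => //.
by rewrite kj eqxx andbT -kj principal_le.
Qed.

(** Before the next principal cube the joins have not yet passed the threshold. *)
Lemma block_le (E : banachLatticeType R) (u : X -> E) (a : R) j x : 1 <= a ->
  (forall y, 0 <= u y) ->
  (forall k, st k x = j -> (j < k)%N -> `|chain_join m anc u j k x| <= threshold a u j x) ->
  `|block u j x| <= threshold a u j x.
Proof.
move=> a1 u0 ua; rewrite /block; elim: N.+1 => [|n IH] /=.
  by rewrite normr0 threshold_ge0.
case: ifP => // /andP[jn /eqP nj].
apply: (@le_trans _ _ `|chain_join m anc u j n x|).
  apply: blnorm_mono; first by apply: bl_join_ge0; exact: pos_join_ge0.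
  rewrite leUx; apply/andP; split; last exact: (pos_join_ub (fun i => avg m anc i u x)).
  apply: pos_join_le => [|i /leqW]; first exact: pos_join_ge0.
  move=> ilt /andP[ji _]; exact: (pos_join_ub (fun i => avg m anc i u x)).
move: jn; rewrite leq_eqVlt => /predU1P[jn|]; last exact: ua.
rewrite -jn chain_join_diag// (le_trans (norm_avg anc m0 _ _ _))//.
by rewrite ler_peMl ?ravg_ge0//; lra.
Qed.

Lemma norm_block_f j x : `|block f j x| <= threshold A f j x.
Proof.
apply: block_le => // k kj jk.
by have := principal_ncrit kj jk; rewrite negb_or -!leNgt => /andP[].
Qed.

Lemma norm_block_g j x : `|block g j x| <= threshold B g j x.
Proof.
apply: block_le => // k kj jk.
by have := principal_ncrit kj jk; rewrite negb_or -!leNgt => /andP[].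
Qed.

Lemma block_ge0 (E : banachLatticeType R) (u : X -> E) j x : 0 <= block u j x.
Proof. exact: pos_join_ge0. Qed.

Lemma le_wsum_block (E : banachLatticeType R) (u : X -> E) j k x : (k <= N)%N ->
  st k x = j -> wsum m anc k u x <= wsum m anc k (block u j) x.
Proof.
move=> kN kj; rewrite -(wsum_avg m0 anc_nested u x (leqnn k)).
apply: le_wsum => // y yx; apply: block_ge => //.
by rewrite -kj; exact: st_adapted.
Qed.

(** Sparseness of the principal cubes: where the family is left, one of the two
    joins exceeds its threshold, which happens on at most a quarter of the cube
    for each of them. *)
Lemma principal_sparse j x : (j <= N)%N -> st j x = j ->
  mass m anc j x <= 2 * \sum_(y | anc j y == anc j x) m y * (st N y == j)%:R.
Proof.
move=> jN jj.
have Aw := maximal_weak_type_avg m0 anc_nested x (lt_le_trans ltr01 A1) weakA f0 jN.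
have Bw := maximal_weak_type_avg m0 anc_nested x (lt_le_trans ltr01 B1) weakB g0 jN.
have : mass m anc j x <= \sum_(y | anc j y == anc j x) (m y * (st N y == j)%:R +
  (m y * norm_gt (threshold A f j x) (chain_join m anc f j N y) +
   m y * norm_gt (threshold B g j x) (chain_join m anc g j N y))).
  apply: ler_sum => y /eqP yx; rewrite -!mulrDr -{1}(mulr1 (m y)) ler_wpM2l//.
  have [_|Nj] := eqVneq (st N y) j.
    by rewrite lerDl addr_ge0// norm_gt_ge0.
  have yj : st j y = j by rewrite -[RHS]jj; exact: st_adapted.
  have [k [jk kN]] := principal_exit yj jN Nj.
  rewrite add0r /large_join !(threshold_adapted _ _ yx) => /orP[h|h].
    rewrite -[leLHS]addr0 lerD ?norm_gt_ge0// /norm_gt (lt_le_trans h)//.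
    by apply: blnorm_mono; [exact: pos_join_ge0|exact: chain_join_homo].
  rewrite -[leLHS]add0r lerD ?norm_gt_ge0// /norm_gt (lt_le_trans h)//.
  by apply: blnorm_mono; [exact: pos_join_ge0|exact: chain_join_homo].
rewrite !big_split/=; rewrite /threshold in Aw Bw *; lra.
Qed.

End principal_cubes.

(** * The positive operator on a filtration *)
Section positive_maps.
Context {R : realType} {C D : banachLatticeType R}.

Lemma positive_op_homo (l : {linear C -> D}) x y : positive_op l -> x <= y -> l x <= l y.
Proof.
by move=> l0 xy; rewrite -bl_subr_ge0 -linearB; apply: l0; rewrite bl_subr_ge0.
Qed.

Lemma dual_pos_homo (phi : dual D) x y : 0 <= phi -> x <= y -> (phi x : R) <= phi y.
Proof.
move=> /dual_leP phi0 xy; rewrite -subr_ge0 -linearB; apply: phi0.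
by rewrite bl_subr_ge0.
Qed.

Lemma dual_homo (phi psi : dual D) x : phi <= psi -> 0 <= x -> (phi x : R) <= psi x.
Proof. by move=> /dual_leP; apply. Qed.

Lemma dual_sum J (r : seq J) (P : pred J) (F : J -> dual D) x :
  (\sum_(i <- r | P i) F i) x = \sum_(i <- r | P i) F i x :> R.
Proof. by elim/big_rec2: _ => // i y1 y2 _ <-. Qed.

End positive_maps.

Section operator.
Context {R : realType} {X : finType} {I : eqType} {C D : banachLatticeType R}.
Variables (m : X -> R) (anc : nat -> X -> I).
Hypothesis m0 : forall x, 0 <= m x.
Hypothesis anc_nested : forall k x y, anc k.+1 x = anc k.+1 y -> anc k x = anc k y.
Variables (L : nat -> I -> {linear C -> D}) (N : nat).
Hypothesis L0 : forall k i, positive_op (L k i).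

Definition level_op j (f : X -> C) x : D :=
  \sum_(k < N.+1 | (j <= k)%N) L k (anc k x) (wsum m anc k f x).

Lemma level_op_ge0 j f x : (forall y, 0 <= f y) -> 0 <= level_op j f x.
Proof. by move=> f0; apply: bl_sum_ge0 => k _; apply: L0; exact: wsum_ge0. Qed.

Lemma level_op_homo j (f g : X -> C) x : (forall y, f y <= g y) -> level_op j f x <= level_op j g x.
Proof.
by move=> fg; apply: bl_ler_sum => k _; apply: positive_op_homo => //; exact: le_wsum.
Qed.

Lemma level_opZ j (w : X -> R) f x : adapted anc j w ->
  level_op j (fun y => w y *: f y) x = w x *: level_op j f x.
Proof.
move=> wj; rewrite /level_op scaler_sumr; apply: eq_bigr => k jk.
by rewrite wsumZ ?linearZ//; exact: adapted_le wj.
Qed.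

Lemma level_op_abs f x : blabs (level_op 0 f x) <= level_op 0 (fun y => blabs (f y)) x.
Proof.
apply: blabs_le; first by apply: level_op_homo => y; exact: blabs_ge.
have -> : - level_op 0 f x = level_op 0 (fun y => - f y) x.
  rewrite -scaleN1r -(@level_opZ 0 (fun=> -1))//.
  by congr (level_op 0 _ x); apply/funext => y; rewrite scaleN1r.
by apply: level_op_homo => y; exact: blabs_geN.
Qed.

Section testing.
Variables (p Kp : R).
Hypothesis p1 : 1 < p.
Hypothesis bounded : forall f : X -> C, (forall x, 0 <= f x) ->
  \sum_x m x * `|level_op 0 f x| `^ p <= Kp * \sum_x m x * `|f x| `^ p.

(** The testing condition follows from boundedness on the function cut off
    outside the cube, since [t <= 1 + t `^ p] turns the power of the norm into an
    estimate in mean. It no longer depends on the exponent. *)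
Lemma testing j x (h : X -> C) : 0 <= Kp -> (forall y, 0 <= h y) -> (forall y, `|h y| <= 1) ->
  \sum_(y | anc j y == anc j x) m y * `|level_op j h y| <= (1 + Kp) * mass m anc j x.
Proof.
move=> Kp0 h0 h1; have p0 : 0 < p by exact: lt_trans p1.
pose h' y : C := if anc j y == anc j x then h y else 0.
have h'0 y : 0 <= h' y by rewrite /h'; case: ifP.
have hh' y : anc j y = anc j x -> level_op j h y <= level_op 0 h' y.
  move=> yx; rewrite /level_op [leRHS](bigID (fun k : 'I_N.+1 => (j <= k)%N))/=.
  rewrite -[leLHS]addr0; apply: blD; last first.
    by apply: bl_sum_ge0 => k _; apply: L0; exact: wsum_ge0.
  apply: bl_ler_sum => k jk; rewrite (@eq_wsum _ _ _ _ _ _ k h' h)// => z zy.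
  by rewrite /h' (anc_le anc_nested jk zy) yx eqxx.
have le1 (t : R) : 0 <= t -> t <= 1 + t `^ p.
  move=> t0; have [t1|t1] := leP t 1; first by rewrite (le_trans t1)// lerDl powR_ge0.
  rewrite -[leLHS]add0r lerD// -[leLHS]powRr1//.
  by apply: ler_powR; rewrite ltW.
apply: (@le_trans _ _ (\sum_(y | anc j y == anc j x) m y * (1 + `|level_op 0 h' y| `^ p))).
  apply: ler_sum => y /eqP yx; rewrite ler_wpM2l//; apply: le_trans (le1 _ (normr_ge0 _)).
  by apply: blnorm_mono (hh' _ yx); exact: level_op_ge0.
under eq_bigr do rewrite mulrDr mulr1; rewrite big_split/= mulrDl mul1r lerD//.
apply: (@le_trans _ _ (\sum_y m y * `|level_op 0 h' y| `^ p)).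
  rewrite [leRHS](bigID (fun y => anc j y == anc j x))/= lerDl.
  by apply: sumr_ge0 => y _; rewrite mulr_ge0// powR_ge0.
apply: le_trans (bounded h'0) _; rewrite ler_wpM2l//.
rewrite (bigID (fun y => anc j y == anc j x))/= [X in _ + X]big1 ?addr0; last first.
  by move=> y /negbTE yx; rewrite /h' yx normr0 powR0 ?mulr0// gt_eqF.
apply: ler_sum => y yx; rewrite ler_piMr// /h' yx.
apply: (@le_trans _ _ (1 `^ p)); last by rewrite powR1.
by apply: ge0_ler_powR => //; rewrite ?nnegrE ?ler01// ltW.
Qed.

End testing.

Section bilinear.
Variables (A B Kc : R).
Hypotheses (A1 : 1 <= A) (B1 : 1 <= B) (Kc0 : 0 <= Kc).
Hypothesis weakA : @tree_weak_type R C A.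
Hypothesis weakB : @tree_weak_type R (dual D) B.
Hypothesis test : forall j x (h : X -> C), (forall y, 0 <= h y) -> (forall y, `|h y| <= 1) ->
  \sum_(y | anc j y == anc j x) m y * `|level_op j h y| <= Kc * mass m anc j x.
Variables (f : X -> C) (g : X -> dual D).
Hypotheses (f0 : forall x, 0 <= f x) (g0 : forall x, 0 <= g x).

Let st := principal (large_join m anc A B f g).
Let bf := block m anc A B f g N f.
Let bg := block m anc A B f g N g.
Let a := threshold m anc A f.
Let b := threshold m anc B g.

Let st_adapted k : adapted anc k (st k).
Proof. by apply: principal_adapted => // i j; exact: large_join_adapted. Qed.

Let a0 j x : 0 <= a j x. Proof. exact: threshold_ge0. Qed.
Let b0 j x : 0 <= b j x. Proof. exact: threshold_ge0. Qed.

(** The averages of the two functions are dominated by their blocks, and both the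
    operators and the pairing are positive. *)
Let replace_by_blocks k j : (k <= N)%N ->
  \sum_(y | st k y == j) m y * g y (L k (anc k y) (wsum m anc k f y)) <=
  \sum_(y | st k y == j) m y * bg j y (L k (anc k y) (wsum m anc k (bf j) y)).
Proof.
move=> kN; apply: (sum_le_classwise (anc := anc) m0 (k := k)).
  by move=> x y xy; rewrite (st_adapted xy).
move=> x /eqP kj; set d := L k (anc k x) (wsum m anc k f x).
have d0 : 0 <= d by apply: L0; exact: wsum_ge0.
have -> : \sum_(y | anc k y == anc k x) m y * g y (L k (anc k y) (wsum m anc k f y)) =
    wsum m anc k g x d :> R.
  rewrite dual_sum; apply: eq_bigr => y /eqP yx.
  by rewrite dualZE (wsum_adapted m f yx) yx.
apply: le_trans (dual_homo (le_wsum_block m0 anc_nested g kN kj) d0) _.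
rewrite dual_sum; apply: ler_sum => y /eqP yx.
rewrite dualZE ler_wpM2l//; apply: dual_pos_homo; first exact: block_ge0.
rewrite /d -yx; apply: positive_op_homo => //.
rewrite -(wsum_adapted m f yx); apply: le_wsum_block => //.
by rewrite -kj; exact: st_adapted.
Qed.

(** The factor [2] and the indicator come from the sparseness of the principal
    cubes. *)
Let block_bound j : (j <= N)%N ->
  \sum_(y | st j y == j) m y * bg j y (level_op j (bf j) y) <=
  2 * Kc * \sum_(y | st j y == j) m y * (a j y * b j y * (st N y == j)%:R).
Proof.
move=> jN; pose h y := (a j y)^-1 *: bf j y.
have h0 y : 0 <= h y by apply: bl_scale_ge0; rewrite ?invr_ge0//; exact: block_ge0.
have h1 y : `|h y| <= 1.
  rewrite normrZ ger0_norm ?invr_ge0//.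
  have [->|an0] := eqVneq (a j y) 0; first by rewrite invr0 mul0r ler01.
  rewrite ler_pdivrMl ?mulr1; first exact: norm_block_f.
  by rewrite lt_neqAle eq_sym an0 a0.
have bfE y : bf j y = a j y *: h y.
  rewrite /h; have [ay0|an0] := eqVneq (a j y) 0; last by rewrite scalerKV.
  rewrite ay0 scale0r; apply/normr0_eq0/le_anti; rewrite normr_ge0 andbT -ay0.
  exact: norm_block_f.
have aj : adapted anc j (a j) by exact: threshold_adapted.
have bj : adapted anc j (b j) by exact: threshold_adapted.
apply: (@le_trans _ _ (\sum_(y | st j y == j) m y * (a j y * b j y * `|level_op j h y|))).
  apply: ler_sum => y _; rewrite ler_wpM2l// (le_trans (ler_norm _))//.
  apply: (le_trans (le_dual_norm _ _)).
  have -> : level_op j (bf j) y = a j y *: level_op j h y.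
    by rewrite -level_opZ//; congr (level_op j _ y); apply/funext.
  rewrite normrZ ger0_norm// [a j y * b j y]mulrC -[b j y * a j y * _]mulrA.
  apply: ler_wpM2r; first exact: (mulr_ge0 (a0 _ _) (normr_ge0 _)).
  by rewrite -dual_normE; exact: norm_block_g.
rewrite mulr_sumr [leRHS](eq_bigr (fun y => m y *
  (2 * Kc * (a j y * b j y * (st N y == j)%:R)))); last by move=> y _; rewrite mulrCA.
apply: (sum_le_classwise (anc := anc) m0 (k := j)); first by move=> x y xy; rewrite (st_adapted xy).
move=> x /eqP jj; set c := a j x * b j x.
have c0 : 0 <= c by exact: mulr_ge0.
rewrite (eq_bigr (fun y => c * (m y * `|level_op j h y|))); last first.
  by move=> y /eqP yx; rewrite (aj _ _ yx) (bj _ _ yx) -/c mulrCA.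
rewrite [leRHS](eq_bigr (fun y => 2 * Kc * c * (m y * (st N y == j)%:R))); last first.
  by move=> y /eqP yx; rewrite (aj _ _ yx) (bj _ _ yx) -/c; ring.
rewrite -!mulr_sumr; apply: le_trans (ler_wpM2l c0 (test _ _ h0 h1)) _.
have := principal_sparse m0 anc_nested A1 B1 weakA weakB f0 g0 jN jj.
by move=> /(ler_wpM2l (mulr_ge0 Kc0 c0)); rewrite -/st; lra.
Qed.

Let partition k (F : X -> R) : (k <= N)%N ->
  \sum_y F y = \sum_(j < N.+1) \sum_(y | st k y == j) F y.
Proof.
move=> kN; rewrite (partition_big (fun y => inord (st k y) : 'I_N.+1) xpredT)//=.
apply: eq_bigr => j _; apply: eq_bigl => y.
by rewrite -val_eqE/= inordK// ltnS (leq_trans (principal_le _ _ _)).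
Qed.

(** The cubes are sorted by their principal cubes. The blocks, divided by their
    thresholds, are subject to the testing condition, and sparseness makes the
    sum over the principal cubes an integral. *)
Lemma bilinear_sparse_bound :
  \sum_y m y * g y (level_op 0 f y) <=
  2 * Kc * (4 * A) * (4 * B) * \sum_y m y *
    (doob_max m anc (fun x => `|f x|) N y * doob_max m anc (fun x => `|g x|) N y).
Proof.
have -> : \sum_y m y * g y (level_op 0 f y) = \sum_(k < N.+1) \sum_(j < N.+1)
    \sum_(y | st k y == j) m y * g y (L k (anc k y) (wsum m anc k f y)).
  under [RHS]eq_bigr => k _ do rewrite -(partition _ (ltn_ord k)).
  rewrite exchange_big/=; apply: eq_bigr => y _.
  by rewrite /level_op linear_sum mulr_sumr.
apply: (@le_trans _ _ (\sum_(j < N.+1)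
    \sum_(y | st j y == j) m y * bg j y (level_op j (bf j) y))).
  rewrite exchange_big/=; apply: ler_sum => j _.
  under [leRHS]eq_bigr do rewrite /level_op linear_sum mulr_sumr.
  rewrite exchange_big/= [leRHS]big_mkcond/=; apply: ler_sum => k _.
  have kN : (k <= N)%N by rewrite -ltnS.
  case: leqP => [jk|kj]; last first.
    rewrite big_pred0// => y; apply/negbTE; rewrite neq_ltn.
    by rewrite (leq_ltn_trans (principal_le _ _ _) kj).
  apply: le_trans (replace_by_blocks _ kN) _.
  rewrite big_mkcond/= [leRHS]big_mkcond/=; apply: ler_sum => y _.
  case: ifPn => [/eqP kj|_].
    by rewrite [st j y](principal_between kj) ?eqxx// leqnn.
  case: ifP => // _; rewrite mulr_ge0//.
  rewrite -(linear0 (bg j y)); apply: dual_pos_homo; first exact: block_ge0.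
  by apply: L0; apply: wsum_ge0 => // z; exact: block_ge0.
pose F y := m y * (4 * A * doob_max m anc (fun x => `|f x|) N y *
  (4 * B * doob_max m anc (fun x => `|g x|) N y)).
apply: (@le_trans _ _ (\sum_(j < N.+1) 2 * Kc * \sum_(y | st N y == j) F y)).
  apply: ler_sum => j _; have jN : (j <= N)%N by rewrite -ltnS.
  apply: le_trans (block_bound jN) _; rewrite ler_wpM2l ?mulr_ge0//.
  rewrite big_mkcond/= [leRHS]big_mkcond/=; apply: ler_sum => y _.
  case: ifPn => [_|stj]; last first.
    case: ifP => // /eqP Nj; move: stj; rewrite -{2}Nj.
    by rewrite [st j y](principal_between Nj) ?eqxx ?Nj ?eqxx// leqnn.
  case: eqP => [_|_]; rewrite ?mulr0// mulr1; apply: ler_wpM2l => //.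
  have fourM (c : R) : 1 <= c -> 0 <= 4 * c by lra.
  apply: ler_pM; [exact: a0|exact: b0| |].
    by apply: ler_wpM2l (fourM _ A1) _ _ _; exact: doob_max_ge.
  by apply: ler_wpM2l (fourM _ B1) _ _ _; exact: doob_max_ge.
rewrite -mulr_sumr -(partition F (leqnn N)) -!mulrA !ler_wpM2l// mulr_sumr.
rewrite !mulr_sumr; apply: ler_sum => y _.
by rewrite le_eqVlt /F; apply/predU1P; left; ring.
Qed.

End bilinear.

(** The extrapolation for finite measure spaces. Duality is pointwise: the dual
    function [g] norms the image of [f], and its share in the sparse bound is
    absorbed by means of Young's inequality. *)
Lemma level_op_bounded A B p q Kp : 1 <= A -> 1 <= B -> 0 <= Kp -> 1 < p -> 1 < q ->
  @tree_weak_type R C A -> @tree_weak_type R (dual D) B ->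
  (forall f : X -> C, (forall x, 0 <= f x) ->
    \sum_x m x * `|level_op 0 f x| `^ p <= Kp * \sum_x m x * `|f x| `^ p) ->
  let c := 2 * (1 + Kp) * (4 * A) * (4 * B) in
  let q' := q / (q - 1) in
  let d := (2 * c * (2 * (q' / (q' - 1))) `^ q')^-1 in
  forall f : X -> C,
    \sum_x m x * `|level_op 0 f x| `^ q <=
    2 * c * d^-1 `^ (q - 1) * (2 * q') `^ q * \sum_x m x * `|f x| `^ q.
Proof.
move=> A1 B1 Kp0 p1 q1 weakA weakB bounded c q' d f0.
pose f x := blabs (f0 x).
have fge0 x : 0 <= f x by exact: blabs_ge0.
have -> : \sum_x m x * `|f0 x| `^ q = \sum_x m x * `|f x| `^ q.
  by apply: eq_bigr => x _; rewrite /f blnorm_abs.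
have q0 : 0 < q by exact: lt_trans q1.
have q10 : 0 < q - 1 by rewrite subr_gt0.
apply: (@le_trans _ _ (\sum_x m x * `|level_op 0 f x| `^ q)).
  apply: ler_sum => x _; rewrite ler_wpM2l//.
  apply: ge0_ler_powR; rewrite ?nnegrE ?(ltW q0)//.
  rewrite -blnorm_abs; apply: blnorm_mono; first exact: blabs_ge0.
  exact: level_op_abs.
set S := \sum_x _; set H := \sum_x _.
have Tf0 x : 0 <= level_op 0 f x by exact: level_op_ge0.
have [phi phiP] := choice (fun x => exists_norming_functional (Tf0 x)).
pose w x := `|level_op 0 f x| `^ (q - 1).
pose g x : dual D := w x *: phi x.
have w0 x : 0 <= w x by exact: powR_ge0.
have g0 x : 0 <= g x by have [p0 _ _] := phiP x; exact: bl_scale_ge0.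
have q'1 : 1 < q' by rewrite ltr_pdivlMr// mul1r gtrBl.
have q'0 : 0 < q' by exact: lt_trans q'1.
have q'10 : 0 < q' - 1 by rewrite subr_gt0.
have gn x : `|g x| `^ q' <= `|level_op 0 f x| `^ q.
  have [_ p1' _] := phiP x.
  have -> : `|level_op 0 f x| `^ q = w x `^ q'.
    by rewrite /w -powRrM /q' mulrCA divff ?mulr1// gt_eqF.
  apply: ge0_ler_powR; rewrite ?nnegrE ?(ltW q'0)//.
  by rewrite /g normrZ ger0_norm// ler_piMr.
have SE : S = \sum_x m x * g x (level_op 0 f x).
  apply: eq_bigr => x _; have [_ _ px] := phiP x.
  by rewrite dualZE px mulrC -(@mulr_powRB1 _ _ q)// mulrC [_ * w x]mulrC.
have Kc0 : 0 <= 1 + Kp by rewrite addr_ge0.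
have c0 : 0 < c.
  by rewrite !mulr_gt0// ?(lt_le_trans ltr01)//; rewrite lerDl.
have c20 : 0 < 2 * c by exact: mulr_gt0.
have G0 : 0 < (2 * (q' / (q' - 1))) `^ q' by rewrite powR_gt0// mulr_gt0// divr_gt0.
have d0 : 0 < d by rewrite invr_gt0; apply: mulr_gt0 => //; exact: mulr_gt0.
have h1 : S <= c * \sum_y m y *
    (doob_max m anc (fun x => `|f x|) N y * doob_max m anc (fun x => `|g x|) N y).
  rewrite SE; apply: bilinear_sparse_bound => // j x h h0 hle1.
  exact: testing p1 bounded _ _ _ Kp0 h0 hle1.
have h2 : \sum_y m y *
    (doob_max m anc (fun x => `|f x|) N y * doob_max m anc (fun x => `|g x|) N y) <=
    d * \sum_y m y * doob_max m anc (fun x => `|g x|) N y `^ q' +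
    d^-1 `^ (q - 1) * \sum_y m y * doob_max m anc (fun x => `|f x|) N y `^ q.
  rewrite !mulr_sumr -big_split/=; apply: ler_sum => y _.
  rewrite [X in _ <= X + _]mulrCA [X in _ <= _ + X]mulrCA -mulrDr ler_wpM2l//.
  by apply: young_delta_conj => //; exact: doob_max_ge0.
have h3 := @doob_inequality R X I m anc m0 anc_nested q' (fun x => `|g x|) N q'1 (fun _ => normr_ge0 _).
have h4 := @doob_inequality R X I m anc m0 anc_nested q (fun x => `|f x|) N q1 (fun _ => normr_ge0 _).
have h5 : \sum_y m y * `|g y| `^ q' <= S by apply: ler_sum => y _; rewrite ler_wpM2l.
have h6 : d * \sum_y m y * doob_max m anc (fun x => `|g x|) N y `^ q' <= (2 * c)^-1 * S.
  rewrite ler_pdivlMl// mulrA.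
  rewrite /d -[X in _ <= X]mul1r.
  have -> : 2 * c * (2 * c * (2 * (q' / (q' - 1))) `^ q')^-1 =
     ((2 * (q' / (q' - 1))) `^ q')^-1 by field; rewrite !gt_eqF.
  rewrite mul1r ler_pdivrMl//; apply: le_trans h3 _.
  by rewrite ler_wpM2l// ltW.
have h7 : d^-1 `^ (q - 1) * \sum_y m y * doob_max m anc (fun x => `|f x|) N y `^ q <=
    d^-1 `^ (q - 1) * ((2 * q') `^ q * H).
  by rewrite ler_wpM2l// powR_ge0.
have := le_trans h1 (ler_wpM2l (ltW c0) (le_trans h2 (lerD h6 h7))).
have -> : c * ((2 * c)^-1 * S + d^-1 `^ (q - 1) * ((2 * q') `^ q * H)) =
  2^-1 * S + c * d^-1 `^ (q - 1) * (2 * q') `^ q * H.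
  by field; rewrite gt_eqF.
by move: (d^-1 `^ _) ((2 * q') `^ q) => u v; lra.
Qed.

End operator.

(** * Functions with finitely many values *)
Section finite_label.
Context {d} {T : measurableType d} {R : realType} {U : finType}.
Variable a : T -> U.
Hypothesis ma : forall u, measurable (a @^-1` [set u]).

Lemma measurable_preimage_label (S : set U) : measurable (a @^-1` S).
Proof.
rewrite (_ : a @^-1` S = \bigcup_(u in S) (a @^-1` [set u])).
  by apply: fin_bigcup_measurable => //; exact: finite_finset.
by apply/seteqP; split=> [x Sx|x [u Su /= ax]]; [exists (a x)|rewrite /preimage/= ax].
Qed.

Lemma measurable_fun_label d' (Y : measurableType d') (h : U -> Y) D :
  measurable D -> measurable_fun D (h \o a).
Proof.
move=> mD _ B mB; apply: measurableI => //.
exact: (measurable_preimage_label (h @^-1` B)).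
Qed.

Variable mu : {measure set T -> \bar R}.

Lemma ge0_integral_label (B : set T) (f : T -> \bar R) : measurable B ->
  measurable_fun B f -> (forall x, B x -> 0 <= f x)%E ->
  (\int[mu]_(x in B) f x = \sum_u \int[mu]_(x in B `&` a @^-1` [set u]) f x)%E.
Proof.
move=> mB mf f0.
have BE : \big[setU/set0]_(u <- index_enum U) (B `&` a @^-1` [set u]) = B.
  rewrite -bigcup_seq; apply/seteqP; split=> [x [u _ []]//|x Bx].
  by exists (a x) => //=; rewrite mem_index_enum.
rewrite -{1}BE ge0_integral_bigsetU ?BE//.
- by move=> u; exact: measurableI.
- exact: index_enum_uniq.
- by move=> u v _ _ [x [[_ /= au] [_ /= av]]]; rewrite -au -av.
Qed.

Lemma measure_label (B : set T) : measurable B ->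
  (mu B = \sum_u mu (B `&` a @^-1` [set u]))%E.
Proof.
move=> mB; rewrite -[LHS]mul1e -(integral_cst _ mB).
rewrite ge0_integral_label//; apply: eq_bigr => u _.
by rewrite integral_cst ?mul1e//; exact: measurableI.
Qed.

Lemma integral_label_fun (B : set T) (g : U -> R) : measurable B ->
  (forall u, 0 <= g u) ->
  (\int[mu]_(x in B) (g (a x))%:E =
   \sum_u (g u)%:E * mu (B `&` a @^-1` [set u]))%E.
Proof.
move=> mB g0; rewrite ge0_integral_label//; last 2 first.
- by apply/measurable_EFinP; exact: measurable_fun_label.
- by move=> x _; rewrite lee_fin.
apply: eq_bigr => u _; rewrite -integral_cst; last exact: measurableI.
by apply: eq_integral => x /[!inE] -[_ /= <-].
Qed.

Lemma fine_measure_label (B : set T) : measurable B -> (mu B < +oo)%E ->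
  fine (mu B) = \sum_u fine (mu (B `&` a @^-1` [set u])).
Proof.
move=> mB Boo; rewrite (measure_label mB) -sum_fine// => u _.
rewrite ge0_fin_numE//; apply: le_lt_trans Boo; apply: le_measure; rewrite ?inE//.
exact: measurableI.
Qed.

End finite_label.

Section simple.
Context {d} {T : measurableType d} {R : realType} {E : completeNormedModType R}.
Implicit Types (s t f : T -> E) (A B : set T).

Lemma simple_fun_label (U : finType) (a : T -> U) (h : U -> E) :
  (forall u, measurable (a @^-1` [set u])) -> simple_fun (h \o a).
Proof.
move=> ma; split; last by move=> e; exact: (measurable_preimage_label ma (h @^-1` [set e])).
apply: (@sub_finite_set _ _ (h @` [set: U])).
  by move=> _ [x _ <-]; exists (a x).
exact/finite_image/finite_finset.
Qed.

Lemma simple_funP s : simple_fun s -> exists (U : finType) (a : T -> U) (h : U -> E),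
  (forall u, measurable (a @^-1` [set u])) /\ s = h \o a.
Proof.
move=> [fs ms]; pose F := fset_set (range s).
have sF x : s x \in F by rewrite in_fset_set// inE; exists x.
exists F, (fun x => FSetSub (sF x)), val; split=> // u.
rewrite (_ : _ @^-1` _ = s @^-1` [set val u]); first exact: ms.
by apply/seteqP; split=> [x /= <-//|x /= su]; exact: val_inj.
Qed.

(** Two simple functions are functions of a common finite label; this replaces
    common refinements of partitions. *)
Lemma simple_fun_label2 s t : simple_fun s -> simple_fun t ->
  exists (U : finType) (a : T -> U) (h k : U -> E),
  [/\ forall u, measurable (a @^-1` [set u]), s = h \o a & t = k \o a].
Proof.
move=> /simple_funP[U [a [h [ma ->]]]] /simple_funP[V [b [k [mb ->]]]].
exists (U * V)%type, (fun x => (a x, b x)), (h \o fst), (k \o snd); split=> // -[u v].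
rewrite (_ : _ @^-1` _ = a @^-1` [set u] `&` b @^-1` [set v]); first exact: measurableI.
by apply/seteqP; split=> [x /= [<- <-]//|x /= [-> ->]].
Qed.

Variable mu : {measure set T -> \bar R}.

Lemma simple_integral_label (U : finType) (a : T -> U) (h : U -> E) A :
  (forall u, measurable (a @^-1` [set u])) -> measurable A -> (mu A < +oo)%E ->
  simple_integral mu A (h \o a) =
  \sum_u fine (mu (A `&` a @^-1` [set u])) *: h u.
Proof.
move=> ma mA Aoo; have [fha mha] := simple_fun_label h ma.
pose c u := fine (mu (A `&` a @^-1` [set u])).
rewrite /simple_integral fsbig_finite//=; set F := fset_set _.
transitivity (\sum_(e <- F) \sum_u (if h u == e then c u else 0) *: e).
  apply: eq_bigr => e _; rewrite -scaler_suml; congr (_ *: _).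
  have mAe : measurable (A `&` (h \o a) @^-1` [set e]) by exact: measurableI.
  rewrite (fine_measure_label ma mAe); last first.
    by apply: le_lt_trans Aoo; apply: le_measure; rewrite ?inE.
  apply: eq_bigr => u _; case: eqP => [hu|hu]; rewrite -?/(c u).
    congr (fine (mu _)); apply/seteqP; split=> [x [[Ax _] ax]//|x [Ax ax]].
    by split=> //; split=> //=; rewrite ax.
  rewrite (_ : _ `&` _ = set0) ?measure0//.
  by apply/seteqP; split=> // x [[_ /= he] ax]; apply: hu; rewrite -ax.
rewrite exchange_big/=; apply: eq_bigr => u _.
have [[x _ ax]|na] := pselect (range a u).
  rewrite (bigD1_seq (h u)) ?fset_uniq//=; last first.
    by rewrite in_fset_set// inE; exists x => //=; rewrite ax.
  by rewrite eqxx big1 ?addr0// => e /negbTE; rewrite eq_sym => ->; rewrite scale0r.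
have -> : fine (mu (A `&` a @^-1` [set u])) = 0.
  rewrite (_ : _ `&` _ = set0) ?measure0//.
  by apply/seteqP; split=> // x [_ /= ax]; apply: na; exists x.
have cu : c u = 0.
  rewrite /c (_ : _ `&` _ = set0) ?measure0//.
  by apply/seteqP; split=> // x [_ /= ax]; apply: na; exists x.
by rewrite scale0r big1// => e _; rewrite cu; case: ifP; rewrite scale0r.
Qed.

Lemma simple_integralB_le s t A : simple_fun s -> simple_fun t -> measurable A ->
  (mu A < +oo)%E ->
  (`|simple_integral mu A s - simple_integral mu A t|%:E <=
   \int[mu]_(x in A) `|s x - t x|%:E)%E.
Proof.
move=> ss st mA Aoo; have [U [a [h [k [ma -> ->]]]]] := simple_fun_label2 ss st.
have muoo u : (mu (A `&` a @^-1` [set u]) < +oo)%E.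
  apply: le_lt_trans Aoo; apply: le_measure; rewrite ?inE//; exact: measurableI.
rewrite !simple_integral_label// -sumrB.
rewrite (@integral_label_fun _ _ _ _ a ma mu A (fun u => `|h u - k u|))//.
rewrite (eq_bigr (fun u => (fine (mu (A `&` a @^-1` [set u])) * `|h u - k u|)%:E)).
  rewrite sumEFin lee_fin (le_trans (ler_norm_sum _ _ _))//.
  by apply: ler_sum => u _; rewrite -scalerBr normrZ ger0_norm.
by move=> u _; rewrite EFinM fineK 1?muleC// ge0_fin_numE.
Qed.

Lemma simple_integral_le s A : simple_fun s -> measurable A -> (mu A < +oo)%E ->
  (`|simple_integral mu A s|%:E <= \int[mu]_(x in A) `|s x|%:E)%E.
Proof.
move=> ss mA Aoo; pose a (x : T) := tt; pose h (u : unit) : E := 0.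
have ma u : measurable (a @^-1` [set u]).
  by rewrite (_ : _ @^-1` _ = setT)//; apply/seteqP; split=> // x _ /=; case: u.
have := simple_integralB_le ss (simple_fun_label h ma) mA Aoo.
under [X in (_ <= X)%E -> _]eq_integral do rewrite /h /= subr0.
by rewrite simple_integral_label// [X in `|_ - X|]big1 ?subr0// => u _; rewrite scaler0.
Qed.

Lemma simple_integral_partition (X : finType) (b : T -> X) s A :
  (forall x, measurable (b @^-1` [set x])) -> simple_fun s -> measurable A ->
  (mu A < +oo)%E ->
  simple_integral mu A s = \sum_x simple_integral mu (A `&` b @^-1` [set x]) s.
Proof.
move=> mb /simple_funP[U [a [h [ma ->]]]] mA Aoo.
have le A' B' : measurable A' -> measurable B' -> (mu A' < +oo)%E ->
    (mu (A' `&` B') < +oo)%E.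
  move=> mA' mB' oo; apply: le_lt_trans oo; apply: le_measure; rewrite ?inE//.
  exact: measurableI.
rewrite simple_integral_label//.
under [RHS]eq_bigr => x _.
  rewrite simple_integral_label//; [|exact: measurableI|exact: le].
  over.
rewrite exchange_big/=; apply: eq_bigr => u _; rewrite -scaler_suml; congr (_ *: _).
rewrite (fine_measure_label mb); [|exact: measurableI|exact: le].
by apply: eq_bigr => x _; rewrite setIAC.
Qed.

Lemma measurable_norm_strongly f : strongly_measurable f ->
  measurable_fun setT (fun x => `|f x|).
Proof.
move=> [s ss sf]; apply: (@measurable_fun_cvg _ _ _ _ (fun n x => `|s n x|)).
  move=> n; have [U [a [h [ma ->]]]] := simple_funP (ss n).
  exact: (measurable_fun_label ma (fun u => `|h u|)).
by move=> x _; apply: cvg_norm; exact: sf.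
Qed.

Lemma strongly_measurableB f t : strongly_measurable f -> simple_fun t ->
  strongly_measurable (fun x => f x - t x).
Proof.
move=> [s ss sf] st; exists (fun n x => s n x - t x).
  move=> n; have [U [a [h [k [ma -> ->]]]]] := simple_fun_label2 (ss n) st.
  exact: (simple_fun_label (fun u => h u - k u) ma).
by move=> x; apply: cvgB; [exact: sf|exact: cvg_cst].
Qed.

Lemma strongly_measurable_simple s : simple_fun s -> strongly_measurable s.
Proof. by move=> ss; exists (fun=> s) => // x; exact: cvg_cst. Qed.

End simple.

(** * The Bochner integral *)
Section bochner_theory.
Context {d} {T : measurableType d} {R : realType} {E : completeNormedModType R}.
Variable mu : {measure set T -> \bar R}.
Implicit Types (s t f : T -> E) (A B : set T).

Lemma measurable_norm_strongly_in f A : strongly_measurable f ->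
  measurable A -> measurable_fun A (fun x => `|f x|%:E).
Proof.
move=> sf mA; apply/measurable_EFinP; apply: measurable_funTS.
exact: measurable_norm_strongly.
Qed.

Lemma bochner_approx f A : strongly_measurable f -> measurable A ->
  (\int[mu]_(x in A) `|f x|%:E < +oo)%E ->
  exists s : (T -> E)^nat, [/\ forall n, simple_fun (s n),
    forall n, (\int[mu]_(x in A) `|s n x|%:E < +oo)%E &
    (\int[mu]_(x in A) `|f x - s n x|%:E)%E @[n --> \oo] --> 0%E].
Proof.
move=> sf mA foo; have [s ss scvg] := sf.
have mf := measurable_norm_strongly sf.
(* The approximating sequence is cut off where it is far from its limit, so
   that it is dominated. *)
pose s' n x := if `|s n x| <= 2 * `|f x| then s n x else 0.
have ss' n : simple_fun (s' n).
  have [U [a [h [ma sE]]]] := simple_funP (ss n).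
  have mB : measurable [set x | `|s n x| <= 2 * `|f x|].
    have m1 := measurable_norm_strongly (strongly_measurable_simple (ss n)).
    have := @measurable_fun_ler _ T R setT _ _ m1 (measurable_funM (measurable_cst (2 : R)) mf).
    by move=> /(_ measurableT [set true] I); rewrite setTI.
  pose b x := (a x, `|s n x| <= 2 * `|f x|).
  have mb u : measurable (b @^-1` [set u]).
    case: u => u c; rewrite (_ : _ @^-1` _ = a @^-1` [set u] `&`
      (if c then [set x | `|s n x| <= 2 * `|f x|] else ~` [set x | `|s n x| <= 2 * `|f x|])).
      by apply: measurableI => //; case: c => //; exact: measurableC.
    apply/seteqP; split=> [x /= [au cu]|x [/= au]].
      by split=> //; rewrite -cu; case: ifPn => //= /negP.
    case: c => /= le_sf; rewrite /b au; first by rewrite le_sf.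
    by move/negP/negbTE : le_sf => ->.
  rewrite (_ : s' n = (fun u => if u.2 then h u.1 else 0) \o b); first exact: simple_fun_label.
  by apply/funext => x; rewrite /s' /b /= sE.
have s'f n x : `|s' n x| <= 2 * `|f x|.
  by rewrite /s'; case: ifP => // _; rewrite normr0 mulr_ge0.
have fint : mu.-integrable A (fun x => (3 * `|f x|)%:E).
  apply/integrableP; split.
    by apply/measurable_EFinP/measurable_funM => //; exact: measurable_funTS.
  under eq_integral do rewrite gee0_abs ?lee_fin ?mulr_ge0// EFinM.
  rewrite ge0_integralZl//; last exact: measurable_norm_strongly_in.
  by rewrite lte_mul_pinfty.
exists s'; split=> // [n|].
  apply: (@le_lt_trans _ _ (\int[mu]_(x in A) (2 * `|f x|)%:E)%E).
    apply: ge0_le_integral => //.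
    - exact/measurable_norm_strongly_in/mA/strongly_measurable_simple.
    - by apply/measurable_EFinP/measurable_funM => //; exact: measurable_funTS.
    - by move=> x _; rewrite lee_fin.
  under eq_integral do rewrite EFinM.
  rewrite ge0_integralZl//; last exact: measurable_norm_strongly_in.
  by rewrite lte_mul_pinfty.
have [| | | | | _ _ ] := @dominated_convergence _ T R mu A mA
  (fun n x => `|f x - s' n x|%:E) (cst 0%E) (fun x => (3 * `|f x|)%:E).
- by move=> n; apply: measurable_norm_strongly_in => //; exact: strongly_measurableB.
- exact: measurable_cst.
- apply: aeW => x _; rewrite -[X in _ --> X]/(0%:E).
  apply: cvg_EFin; first exact: nearW.
  rewrite /comp/=; have [fx0|fx0] := eqVneq (f x) 0.
    rewrite (_ : (fun n => _) = fun=> 0); first exact: cvg_cst.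
    apply/funext => n; have := s'f n x; rewrite fx0 normr0 mulr0 normr_le0 => /eqP ->.
    by rewrite subr0 normr0.
  have nfx : 0 < `|f x| by rewrite normr_gt0.
  have e0 : `|f x - s n x| @[n --> \oo] --> 0.
    rewrite -(@normr0 _ E) -(subrr (f x)); apply: cvg_norm; apply: cvgB; [exact: cvg_cst|exact: scvg].
  apply: cvg_trans e0; apply: near_eq_cvg; near=> n.
  rewrite /s' ifT//; have : `|s n x| < 2 * `|f x|.
    near: n; have h : `|s n x| @[n --> \oo] --> `|f x| by apply: cvg_norm; exact: scvg.
    move/cvgrPdist_lt : h => /(_ _ nfx).
    by apply: filterS => n; rewrite distrC ltr_distl => /andP[_]; lra.
  exact: ltW.
- exact: fint.
- apply: aeW => x n _; rewrite gee0_abs ?lee_fin//.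
  by rewrite (le_trans (ler_normB _ _))//; have := s'f n x; lra.
by rewrite integral0.
Unshelve. all: by end_near. Qed.

Lemma simple_integral_dist f s t A : strongly_measurable f -> simple_fun s ->
  simple_fun t -> measurable A -> (mu A < +oo)%E ->
  (`|simple_integral mu A s - simple_integral mu A t|%:E <=
   \int[mu]_(x in A) `|f x - s x|%:E + \int[mu]_(x in A) `|f x - t x|%:E)%E.
Proof.
move=> sf ss st mA Aoo; apply: le_trans (simple_integralB_le ss st mA Aoo) _.
have m1 := measurable_norm_strongly_in (strongly_measurableB sf ss) mA.
have m2 := measurable_norm_strongly_in (strongly_measurableB sf st) mA.
rewrite -ge0_integralD//; apply: ge0_le_integral => //.
- apply: measurable_norm_strongly_in => //.
  by apply: strongly_measurableB => //; exact: strongly_measurable_simple.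
- exact: emeasurable_funD.
- move=> x _; rewrite -EFinD lee_fin [leRHS]addrC.
  have -> : s x - t x = (f x - t x) - (f x - s x) by rewrite opprB [RHS]addrC addrA subrK.
  exact: ler_normB.
Qed.

Lemma cvg0_near_lt (e : (\bar R)^nat) : e n @[n --> \oo] --> 0%E ->
  forall r : R, 0 < r -> \forall n \near \oo, (e n < r%:E)%E.
Proof.
move=> e0 r r0; have := e0 `]-oo, r%:E[%classic; apply.
by apply: open_nbhs_nbhs; split; [exact: lray_open|rewrite /= in_itv/= lte_fin].
Qed.

Lemma is_bochner_integral_cvg f (s : (T -> E)^nat) A : strongly_measurable f -> measurable A ->
  (mu A < +oo)%E -> (forall n, simple_fun (s n)) ->
  (forall n, (\int[mu]_(x in A) `|s n x|%:E < +oo)%E) ->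
  (\int[mu]_(x in A) `|f x - s n x|%:E)%E @[n --> \oo] --> 0%E ->
  cvgn (fun n => simple_integral mu A (s n)).
Proof.
move=> sf mA Aoo ss soo s0; apply/cauchy_cvgP/cauchy_exP => _/posnumP[e].
have e20 : 0 < e%:num / 2 by rewrite divr_gt0.
have [N _ Ne] := cvg0_near_lt s0 e20.
exists (simple_integral mu A (s N)); exists N => // n Nn /=.
rewrite -ball_normE /= -lte_fin.
apply: le_lt_trans (simple_integral_dist sf (ss N) (ss n) mA Aoo) _.
by rewrite [X in (_ < X%:E)%E](splitr e%:num) EFinD lteD//; apply: Ne => /=.
Qed.

(** Uniqueness is what gives meaning to the choice in [bochner_integral]. *)
Lemma is_bochner_integral_unique f A v w : measurable A -> (mu A < +oo)%E ->
  is_bochner_integral mu A f v -> is_bochner_integral mu A f w -> v = w.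
Proof.
move=> mA Aoo [sf [s [ss soo s0 sv]]] [_ [t [st too t0 tw]]].
apply/eqP; rewrite -subr_eq0 -normr_le0; apply/ler_addgt0Pr => e e0; rewrite add0r.
have e40 : 0 < e / 4 by rewrite divr_gt0.
near \oo => n.
have h1 : `|v - simple_integral mu A (s n)| <= e / 4.
  by near: n; move/cvgrPdist_le : sv; apply.
have h2 : `|w - simple_integral mu A (t n)| <= e / 4.
  by near: n; move/cvgrPdist_le : tw; apply.
have h3 : `|simple_integral mu A (s n) - simple_integral mu A (t n)| <= e / 4 + e / 4.
  rewrite -lee_fin EFinD (le_trans (simple_integral_dist sf (ss n) (st n) mA Aoo))//.
  by rewrite leeD// ltW//; near: n; exact: cvg0_near_lt.
have -> : v - w = (v - simple_integral mu A (s n)) +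
    ((simple_integral mu A (s n) - simple_integral mu A (t n)) -
     (w - simple_integral mu A (t n))).
  by rewrite opprB addrA (addrA (v - _)) subrK addrA subrK.
rewrite (le_trans (ler_normD _ _))// (le_trans (lerD h1 (ler_normB _ _)))//.
by rewrite (le_trans (lerD (lexx _) (lerD h3 h2)))//; lra.
Unshelve. all: by end_near. Qed.

Lemma bochner_integralE f A v : measurable A -> (mu A < +oo)%E ->
  is_bochner_integral mu A f v -> bochner_integral mu A f = v.
Proof.
move=> mA Aoo fv; apply: (is_bochner_integral_unique mA Aoo _ fv).
exact: (xgetPex _ (ex_intro _ v fv)).
Qed.

Lemma bochner_integral_cvg f (s : (T -> E)^nat) A : strongly_measurable f -> measurable A ->
  (mu A < +oo)%E -> (forall n, simple_fun (s n)) ->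
  (forall n, (\int[mu]_(x in A) `|s n x|%:E < +oo)%E) ->
  (\int[mu]_(x in A) `|f x - s n x|%:E)%E @[n --> \oo] --> 0%E ->
  simple_integral mu A (s n) @[n --> \oo] --> bochner_integral mu A f.
Proof.
move=> sf mA Aoo ss soo s0; have sc := is_bochner_integral_cvg sf mA Aoo ss soo s0.
rewrite (@bochner_integralE f A (lim (simple_integral mu A (s n) @[n --> \oo])))//.
by split=> //; exists s; split.
Qed.

(** The constant sequence approximates a simple function. *)
Lemma bochner_integral_label (U : finType) (a : T -> U) (h : U -> E) A :
  (forall u, measurable (a @^-1` [set u])) -> measurable A -> (mu A < +oo)%E ->
  bochner_integral mu A (h \o a) =
  \sum_u fine (mu (A `&` a @^-1` [set u])) *: h u.
Proof.
move=> ma mA Aoo; have sh := simple_fun_label h ma.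
rewrite -simple_integral_label//; apply: bochner_integralE => //.
split; first exact: strongly_measurable_simple.
exists (fun=> h \o a); split=> //; last exact: cvg_cst.
  move=> _; rewrite (@integral_label_fun _ _ _ _ a ma mu A (fun u => `|h u|))//.
  apply: lte_sum_pinfty => u _; rewrite lte_mul_pinfty//.
  by apply: le_lt_trans Aoo; apply: le_measure; rewrite ?inE//; exact: measurableI.
under eq_fun do under eq_integral do rewrite subrr normr0.
by rewrite integral0; exact: cvg_cst.
Qed.

Section integrable.
Variables (f : T -> E) (A : set T).
Hypotheses (sf : strongly_measurable f) (mA : measurable A) (Aoo : (mu A < +oo)%E).
Hypothesis foo : (\int[mu]_(x in A) `|f x|%:E < +oo)%E.

(** A sequence that approximates [f] on [A] does so on every piece, so that
    additivity passes to the limit. *)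
Lemma bochner_integral_partition (X : finType) (b : T -> X) :
  (forall x, measurable (b @^-1` [set x])) ->
  bochner_integral mu A f = \sum_x bochner_integral mu (A `&` b @^-1` [set x]) f.
Proof.
move=> mb; have [s [ss soo s0]] := bochner_approx sf mA foo.
have mAb x : measurable (A `&` b @^-1` [set x]) by exact: measurableI.
have sub (x : X) (g : T -> E) : strongly_measurable g ->
    (\int[mu]_(y in A `&` b @^-1` [set x]) `|g y|%:E <= \int[mu]_(y in A) `|g y|%:E)%E.
  by move=> sg; apply: ge0_subset_integral => //; exact: measurable_norm_strongly_in.
apply: (@cvg_unique _ _ ((fun n => simple_integral mu A (s n)) @ \oo)).
- exact: norm_hausdorff.
- exact: bochner_integral_cvg.
- rewrite (_ : (fun n => simple_integral mu A (s n)) =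
    fun n => \sum_x simple_integral mu (A `&` b @^-1` [set x]) (s n)); last first.
    by apply/funext => n; exact: simple_integral_partition.
  apply: cvg_big => [|x _]; first exact: add_continuous.
  apply: bochner_integral_cvg => //.
  + by apply: le_lt_trans Aoo; apply: le_measure; rewrite ?inE.
  + move=> n; apply: le_lt_trans (soo n); apply: sub.
    exact: strongly_measurable_simple.
  + apply: squeeze_cvge (@cvg_cst _ _ _ _ _) s0; apply: nearW => n.
    by rewrite integral_ge0//= sub//; exact: strongly_measurableB.
Qed.

Lemma norm_bochner_integral_le :
  (`|bochner_integral mu A f|%:E <= \int[mu]_(x in A) `|f x|%:E)%E.
Proof.
have [s [ss soo s0]] := bochner_approx sf mA foo.
have sv := bochner_integral_cvg sf mA Aoo ss soo s0.
apply/lee_addgt0Pr => e e0; have e20 : 0 < e / 2 by rewrite divr_gt0.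
near \oo => n.
have h1 : `|bochner_integral mu A f - simple_integral mu A (s n)| <= e / 2.
  by near: n; move/cvgrPdist_le : sv; apply.
have h2 : (\int[mu]_(x in A) `|f x - s n x|%:E <= (e / 2)%:E)%E.
  by rewrite ltW//; near: n; exact: cvg0_near_lt.
have h4 : (\int[mu]_(x in A) `|s n x|%:E <=
    \int[mu]_(x in A) `|f x|%:E + \int[mu]_(x in A) `|f x - s n x|%:E)%E.
  have m1 := measurable_norm_strongly_in (strongly_measurableB sf (ss n)) mA.
  have m2 := measurable_norm_strongly_in sf mA.
  rewrite -ge0_integralD//; apply: ge0_le_integral => //.
  - exact/measurable_norm_strongly_in/mA/strongly_measurable_simple.
  - exact: emeasurable_funD.
  - move=> x _; rewrite -EFinD lee_fin -{1}(subKr (f x) (s n x)).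
    exact: ler_normB.
rewrite -(subrK (simple_integral mu A (s n)) (bochner_integral mu A f)).
apply: (@le_trans _ _ ((e / 2)%:E + \int[mu]_(x in A) `|s n x|%:E)%E).
  apply: (@le_trans _ _ ((e / 2)%:E + `|simple_integral mu A (s n)|%:E)%E).
    by rewrite -EFinD lee_fin (le_trans (ler_normD _ _))// lerD2r.
  by rewrite leeD2l//; exact: simple_integral_le.
apply: (@le_trans _ _ ((e / 2)%:E + (\int[mu]_(x in A) `|f x|%:E + (e / 2)%:E))%E).
  by rewrite leeD2l// (le_trans h4)// leeD2l.
by rewrite addeCA -EFinD -splitr.
Unshelve. all: by end_near. Qed.

End integrable.
End bochner_theory.

(** * Norms of vector-valued functions *)
Section Lp.
Context {d} {T : measurableType d} {R : realType}.
Variable mu : {measure set T -> \bar R}.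

(** The power of the norm is additive over disjoint sets. *)
Definition Lp_integral {E : completeNormedModType R} (p : R) (f : T -> E) : \bar R :=
  (\int[mu]_x (`|f x| `^ p)%:E)%E.

Lemma Lp_integral_ge0 (E : completeNormedModType R) p (f : T -> E) :
  (0 <= Lp_integral p f)%E.
Proof. by apply: integral_ge0 => x _; rewrite lee_fin powR_ge0. Qed.

Lemma Lp_norm_poweR (E : completeNormedModType R) p (f : T -> E) : 0 < p ->
  (Lp_norm mu p f `^ p = Lp_integral p f)%E.
Proof.
move=> p0; rewrite /Lp_norm poweR_Lnorm ?gt_eqF//.
by apply: eq_integral => x _; rewrite gee0_abs ?lee_fin// poweR_EFin.
Qed.

Lemma Lp_normE (E : completeNormedModType R) p (f : T -> E) : 0 < p ->
  (Lp_norm mu p f = Lp_integral p f `^ p^-1)%E.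
Proof.
move=> p0; rewrite -Lp_norm_poweR// -poweRrM mulfV ?gt_eqF// poweRe1//.
exact: Lnorm_ge0.
Qed.

Lemma Lp_norm_le_integral (E F : completeNormedModType R) p (K : R)
    (f : T -> E) (g : T -> F) : 0 < p ->
  (Lp_norm mu p g <= K%:E * Lp_norm mu p f)%E ->
  (Lp_integral p g <= (`|K| `^ p)%:E * Lp_integral p f)%E.
Proof.
move=> p0 gf; have {}gf : (Lp_norm mu p g <= `|K|%:E * Lp_norm mu p f)%E.
  by apply: le_trans gf _; rewrite lee_wpmul2r ?Lnorm_ge0// lee_fin ler_norm.
rewrite -!Lp_norm_poweR// -poweR_EFin -poweRM ?lee_fin ?Lnorm_ge0//.
apply: gt0_ler_poweR => //; rewrite ?ltW// ?in_itv/= ?leey ?andbT ?Lnorm_ge0//.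
by rewrite mule_ge0 ?lee_fin// Lnorm_ge0.
Qed.

Lemma Lp_integral_le_norm (E F : completeNormedModType R) p (K : R)
    (f : T -> E) (g : T -> F) : 0 < p -> 0 <= K ->
  (Lp_integral p g <= K%:E * Lp_integral p f)%E ->
  (Lp_norm mu p g <= (K `^ p^-1)%:E * Lp_norm mu p f)%E.
Proof.
move=> p0 K0 gf; rewrite !Lp_normE// -poweR_EFin -poweRM ?lee_fin ?Lp_integral_ge0//.
apply: gt0_ler_poweR => //; rewrite ?invr_ge0 ?(ltW p0)// ?in_itv/= ?leey ?andbT ?Lp_integral_ge0//.
by rewrite mule_ge0 ?lee_fin// Lp_integral_ge0.
Qed.

Lemma Lp_integral_lty (E : completeNormedModType R) p (f : T -> E) : 0 < p ->
  ((Lp_norm mu p f < +oo) = (Lp_integral p f < +oo))%E.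
Proof.
move=> p0; apply/idP/idP => h.
  by rewrite -Lp_norm_poweR// poweR_lty.
by rewrite Lp_normE// poweR_lty.
Qed.

Lemma measurable_norm_powR (E : completeNormedModType R) p (f : T -> E) (A : set T) :
  strongly_measurable f -> measurable A ->
  measurable_fun A (fun x => (`|f x| `^ p)%:E).
Proof.
move=> sf mA; apply/measurable_EFinP.
apply: (@measurableT_comp _ _ _ _ _ _ (fun t : R => t `^ p)).
  exact: measurable_powR.
by apply: measurable_funTS; exact: measurable_norm_strongly.
Qed.

Lemma integral_norm_lty (E : completeNormedModType R) p (f : T -> E) (A : set T) :
  1 < p -> strongly_measurable f -> measurable A -> (mu A < +oo)%E ->
  (\int[mu]_(x in A) (`|f x| `^ p)%:E < +oo)%E ->
  (\int[mu]_(x in A) `|f x|%:E < +oo)%E.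
Proof.
move=> p1 sf mA Aoo foo.
apply: (@le_lt_trans _ _ (\int[mu]_(x in A) (1%:E + (`|f x| `^ p)%:E))%E).
  apply: ge0_le_integral => //.
  - exact: measurable_norm_strongly_in.
  - by apply: emeasurable_funD; [exact: measurable_cst|exact: measurable_norm_powR].
  - move=> x _; rewrite -EFinD lee_fin; have [f1|f1] := leP `|f x| 1.
      by rewrite (le_trans f1)// lerDl powR_ge0.
    rewrite -[leLHS]add0r lerD// -[leLHS]powRr1//.
    by apply: ler_powR; rewrite ltW.
rewrite ge0_integralD//; last exact: measurable_norm_powR.
by rewrite (integral_cst mu mA 1%:E) mul1e lte_add_pinfty.
Qed.

(** Jensen's inequality for the norm of an average; pointwise, it is the
    tangent line inequality for the power at the norm of the average. *)
Lemma norm_average_powR (E : completeNormedModType R) p (f : T -> E) (A : set T) :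
  1 < p -> strongly_measurable f -> measurable A -> (mu A < +oo)%E ->
  (\int[mu]_(x in A) (`|f x| `^ p)%:E < +oo)%E ->
  ((fine (mu A) * `|(fine (mu A))^-1 *: bochner_integral mu A f| `^ p)%:E <=
   \int[mu]_(x in A) (`|f x| `^ p)%:E)%E.
Proof.
move=> p1 sf mA Aoo foo; have p0 : 0 < p by exact: lt_trans p1.
have J0 : (0 <= \int[mu]_(x in A) (`|f x| `^ p)%:E)%E.
  by apply: integral_ge0 => x _; rewrite lee_fin powR_ge0.
have f1oo := integral_norm_lty p1 sf mA Aoo foo.
have I0 : (0 <= \int[mu]_(x in A) `|f x|%:E)%E by exact: integral_ge0.
have := norm_bochner_integral_le sf mA Aoo f1oo.
set M := fine (mu A); set t := `|M^-1 *: _|.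
have M0 : 0 <= M by exact: fine_ge0.
have [->|Mn0] := eqVneq M 0; first by rewrite mul0r.
have Mp : 0 < M by rewrite lt_neqAle eq_sym Mn0.
have -> : `|bochner_integral mu A f| = M * t.
  by rewrite /t normrZ ger0_norm ?invr_ge0// mulrA divff// mul1r.
have t0 : 0 <= t by exact: normr_ge0.
have muA : mu A = M%:E by rewrite fineK// ge0_fin_numE.
have : (\int[mu]_(x in A) ((p * t `^ (p - 1))%:E * `|f x|%:E) <=
    \int[mu]_(x in A) ((`|f x| `^ p)%:E + ((p - 1) * t `^ p)%:E))%E.
  have c0 : 0 <= p * t `^ (p - 1) by rewrite mulr_ge0 ?powR_ge0// ltW.
  have c1 : 0 <= (p - 1) * t `^ p by rewrite mulr_ge0 ?powR_ge0// subr_ge0 ltW.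
  apply: ge0_le_integral => //.
  - by move=> x _; rewrite mule_ge0// lee_fin.
  - by apply: measurable_funeM; exact: measurable_norm_strongly_in.
  - by apply: emeasurable_funD; [exact: measurable_norm_powR|exact: measurable_cst].
  - move=> x _; rewrite -EFinM -EFinD lee_fin -mulrA [t `^ _ * _]mulrC.
    exact: young_powR.
rewrite ge0_integralZl//; last 2 first.
- exact: measurable_norm_strongly_in.
- by rewrite lee_fin mulr_ge0 ?powR_ge0// ltW.
rewrite ge0_integralD//; last 2 first.
- exact: measurable_norm_powR.
- by move=> x _; rewrite lee_fin mulr_ge0 ?powR_ge0// subr_ge0 ltW.
rewrite (integral_cst mu mA ((p - 1) * t `^ p)%:E) muA.
rewrite -(fineK (_ : (\int[mu]_(x in A) (`|f x| `^ p)%:E)%E \is a fin_num)) ?ge0_fin_numE//.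
rewrite -(fineK (_ : (\int[mu]_(x in A) `|f x|%:E)%E \is a fin_num)) ?ge0_fin_numE//.
rewrite -!EFinM -EFinD !lee_fin => h1 h2.
have : p * t `^ (p - 1) * (M * t) <= p * t `^ (p - 1) * fine (\int[mu]_(x in A) `|f x|%:E).
  by rewrite ler_wpM2l// mulr_ge0 ?powR_ge0// ltW.
move=> /le_trans/(_ h1).
have -> : p * t `^ (p - 1) * (M * t) = p * M * t `^ p.
  by rewrite -(@mulr_powRB1 _ t p)//; ring.
lra.
Qed.

End Lp.

(** * Dyadic cubes *)
Section cubes.
Context {R : realType} {n : nat}.
Implicit Types (Q : cube_index n) (x y : Rn R n).

Lemma measurable_cube Q : measurable (cube Q : set (Rn R n)).
Proof. exact: measurable_box. Qed.

Let pow2_gt0 (k : int) : 0 < (2 : R) ^ k. Proof. by rewrite exprz_gt0. Qed.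

Lemma cube_nested Q Q' x : (Q'.1 <= Q.1)%R -> cube Q x -> cube Q' x ->
  (cube Q : set (Rn R n)) `<=` cube Q'.
Proof.
move=> QQ' Qx Q'x y Qy i.
have [d dE] : exists d : nat, Q.1 = Q'.1 + d%:Z.
  by exists `|Q.1 - Q'.1|%N; rewrite gez0_abs ?subr_ge0// subrKC.
have {}dE : (2 : R) ^ (- Q'.1) = 2 ^+ d * 2 ^ (- Q.1).
  by rewrite dE opprD expfzDr// mulrCA exprnP -expfzDr// subrr expr0z mulr1.
have := Qx i; have := Q'x i; have := Qy i.
set u := (2 : R) ^ (- Q.1) in dE *; have u0 : 0 < u by exact: pow2_gt0.
rewrite dE !mulrA -!ler_pdivlMr// -!ltr_pdivrMr//.
set a := tnth Q.2 i; set b := tnth Q'.2 i.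
set xi := (tnth x i : R) / u; set yi := (tnth y i : R) / u.
move=> /andP[ay ya] /andP[bx xb] /andP[ax xa].
have cast (c : int) : c%:~R * 2 ^+ d = (c * 2 ^+ d)%:~R :> R.
  by rewrite intrM rmorphXn.
have cast1 : (b%:~R + 1) * 2 ^+ d = ((b + 1) * 2 ^+ d)%:~R :> R.
  by rewrite -cast intrD.
have d0 : 0 < (2 : R) ^+ d by exact: exprn_gt0.
rewrite ler_pdivlMr// cast in bx; rewrite ltr_pdivrMr// cast1 in xb.
rewrite ler_pdivlMr// cast ltr_pdivrMr// cast1.
have h1 : (b * 2 ^+ d <= a)%R.
  by rewrite -ltzD1 -(ltr_int R) intrD (le_lt_trans bx).
have h2 : (a + 1 <= (b + 1) * 2 ^+ d)%R.
  by rewrite lezD1 -(ltr_int R) (le_lt_trans ax).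
rewrite -(ler_int R) in h1; rewrite -(ler_int R) intrD in h2.
by rewrite (le_trans h1 ay) (lt_le_trans ya h2).
Qed.

Lemma cube_inj Q Q' x : Q.1 = Q'.1 -> cube Q x -> cube Q' x -> Q = Q'.
Proof.
case: Q Q' => [k m] [k' m'] /= <- Qx Q'x; congr pair; apply: eq_from_tnth => i.
have := Qx i; have := Q'x i; rewrite /=.
set u := (2 : R) ^ (- k); have u0 : 0 < u by exact: pow2_gt0.
rewrite -!ler_pdivlMr// -!ltr_pdivrMr// => /andP[a b] /andP[c e].
apply/le_anti; rewrite -!ltzD1 -!(ltr_int R) !intrD.
by rewrite (le_lt_trans c b) (le_lt_trans a e).
Qed.

(** A cube is bounded, hence covered by finitely many of the boxes of finite
    measure that local finiteness provides. *)
Lemma locally_finite_cube (mu : {measure set (Rn R n) -> \bar R}) Q :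
  locally_finite mu -> (mu (cube Q) < +oo)%E.
Proof.
move=> lf.
pose box x (e : R) : set (Rn R n) := [set y | forall i, `|(tnth y i : R) - tnth x i| < e].
have mbox x e : measurable (box x e).
  rewrite (_ : box x e = \bigcap_(i in [set: 'I_n])
    ((fun y : Rn R n => tnth y i) @^-1` `](tnth x i : R) - e, (tnth x i : R) + e[%classic)).
    apply: fin_bigcap_measurable => // i _.
    by rewrite -[X in measurable X]setTI; apply: measurable_tnth.
  apply/seteqP; split=> y /= h i; first by move=> _; rewrite /= in_itv/= -ltr_distl.
  by have := h i I; rewrite /= in_itv/= -ltr_distl.
pose tr (y : Rn R n) : 'rV[R]_n := \row_i (tnth y i : R).
pose rt (v : 'rV[R]_n) : Rn R n := [tuple (v ord0 i : measurableTypeR R) | i < n].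
have /choice[e eP] : forall v : 'rV[R]_n, exists e : R, 0 < e /\ (mu (box (rt v) e) < +oo)%E.
  by move=> v; have [e e0 eoo] := lf (rt v); exists e.
pose J i : set R := `[(tnth Q.2 i)%:~R * 2 ^ (- Q.1),
  ((tnth Q.2 i)%:~R + 1) * 2 ^ (- Q.1)]%classic.
pose K : set 'rV[R]_n := [set v | forall i, J i (v ord0 i)].
have : compact K by apply: (@rV_compact R n J) => i; exact: segment_compact.
rewrite compact_cover => /(_ _ [set: 'rV[R]_n] (fun v => ball v (e v))).
case=> [v _|v _|D _ KD].
- exact: ball_open.
- by exists v => //; apply: ballxx; exact: (eP v).1.
have cD : cube Q `<=` \big[setU/set0]_(v <- enum_fset D) box (rt v) (e v).
  move=> y Qy; have : K (tr y).
    by move=> i /=; rewrite /J /= in_itv/= mxE; have /andP[-> /ltW] := Qy i.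
  move=> /KD[v /= vD yv]; rewrite -bigcup_seq; exists v => //= i.
  have := yv.2 ord0 i; rewrite /ball/= mxE distrC.
  by rewrite tnth_mktuple.
apply: (@le_lt_trans _ _ (\sum_(v <- enum_fset D) mu (box (rt v) (e v)))%E).
  apply: le_trans (le_measure mu _ _ cD) _; rewrite ?inE.
  - exact: measurable_cube.
  - exact: bigsetU_measurable.
  - elim: (enum_fset D) => [|v r IH]; first by rewrite !big_nil measure0.
    rewrite !big_cons (le_trans (measureU2 _ _ _))//; last exact: leeD2l.
    exact: bigsetU_measurable.
by apply: lte_sum_pinfty => v _; exact: (eP v).2.
Qed.

End cubes.

(** * Reduction to a finite filtration *)
Section pattern.
Context {R : realType} {n : nat}.
Variable F : {fset cube_index n}.
Implicit Types (x z : {ffun F -> bool}) (y : Rn R n) (Q : F).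

(** The atoms of the algebra generated by the cubes of [F], indexed by the sets
    of cubes of [F] that contain them. *)
Definition pattern (y : Rn R n) : {ffun F -> bool} :=
  [ffun Q => `[< cube (val Q) y >]].

Lemma patternP y Q : reflect (cube (val Q) y) (pattern y Q).
Proof. by rewrite ffunE; exact: asboolP. Qed.

Lemma measurable_pattern x : measurable (pattern @^-1` [set x]).
Proof.
rewrite (_ : _ @^-1` _ = \bigcap_(Q in [set: F])
    (if x Q then cube (val Q) else ~` cube (val Q))).
  apply: fin_bigcap_measurable; first exact: finite_finset.
  move=> Q _; case: ifP => _; first exact: measurable_cube.
  by apply: measurableC; exact: measurable_cube.
apply/seteqP; split=> [y /= <- Q _|y h].
  by case: ifPn => /patternP.
apply/ffunP => Q; have := h Q I.
by case: ifPn => [_ /patternP//|_ yQ]; apply/negbTE/patternP.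
Qed.

Definition occupied x : bool := [exists Q, x Q].

(** The atom outside all the cubes of [F] may have infinite measure, hence the
    functions and the weights vanish there. *)
Definition extend0 {E : zmodType} (h : {ffun F -> bool} -> E) x : E :=
  if occupied x then h x else 0.

Lemma cube_pattern_in x Q : x Q ->
  cube (val Q) `&` pattern @^-1` [set x] = pattern @^-1` [set x].
Proof.
move=> xQ; apply/seteqP; split=> [y []//|y /= yx]; split=> //.
by apply/patternP; rewrite yx.
Qed.

Lemma cube_pattern_notin x Q : ~~ x Q ->
  cube (val Q) `&` pattern @^-1` [set x] = set0.
Proof.
move=> xQ; apply/seteqP; split=> // y [/patternP yQ /= yx].
by move: xQ; rewrite -yx yQ.
Qed.

(** The scales of the cubes of [F], shifted so as to become natural numbers. *)
Definition rank Q : nat :=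
  absz ((val Q).1 + (\sum_(Q' : F) absz (val Q').1)%N%:Z)%R.

Lemma le_rank Q Q' : (rank Q <= rank Q')%N = ((val Q).1 <= (val Q').1).
Proof.
rewrite /rank; set B := (\sum_(Q' : F) _)%N.
have h Q1 : 0 <= (val Q1).1 + B%:Z.
  have : (absz (val Q1).1 <= B)%N by rewrite /B (bigD1 Q1)//= leq_addr.
  rewrite -lez_nat abszE => hB.
  by rewrite -lerBlDr sub0r lerNl (le_trans _ hB)// -normrN ler_norm.
by rewrite -lez_nat !gez0_abs// lerD2r.
Qed.

Definition coarsen k x : {ffun F -> bool} :=
  [ffun Q => x Q && (rank Q <= k)%N].

Lemma coarsen_nested k x z : coarsen k.+1 x = coarsen k.+1 z ->
  coarsen k x = coarsen k z.
Proof.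
move=> /ffunP xz; apply/ffunP => Q; have := xz Q; rewrite !ffunE.
by case: (leqP (rank Q) k) => [kQ|]; rewrite ?andbF// leqW// !andbT.
Qed.

(** By nestedness, a point of [Q] lies in the same cubes of lower rank as any
    other point of [Q]: the classes of the filtration are the cubes. *)
Lemma pattern_coarsen y y' Q : pattern y Q ->
  (coarsen (rank Q) (pattern y') == coarsen (rank Q) (pattern y)) = pattern y' Q.
Proof.
move=> yQ; apply/eqP/idP => [/ffunP/(_ Q)|y'Q].
  by rewrite ffunE [RHS]ffunE leqnn !andbT yQ.
apply/ffunP => Q'; rewrite ffunE [RHS]ffunE.
have [QQ'|] := leqP (rank Q') (rank Q); last by rewrite !andbF.
rewrite !andbT; rewrite le_rank in QQ'.
move/patternP in yQ; move/patternP in y'Q.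
by apply/patternP/patternP => h; exact: (cube_nested QQ' _ h).
Qed.

Lemma pattern_rank_inj y Q Q' : pattern y Q -> pattern y Q' ->
  rank Q = rank Q' -> Q = Q'.
Proof.
move=> /patternP yQ /patternP yQ' QQ'; apply: val_inj; apply: cube_inj yQ yQ'.
by apply/le_anti; rewrite -!le_rank QQ' leqnn.
Qed.

Section measure.
Variable mu : {measure set (Rn R n) -> \bar R}.
Hypothesis lf : locally_finite mu.

Definition weight x : R :=
  if occupied x then fine (mu (pattern @^-1` [set x])) else 0.

Lemma weight_ge0 x : 0 <= weight x.
Proof. by rewrite /weight; case: ifP => // _; exact: fine_ge0. Qed.

Lemma pattern_lty x : occupied x -> (mu (pattern @^-1` [set x]) < +oo)%E.
Proof.
move=> /existsP[Q xQ]; rewrite -(cube_pattern_in xQ).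
apply: le_lt_trans (locally_finite_cube (val Q) lf); apply: le_measure; rewrite ?inE.
- apply: measurableI; [exact: measurable_cube|exact: measurable_pattern].
- exact: measurable_cube.
- exact: subIsetl.
Qed.

Lemma weightE x Q : x Q -> weight x = fine (mu (pattern @^-1` [set x])).
Proof.
by move=> xQ; rewrite /weight (_ : occupied x)//; apply/existsP; exists Q.
Qed.

Lemma Lp_integral_extend0 (E : completeNormedModType R) p
    (h : {ffun F -> bool} -> E) : 0 < p ->
  Lp_integral mu p (extend0 h \o pattern) = (\sum_x weight x * `|h x| `^ p)%:E.
Proof.
move=> p0; rewrite /Lp_integral.
rewrite (integral_label_fun measurable_pattern mu
  (g := fun x => `|extend0 h x| `^ p))//.
transitivity (\sum_x (weight x * `|h x| `^ p)%:E)%E; last by rewrite sumEFin.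
apply: eq_bigr => x _; rewrite setTI /extend0 /weight.
case: ifP => [ox|_]; last by rewrite normr0 powR0 ?gt_eqF// !mul0r mul0e.
rewrite EFinM fineK 1?muleC// ge0_fin_numE//.
exact: pattern_lty.
Qed.

Lemma bochner_integral_extend0 (E : completeNormedModType R)
    (h : {ffun F -> bool} -> E) (Q : F) :
  bochner_integral mu (cube (val Q)) (extend0 h \o pattern) =
  \sum_(x : {ffun F -> bool} | x Q) weight x *: h x.
Proof.
rewrite bochner_integral_label; last 3 first.
- exact: measurable_pattern.
- exact: measurable_cube.
- exact: locally_finite_cube.
rewrite [RHS]big_mkcond/=; apply: eq_bigr => x _; case: ifPn => xQ.
  rewrite cube_pattern_in// (weightE xQ) /extend0 (_ : occupied x)//.
  by apply/existsP; exists Q.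
by rewrite cube_pattern_notin// measure0 scale0r.
Qed.

Lemma strongly_measurable_extend0 (E : completeNormedModType R)
    (h : {ffun F -> bool} -> E) : strongly_measurable (extend0 h \o pattern).
Proof.
by apply/strongly_measurable_simple/simple_fun_label; exact: measurable_pattern.
Qed.

Section averages.
Context {E : completeNormedModType R} (q : R) (f : Rn R n -> E).
Hypotheses (q1 : 1 < q) (fq : Lp mu q f).

(** Averaging a function over the atoms changes none of its integrals over cubes
    and does not increase its norm. *)
Definition pattern_average x : E :=
  (weight x)^-1 *: bochner_integral mu (pattern @^-1` [set x]) f.

Let q0 : 0 < q. Proof. exact: lt_trans q1. Qed.
Let sf : strongly_measurable f. Proof. exact: fq.1. Qed.

Lemma subset_powR_lty A : measurable A ->
  (\int[mu]_(x in A) (`|f x| `^ q)%:E < +oo)%E.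
Proof.
move=> mA; apply: (@le_lt_trans _ _ (Lp_integral mu q f)).
  apply: ge0_subset_integral => //; first exact: measurable_norm_powR.
by rewrite -Lp_integral_lty//; case: fq.
Qed.

Let f1oo A : measurable A -> (mu A < +oo)%E -> (\int[mu]_(x in A) `|f x|%:E < +oo)%E.
Proof.
by move=> mA Aoo; apply: (integral_norm_lty q1) => //; exact: subset_powR_lty.
Qed.

Lemma bochner_integral_pattern (Q : F) :
  bochner_integral mu (cube (val Q)) f = \sum_(x : {ffun F -> bool} | x Q) weight x *: pattern_average x.
Proof.
have mQ := @measurable_cube R n (val Q); have Qoo := locally_finite_cube (val Q) lf.
rewrite (bochner_integral_partition sf mQ Qoo (f1oo mQ Qoo) measurable_pattern).
rewrite [RHS]big_mkcond/=; apply: eq_bigr => x _.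
have null A : measurable A -> mu A = 0%E -> bochner_integral mu A f = 0.
  move=> mA A0; have Aoo : (mu A < +oo)%E by rewrite A0.
  apply/normr0_eq0/le_anti; rewrite normr_ge0 andbT -lee_fin.
  apply: le_trans (norm_bochner_integral_le sf mA Aoo (f1oo mA Aoo)) _.
  by rewrite null_set_integral//; exact: measurable_norm_strongly_in.
case: ifPn => xQ; last by rewrite cube_pattern_notin//; apply: null => //; exact: measure0.
rewrite cube_pattern_in// /pattern_average.
have [w0|w0] := eqVneq (weight x) 0; last by rewrite scalerA divff ?scale1r.
rewrite w0 scale0r; apply: null; first exact: measurable_pattern.
move: w0; rewrite (weightE xQ) => /eqP; rewrite fine_eq0; first by move/eqP.
by rewrite ge0_fin_numE//; apply: pattern_lty; apply/existsP; exists Q.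
Qed.

Lemma sum_pattern_average_le :
  ((\sum_x weight x * `|pattern_average x| `^ q)%:E <= Lp_integral mu q f)%E.
Proof.
rewrite /Lp_integral (ge0_integral_label measurable_pattern mu)//; last exact: measurable_norm_powR.
rewrite -sumEFin; apply: lee_sum => x _; rewrite setTI /weight.
have mx := measurable_pattern x.
case: ifPn => ox; last first.
  by rewrite mul0r; apply: integral_ge0 => y _; rewrite lee_fin powR_ge0.
rewrite /pattern_average /weight ox; apply: norm_average_powR => //.
- exact: pattern_lty.
- exact: subset_powR_lty.
Qed.

End averages.

Section operator.
Context {C D : banachLatticeType R} (lam : cube_index n -> {linear C -> D}).

(** An atom lies in at most one cube of each rank. *)
Definition pattern_op k (c : {ffun F -> bool}) : {linear C -> D} :=
  if [pick Q : F | c Q && (rank Q == k)] is Some Q then lam (val Q)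
  else \0.

Definition max_rank : nat := \max_(Q : F) rank Q.

Lemma wsum_pattern (v : {ffun F -> bool} -> C) y Q : pattern y Q ->
  wsum weight coarsen (rank Q) v (pattern y) = \sum_(z : {ffun F -> bool} | z Q) weight z *: v z.
Proof.
move=> yQ; rewrite /wsum big_mkcond [RHS]big_mkcond/=; apply: eq_bigr => z _.
have [w0|w0] := eqVneq (weight z) 0; first by rewrite w0 scale0r !if_same.
have [y' y'z] : exists y', pattern y' = z.
  apply/not_existsP => nz; move/eqP : w0; apply; rewrite /weight.
  case: ifP => // _; rewrite (_ : _ @^-1` _ = set0) ?measure0//.
  by apply/seteqP; split=> // y' /= /nz.
by rewrite -y'z pattern_coarsen.
Qed.

Lemma level_op_pattern (v : {ffun F -> bool} -> C) y :
  level_op weight coarsen pattern_op max_rank 0 v (pattern y) =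
  \sum_(Q | pattern y Q) lam (val Q) (\sum_(z : {ffun F -> bool} | z Q) weight z *: v z).
Proof.
rewrite /level_op/= (partition_big (fun Q => inord (rank Q) : 'I_max_rank.+1) xpredT)//=.
have rankP (Q : F) : (rank Q < max_rank.+1)%N by rewrite ltnS; exact: leq_bigmax.
apply: eq_bigr => k _; rewrite /pattern_op; case: pickP => [Q|none].
  rewrite ffunE => /andP[/andP[yQ _] /eqP Qk].
  rewrite (big_pred1 Q) => [|Q']; first by rewrite -Qk wsum_pattern.
  apply/andP/eqP => [[yQ' /eqP Q'k]|->]; last first.
    by split=> //; apply/eqP/val_inj; rewrite /= inordK.
  apply: (pattern_rank_inj yQ' yQ); rewrite Qk -Q'k inordK//.
rewrite big_pred0// => Q; have := none Q; rewrite ffunE -andbA => h.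
apply/negbTE; move: h => /negbT; apply: contra => /andP[-> /eqP <-] /=.
by rewrite inordK// leqnn eqxx.
Qed.

Lemma pattern_op_ge0 k c : (forall Q : cube_index n, positive_op (lam Q)) -> positive_op (pattern_op k c).
Proof. by move=> lam0; rewrite /pattern_op; case: pickP => // _ x x0. Qed.

Lemma dyadic_op_pattern (f : Rn R n -> C) (v : {ffun F -> bool} -> C) :
  (forall Q : F, bochner_integral mu (cube (val Q)) f = \sum_(x : {ffun F -> bool} | x Q) weight x *: v x) ->
  dyadic_op lam mu F f =
  extend0 (level_op weight coarsen pattern_op max_rank 0 v) \o pattern.
Proof.
move=> fv; apply/funext => y.
transitivity (\sum_(Q : F | pattern y Q)
    lam (val Q) (\sum_(z : {ffun F -> bool} | z Q) weight z *: v z)); last first.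
  rewrite /= /extend0; case: ifPn => [_|/existsPn oy]; first by rewrite level_op_pattern.
  by rewrite big_pred0// => Q; exact/negbTE.
rewrite /dyadic_op big_seq_fsetE/=.
rewrite [RHS]big_mkcond/=; apply: eq_bigr => Q _; rewrite indicE -fv.
case: ifPn => [/patternP yQ|/patternP yQ].
  by rewrite mem_set// scale1r.
by rewrite memNset// scale0r.
Qed.

End operator.
End measure.
End pattern.

Section extrapolation.
Context {R : realType} {n : nat} {C D : banachLatticeType R}.
Variables (mu : {measure set (Rn R n) -> \bar R}).
Variables (lam : cube_index n -> {linear C -> D}).

Lemma dyadic_op_bounded_extrapolation (A B p q : R) :
  1 <= A -> 1 <= B -> 1 < p -> 1 < q ->
  @tree_weak_type R C A -> @tree_weak_type R (dual D) B ->
  locally_finite mu -> (forall Q, positive_op (lam Q)) ->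
  dyadic_op_bounded lam mu p -> dyadic_op_bounded lam mu q.
Proof.
move=> A1 B1 p1 q1 weakA weakB lf lam0 [K HK].
have p0 : 0 < p by exact: lt_trans p1.
have q0 : 0 < q by exact: lt_trans q1.
have Kp0 : 0 <= `|K| `^ p by exact: powR_ge0.
have bounded (F : {fset cube_index n}) (h : {ffun F -> bool} -> C) :
    \sum_x weight mu x *
      `|level_op (weight mu) (@coarsen n F) (pattern_op lam) (max_rank F) 0 h x| `^ p <=
    `|K| `^ p * \sum_x weight mu x * `|h x| `^ p.
  have hp : Lp mu p (extend0 h \o @pattern R n F).
    split; first exact: strongly_measurable_extend0.
    by rewrite Lp_integral_lty// Lp_integral_extend0// ltry.
  have := Lp_norm_le_integral p0 (HK F _ hp).
  rewrite (dyadic_op_pattern lam (fun Q => bochner_integral_extend0 lf h Q)).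
  by rewrite !Lp_integral_extend0// -EFinM lee_fin.
pose c := 2 * (1 + `|K| `^ p) * (4 * A) * (4 * B); pose q' := q / (q - 1).
pose d := (2 * c * (2 * (q' / (q' - 1))) `^ q')^-1.
pose K' := 2 * c * d^-1 `^ (q - 1) * (2 * q') `^ q.
have A0 : 0 <= 4 * A by lra.
have B0 : 0 <= 4 * B by lra.
have c0 : 0 <= c by do 3 apply: mulr_ge0 => //; exact: addr_ge0.
have K'0 : 0 <= K'.
  do 2 (apply: mulr_ge0; last exact: powR_ge0).
  exact: mulr_ge0.
exists (K' `^ q^-1) => F f fq; apply: Lp_integral_le_norm => //.
rewrite (dyadic_op_pattern lam (bochner_integral_pattern lf q1 fq)).
rewrite Lp_integral_extend0//.
apply: (@le_trans _ _ (K' * \sum_x weight mu x * `|pattern_average mu f x| `^ q)%:E).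
  rewrite lee_fin; apply: (@level_op_bounded _ _ _ _ _ _ _ _ _ _ _ _ A B p q (`|K| `^ p)) => //.
  - by move=> x; exact: weight_ge0.
  - exact: coarsen_nested.
  - by move=> k c'; exact: pattern_op_ge0.
rewrite EFinM lee_wpmul2l ?lee_fin//; exact: sum_pattern_average_le.
Qed.

End extrapolation.

(** * Trees as dyadic step functions *)
Section tree_values.
Context {R : realType} {E : banachLatticeType R}.
Implicit Types (t l r : @tree R E) (s b : E).

Fixpoint tree_height t : nat :=
  if t is Node l r then (maxn (tree_height l) (tree_height r)).+1 else 0.

(** The value on the [j]th of the [2 ^ N] dyadic subintervals of the unit
    interval. *)
Fixpoint tree_value t N j : E :=
  match t with
  | Leaf x => x
  | Node l r =>
    if N is M.+1 then
      if (j < 2 ^ M)%N then tree_value l M j else tree_value r M (j - 2 ^ M)%N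
    else 0
  end.

(** The value there of the lattice maximal function, joined with [s]. *)
Fixpoint tree_path_join s t N j : E :=
  match t with
  | Leaf x => Order.join s x
  | Node l r =>
    let s' := Order.join s (2^-1 *: (tree_mean l + tree_mean r)) in
    if N is M.+1 then
      if (j < 2 ^ M)%N then tree_path_join s' l M j
      else tree_path_join s' r M (j - 2 ^ M)%N
    else 0
  end.

Lemma sum_halves (V : nmodType) N (P : pred nat) (h : nat -> V) :
  \sum_(0 <= j < 2 ^ N.+1 | P j) h j =
  \sum_(0 <= j < 2 ^ N | P j) h j + \sum_(0 <= j < 2 ^ N | P (2 ^ N + j)%N) h (2 ^ N + j)%N.
Proof.
rewrite (big_cat_nat (n := (2 ^ N)%N))//=; last by rewrite leq_exp2l.
congr (_ + _); rewrite -{1}[(2 ^ N)%N]add0n big_addn expnS mul2n -addnn addnK.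
by apply: eq_big => j; rewrite addnC.
Qed.

Lemma sum_tree_halves (V : nmodType) N (u v : nat -> V) :
  \sum_(0 <= j < 2 ^ N.+1) (if (j < 2 ^ N)%N then u j else v (j - 2 ^ N)%N) =
  \sum_(0 <= j < 2 ^ N) u j + \sum_(0 <= j < 2 ^ N) v j.
Proof.
rewrite sum_halves; congr (_ + _).
  by apply: eq_big_nat => j /andP[_ ->].
by apply: eq_bigr => j _; rewrite ltnNge leq_addr/= addKn.
Qed.

Let half2 N (a c : R) :
  2^-1 * ((2 ^+ N)^-1 * a + (2 ^+ N)^-1 * c) = (2 ^+ N.+1)^-1 * (a + c).
Proof. by rewrite -mulrDr mulrA -invfM -exprS. Qed.

Lemma tree_avgE (g : E -> R) t N : (tree_height t <= N)%N ->
  tree_avg g t = (2 ^+ N)^-1 * \sum_(0 <= j < 2 ^ N) g (tree_value t N j).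
Proof.
elim: t N => [x|l IHl r IHr] N /=.
  move=> _; rewrite sumr_const_nat subn0 -[g x *+ _]mulr_natl natrX mulKf//.
case: N => // N; rewrite ltnS geq_max => /andP[lN rN].
rewrite (IHl N)// (IHr N)// half2 -sum_tree_halves//.
by congr (_ * _); apply: eq_bigr => j _; case: ifP.
Qed.

Lemma tree_meanE t N : (tree_height t <= N)%N ->
  tree_mean t = (2 ^+ N)^-1 *: \sum_(0 <= j < 2 ^ N) tree_value t N j.
Proof.
elim: t N => [x|l IHl r IHr] N /=.
  move=> _; rewrite sumr_const_nat subn0 -[x *+ _]scaler_nat natrX scalerA mulVf ?scale1r//.
case: N => // N; rewrite ltnS geq_max => /andP[lN rN].
by rewrite (IHl N)// (IHr N)// sum_tree_halves// -scalerDr scalerA -invfM -exprS.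
Qed.

Lemma tree_maxE (g : E -> R) s t N : (tree_height t <= N)%N ->
  tree_max g s t = (2 ^+ N)^-1 * \sum_(0 <= j < 2 ^ N) g (tree_path_join s t N j).
Proof.
elim: t s N => [x|l IHl r IHr] s N /=.
  move=> _; rewrite sumr_const_nat subn0 -[g _ *+ _]mulr_natl natrX mulKf//.
case: N => // N; rewrite ltnS geq_max => /andP[lN rN].
rewrite (IHl _ N)// (IHr _ N)// half2 -sum_tree_halves//.
by congr (_ * _); apply: eq_bigr => j _; case: ifP.
Qed.

Lemma tree_value_ge0 t N j : tree_pos t -> 0 <= tree_value t N j.
Proof.
elim: t N j => [//|l IHl r IHr] N j /= [l0 r0].
by case: N => // N; case: ifP => _; [exact: IHl|exact: IHr].
Qed.

Lemma tree_path_join_ge0 s t N j : 0 <= s -> 0 <= tree_path_join s t N j.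
Proof.
elim: t s N j => [x|l IHl r IHr] s N j s0 /=; first exact: bl_join_ge0.
by case: N => // N; case: ifP => _; [apply: IHl|apply: IHr]; exact: bl_join_ge0.
Qed.

(** The average over the dyadic interval of length [2 ^ - k] that contains the
    [j]th of the [2 ^ N] intervals. *)
Definition tree_block_avg t N k j : E :=
  (2 ^+ (N - k))^-1 *:
  \sum_(0 <= i < 2 ^ N | (i %/ 2 ^ (N - k) == j %/ 2 ^ (N - k))%N) tree_value t N i.

Let divn_half N k j : (k <= N)%N -> ((2 ^ N + j) %/ 2 ^ (N - k) = 2 ^ k + j %/ 2 ^ (N - k))%N.
Proof.
move=> kN; rewrite divnDl; last by rewrite dvdn_exp2l// leq_subr.
by rewrite -{1}(subnK kN) expnD mulKn// expn_gt0.
Qed.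

Let divn_small_half N k j : (k <= N)%N -> (j < 2 ^ N)%N -> (j %/ 2 ^ (N - k) < 2 ^ k)%N.
Proof. by move=> kN jN; rewrite ltn_divLR ?expn_gt0// -expnD subnKC. Qed.

Lemma tree_block_avg_left l r N k j : (k <= N)%N -> (j < 2 ^ N)%N ->
  tree_block_avg (Node l r) N.+1 k.+1 j = tree_block_avg l N k j.
Proof.
move=> kN jN; rewrite /tree_block_avg subSS; congr (_ *: _).
rewrite sum_halves [X in _ + X]big1 ?addr0; last first.
  move=> i; rewrite divn_half// => /eqP h; have := divn_small_half kN jN.
  by rewrite -h ltnNge leq_addr.
rewrite big_nat_cond [RHS]big_nat_cond; apply: eq_big => // i /andP[/andP[_ iN] _] /=.
by rewrite iN.
Qed.

Lemma tree_block_avg_right l r N k j : (k <= N)%N -> (j < 2 ^ N)%N ->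
  tree_block_avg (Node l r) N.+1 k.+1 (2 ^ N + j)%N = tree_block_avg r N k j.
Proof.
move=> kN jN; rewrite /tree_block_avg subSS; congr (_ *: _).
rewrite divn_half// sum_halves big1_seq ?add0r; last first.
  move=> i /andP[/eqP h]; rewrite mem_index_iota => /andP[_ iN].
  by have := divn_small_half kN iN; rewrite h ltnNge leq_addr.
apply: eq_big => i; first by rewrite divn_half// eqn_add2l.
by move=> _ /=; rewrite ltnNge leq_addr/= addKn.
Qed.

(** The nodes on a path carry the averages over the dyadic intervals around
    [j]. *)
Lemma tree_path_join_le s t N j b : (tree_height t <= N)%N -> (j < 2 ^ N)%N ->
  s <= b -> (forall k, (k <= N)%N -> tree_block_avg t N k j <= b) ->
  tree_path_join s t N j <= b.
Proof.
elim: t s N j => [x|l IHl r IHr] s N j /= hN jN sb tb.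
  rewrite leUx sb/=; have := tb N (leqnn N).
  rewrite /tree_block_avg subnn expr0 invr1 scale1r expn0.
  under eq_bigl do rewrite !divn1.
  by rewrite big_nat1_eq jN.
case: N hN jN tb => // N; rewrite ltnS geq_max => /andP[lN rN] jN tb.
have {}sb : Order.join s (2^-1 *: (tree_mean l + tree_mean r)) <= b.
  rewrite leUx sb/=; have := tb 0%N (leq0n _).
  rewrite /tree_block_avg subn0 (divn_small jN) big_nat_cond.
  rewrite (eq_bigl (fun i => (0 <= i < 2 ^ N.+1)%N && true)); last first.
    by move=> i; case: ltnP => iN; rewrite ?andbF// divn_small.
  rewrite -big_nat_cond -tree_meanE//= ltnS geq_max lN.
  exact.
case: ltnP => [jN'|jN'].
  apply: IHl => // k kN; rewrite -(@tree_block_avg_left l r)//; exact: tb.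
have jN2 : (j - 2 ^ N < 2 ^ N)%N by rewrite ltn_subLR// addnn -mul2n -expnS.
apply: IHr => // k kN; rewrite -(@tree_block_avg_right l r)// subnKC//; exact: tb.
Qed.

End tree_values.

(** * From the Hardy--Littlewood property to trees *)
Section slabs.
Context {R : realType} {n : nat}.
Variable N : nat.
Let mu := @lebesgue_Rn R n.+1.

(** Step functions of the first coordinate carry the one-dimensional theory into
    the unit cube; they are constant on slabs. *)
Definition slab (j : nat) : set (Rn R n.+1) :=
  [set x | forall i : 'I_n.+1,
    (if i == ord0 then j%:R / 2 ^+ N else 0) <= (tnth x i : R) <
    (if i == ord0 then j.+1%:R / 2 ^+ N else 1)].

Let p2 k : 0 < (2 : R) ^+ k. Proof. exact: exprn_gt0. Qed.

Let big_head (u v : R) : \prod_(i < n.+1) (if i == ord0 then u else v) = u * v ^+ n.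
Proof. by rewrite big_ord_recl eqxx /= prodr_const card_ord. Qed.

Lemma slab_inj (j j' : nat) x : slab j x -> slab j' x -> j = j'.
Proof.
move=> /(_ ord0) + /(_ ord0); rewrite eqxx !ler_pdivrMr// !ltr_pdivlMr//.
move=> /andP[a b] /andP[c d]; apply/anti_leq/andP; split; rewrite -ltnS -(ltr_nat R).
  exact: le_lt_trans a d.
exact: le_lt_trans c b.
Qed.

Definition slab_label (x : Rn R n.+1) : option 'I_(2 ^ N) :=
  [pick j : 'I_(2 ^ N) | `[< slab j x >]].

Lemma slab_label_Some (j : 'I_(2 ^ N)) : slab_label @^-1` [set Some j] = slab j.
Proof.
apply/seteqP; split=> x; rewrite /preimage/= /slab_label; case: pickP => [j' /asboolP h|none].
- by move=> [<-].
- by [].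
- by move=> /(slab_inj h) jj; congr Some; exact: val_inj.
- by move=> /asboolP; rewrite none.
Qed.

Lemma measurable_slab j : measurable (slab j).
Proof. exact: measurable_box. Qed.

Lemma measurable_slab_label o : measurable (slab_label @^-1` [set o]).
Proof.
have mS (j : 'I_(2 ^ N)) : measurable (slab_label @^-1` [set Some j]).
  by rewrite slab_label_Some; exact: measurable_slab.
case: o => [j|]; first exact: mS.
rewrite (_ : _ @^-1` _ = ~` \bigcup_(j in [set: 'I_(2 ^ N)]) (slab_label @^-1` [set Some j])).
  by apply/measurableC/fin_bigcup_measurable => //; exact: finite_finset.
apply/seteqP; split=> [x /= xN [j _ /= xj]|x /=]; first by rewrite xN in xj.
by case E: (slab_label x) => [j|//] []; exists j.
Qed.

Lemma lebesgue_slab j : mu (slab j) = ((2 ^+ N)^-1)%:E.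
Proof.
rewrite /mu lebesgue_Rn_box; last first.
  by move=> i; case: ifP => _ //; rewrite ler_pM2r ?invr_gt0// ler_nat.
congr EFin; rewrite (eq_bigr (fun i => if i == ord0 then (2 ^+ N)^-1 else 1)).
  by rewrite big_head expr1n mulr1.
move=> i _; case: ifP => _; last by rewrite subr0.
by rewrite -mulrBl -natrB// subSnn mul1r.
Qed.

Definition unit_cube (k : nat) (m : 'I_n.+1 -> nat) : cube_index n.+1 :=
  (k%:Z, [tuple (m i)%:Z | i < n.+1]).

Lemma unit_cubeE k m : cube (unit_cube k m) =
  [set x : Rn R n.+1 | forall i, (m i)%:R / 2 ^+ k <= (tnth x i : R) < (m i).+1%:R / 2 ^+ k].
Proof.
apply/seteqP; split=> x h i; have := h i; rewrite /= tnth_mktuple.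
  by rewrite -!pmulrn -exprnN natr1.
by rewrite -!pmulrn -exprnN natr1.
Qed.

Lemma lebesgue_unit_cube k m : mu (cube (unit_cube k m)) = ((2 ^+ k)^-1 ^+ n.+1)%:E.
Proof.
rewrite unit_cubeE /mu lebesgue_Rn_box.
  congr EFin; rewrite (eq_bigr (fun=> (2 ^+ k)^-1)) ?prodr_const ?card_ord// => i _.
  by rewrite -mulrBl -natrB// subSnn mul1r.
by move=> i; rewrite ler_pM2r ?invr_gt0// ler_nat.
Qed.

Lemma block_interval k j i : (k <= N)%N -> (j %/ 2 ^ (N - k) = i)%N ->
  i%:R / 2 ^+ k <= (j%:R / 2 ^+ N : R) /\ (j.+1%:R / 2 ^+ N : R) <= i.+1%:R / 2 ^+ k.
Proof.
move=> kN' <-; set M := (2 ^ (N - k))%N.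
have M0 : (0 < M)%N by rewrite expn_gt0.
have NE : (2 : R) ^+ N = M%:R * 2 ^+ k by rewrite /M natrX -exprD subnK.
have MR : 0 < (M%:R : R) by rewrite ltr0n.
have scale (u : nat) : (u%:R / 2 ^+ k : R) = (u * M)%:R / 2 ^+ N.
  by rewrite NE natrM; field; rewrite !gt_eqF.
rewrite !scale; split; rewrite ler_pM2r ?invr_gt0// ler_nat.
  exact: leq_trunc_div.
exact: ltn_ceil.
Qed.

Lemma lebesgue_cube_slab k m (j : nat) : (k <= N)%N -> (forall i, (m i < 2 ^ k)%N) ->
  mu (cube (unit_cube k m) `&` slab j) =
  (if (j %/ 2 ^ (N - k) == m ord0)%N then (2 ^+ N)^-1 * (2 ^+ k)^-1 ^+ n else 0)%:E.
Proof.
move=> kN' mk; rewrite unit_cubeE; case: eqP => [jm|jm].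
  have [b1 b2] := block_interval kN' jm.
  pose a (i : 'I_n.+1) := if i == ord0 then j%:R / 2 ^+ N else (m i)%:R / 2 ^+ k : R.
  pose b (i : 'I_n.+1) := if i == ord0 then j.+1%:R / 2 ^+ N else (m i).+1%:R / 2 ^+ k : R.
  rewrite (_ : _ `&` _ = [set x : Rn R n.+1 | forall i, a i <= (tnth x i : R) < b i]).
    rewrite /mu lebesgue_Rn_box; last first.
      by move=> i; rewrite /a /b; case: ifP => _; rewrite ler_pM2r ?invr_gt0// ler_nat.
    congr EFin; rewrite -big_head; apply: eq_bigr => i _; rewrite /a /b.
    by case: ifP => _; rewrite -mulrBl -natrB// subSnn mul1r.
  apply/seteqP; split=> [x [h1 h2] i|x h].
    have := h1 i; have := h2 i; rewrite /a /b.
    by case: eqP => [->|_] //.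
  split=> i; have := h i; rewrite /a /b; case: eqP => [->|_] //.
    by move=> /andP[c d]; rewrite (le_trans b1 c) (lt_le_trans d b2).
  move=> /andP[c d]; rewrite (le_trans _ c) ?divr_ge0 ?(ltW (p2 k))//=.
  by rewrite (lt_le_trans d)// ler_pdivrMr// mul1r -natrX ler_nat.
rewrite (_ : _ `&` _ = set0) ?measure0//; apply/seteqP; split=> // x [h1 h2].
have := h1 ord0; have := h2 ord0; rewrite eqxx.
have [b1 b2] := block_interval kN' (erefl (j %/ 2 ^ (N - k))%N).
move=> /andP[c d] /andP[e f]; apply: jm; apply/anti_leq/andP.
have k0 : 0 < ((2 : R) ^+ k)^-1 by rewrite invr_gt0.
split; rewrite -ltnS -(ltr_nat R) -(ltr_pM2r k0).
  exact: le_lt_trans (le_trans b1 c) f.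
exact: le_lt_trans e (lt_le_trans d b2).
Qed.

Lemma big_option (V : nmodType) (I : finType) (h : option I -> V) :
  \sum_o h o = h None + \sum_i h (Some i).
Proof.
rewrite (bigD1 None)//=; congr (_ + _).
rewrite (reindex_omap Some id)/=; last by case.
by apply: eq_bigl => i; rewrite eqxx.
Qed.

Section values.
Context {E : banachLatticeType R} (h : nat -> E).

Definition slab_fun (x : Rn R n.+1) : E :=
  if slab_label x is Some j then h j else 0.

Lemma slab_funE : slab_fun = (fun o : option 'I_(2 ^ N) => if o is Some j then h j else 0) \o slab_label.
Proof. by []. Qed.

Lemma Lp_integral_slab_fun p : 0 < p ->
  Lp_integral mu p slab_fun = ((2 ^+ N)^-1 * \sum_(0 <= j < 2 ^ N) `|h j| `^ p)%:E.
Proof.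
move=> p0; rewrite slab_funE /Lp_integral.
rewrite (integral_label_fun measurable_slab_label mu
  (g := fun o => `|if o is Some j then h (j : 'I_(2 ^ N)) else 0| `^ p))//.
rewrite big_option normr0 powR0 ?gt_eqF// mul0e add0e.
transitivity (\sum_(j < 2 ^ N) ((2 ^+ N)^-1 * `|h j| `^ p)%:E)%E.
  apply: eq_bigr => j _; rewrite setTI slab_label_Some EFinM muleC.
  congr (_ * _)%E; exact: lebesgue_slab.
by rewrite sumEFin -mulr_sumr big_mkord.
Qed.

(** The other coordinates cancel in the average. *)
Lemma average_slab_fun k m : (k <= N)%N -> (forall i, (m i < 2 ^ k)%N) ->
  average (unit_cube k m) slab_fun =
  (2 ^+ (N - k))^-1 *:
  \sum_(0 <= j < 2 ^ N | (j %/ 2 ^ (N - k) == m ord0)%N) h j.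
Proof.
move=> kN' mk; rewrite /average slab_funE bochner_integral_label; last 3 first.
- exact: measurable_slab_label.
- exact: measurable_cube.
- by rewrite [X in (X < +oo)%E]lebesgue_unit_cube ltry.
rewrite big_option scaler0 add0r [X in fine X]lebesgue_unit_cube /=.
rewrite big_mkord [in RHS]big_mkcond/= !scaler_sumr; apply: eq_bigr => j _.
rewrite slab_label_Some [X in fine X]lebesgue_cube_slab//=; case: ifP => _; last first.
  by rewrite scale0r !scaler0.
rewrite scalerA; congr (_ *: _).
have NE : (2 : R) ^+ N = 2 ^+ (N - k) * 2 ^+ k by rewrite -exprD subnK.
rewrite exprS NE; field.
by rewrite !expf_neq0 ?invr_eq0// !expf_neq0.
Qed.

End values.
End slabs.

Lemma lattice_sup_ub (R : realType) (E : banachLatticeType R) (s : seq E) b :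
  b \in s -> b <= lattice_sup s.
Proof.
case: s => // a s; rewrite inE /lattice_sup.
elim: s => [|c s IH] /=; first by rewrite big_nil orbF => /eqP ->.
rewrite big_cons inE orbCA => /predU1P[->|/IH h]; first exact: leUl.
exact: le_trans h (leUr _ _).
Qed.

Section hardy_littlewood_tree.
Context {R : realType} {n : nat} {E : banachLatticeType R}.

(** Measurability of the maximal function, which depends only on the cubes of [F]
    that contain the point. *)
Lemma measurable_pattern_adapted d (Y : measurableType d) (F : {fset cube_index n})
    (g : Rn R n -> Y) :
  (forall x y, pattern F x = pattern F y -> g x = g y) -> measurable_fun setT g.
Proof.
move=> gF _ B mB; rewrite setTI.
rewrite (_ : g @^-1` B = pattern F @^-1` (pattern F @` (g @^-1` B))).
  exact: (measurable_preimage_label (@measurable_pattern R n F)).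
apply/seteqP; split=> x; first by move=> Bx; exists x.
by move=> [y By /gF yx]; rewrite /preimage/= -yx.
Qed.

Lemma dyadic_maximal_pattern (F : {fset cube_index n}) (f : Rn R n -> E) x y :
  pattern F x = pattern F y -> dyadic_maximal F f x = dyadic_maximal F f y.
Proof.
move=> xy; congr lattice_sup; apply/eq_in_map => Q QF; rewrite !indicE.
have := congr1 (fun u : {ffun F -> bool} => u (FSetSub QF)) xy; rewrite !ffunE /= => e.
congr ((nat_of_bool _)%:R *: _); apply/idP/idP; rewrite !inE => /asboolP.
  by rewrite e => /asboolP.
by rewrite -e => /asboolP.
Qed.

End hardy_littlewood_tree.

Section strong_type.
Context {R : realType} {n : nat} {E : banachLatticeType R}.
Variable t : @tree R E.
Hypothesis t0 : tree_pos t.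
Let N := tree_height t.
Let f : Rn R n.+1 -> E := slab_fun N (tree_value t N).

(** Those of the cubes that lie outside the unit cube do no harm, as they can
    only enlarge the maximal function. *)
Definition slab_cubes : {fset cube_index n.+1} :=
  [fset Q in [seq unit_cube k (fun i => val ((m : {ffun 'I_n.+1 -> 'I_(2 ^ N)}) i)) |
     k <- iota 0 N.+1, m <- enum {ffun 'I_n.+1 -> 'I_(2 ^ N)}]]%fset.

Lemma slab_cubes_cover (j : 'I_(2 ^ N)) (x : Rn R n.+1) k : (k <= N)%N -> slab N j x ->
  exists m : 'I_n.+1 -> nat, [/\ unit_cube k m \in slab_cubes, cube (unit_cube k m) x,
    forall i, (m i < 2 ^ k)%N & m ord0 = (j %/ 2 ^ (N - k))%N].
Proof.
move=> kN xj.
have p2 : 0 < (2 : R) ^+ k by exact: exprn_gt0.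
have p2N : 0 < (2 : R) ^+ N by exact: exprn_gt0.
have x01 i : 0 <= (tnth x i : R) < 1.
  have := xj i; case: eqP => // _ /andP[a b].
  rewrite (le_trans _ a) ?divr_ge0 ?(ltW p2N)//= (lt_le_trans b)//.
  by rewrite ler_pdivrMr// mul1r -natrX ler_nat.
pose m i := Num.truncn ((tnth x i : R) * 2 ^+ k).
have mi i : (m i)%:R / 2 ^+ k <= (tnth x i : R) < (m i).+1%:R / 2 ^+ k.
  rewrite ler_pdivrMr// ltr_pdivlMr// truncn_itv// mulr_ge0 ?(ltW p2)//.
  by have /andP[] := x01 i.
have mk i : (m i < 2 ^ k)%N.
  rewrite -(ltr_nat R) natrX; have /andP[a _] := mi i; have /andP[_ b] := x01 i.
  by have := le_lt_trans a b; rewrite ltr_pdivrMr// mul1r.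
exists m; split=> //.
- have mN i : (m i < 2 ^ N)%N by rewrite (leq_trans (mk i))// leq_exp2l.
  rewrite in_fset; apply/allpairsP; exists (k, [ffun i => Ordinal (mN i)]); split.
  + by rewrite mem_iota.
  + by rewrite mem_enum.
  + by congr pair; apply: eq_from_tnth => i; rewrite !tnth_mktuple ffunE.
- by rewrite unit_cubeE.
- have [b1 b2] := @block_interval R N k j _ kN erefl.
  have /andP[c d] := mi ord0; have := xj ord0; rewrite eqxx => /andP[e g].
  have k0 : 0 < ((2 : R) ^+ k)^-1 by rewrite invr_gt0.
  apply/anti_leq/andP; split; rewrite -ltnS -(ltr_nat R) -(ltr_pM2r k0).
    exact: le_lt_trans c (lt_le_trans g b2).
  exact: le_lt_trans (le_trans b1 e) d.
Qed.

Lemma tree_path_join_le_maximal (j : 'I_(2 ^ N)) x : slab N j x ->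
  tree_path_join 0 t N j <= dyadic_maximal slab_cubes f x.
Proof.
move=> xj.
have ub k : (k <= N)%N -> tree_block_avg t N k j <= dyadic_maximal slab_cubes f x.
  move=> kN; have [m [mF xm mk mj]] := slab_cubes_cover kN xj.
  apply: lattice_sup_ub; apply/mapP; exists (unit_cube k m) => //.
  by rewrite indicE mem_set// scale1r average_slab_fun// mj.
apply: tree_path_join_le => //.
apply: le_trans (ub 0%N (leq0n _)); apply: bl_scale_ge0; first by rewrite invr_ge0 exprn_ge0.
by apply: bl_sum_ge0 => i _; exact: tree_value_ge0.
Qed.

Lemma tree_max_le_maximal p : 0 < p ->
  ((tree_max (fun x => `|x| `^ p) 0 t)%:E <=
   Lp_integral (@lebesgue_Rn R n.+1) p (dyadic_maximal slab_cubes f))%E.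
Proof.
move=> p0; rewrite (tree_maxE _ _ (leqnn _)).
rewrite -(@Lp_integral_slab_fun R n N E (tree_path_join 0 t N) p p0).
apply: ge0_le_integral => //.
- apply/measurable_EFinP; rewrite slab_funE.
  exact: (measurable_fun_label (@measurable_slab_label R n N) (fun o : option 'I_(2 ^ N) =>
    `|if o is Some j then tree_path_join 0 t N j else 0| `^ p)).
- apply/measurable_EFinP.
  apply: (@measurable_pattern_adapted R n.+1 _ (measurableTypeR R) slab_cubes) => x y xy.
  exact: (congr1 (fun e : E => `|e| `^ p) (dyadic_maximal_pattern f xy)).
move=> x _; rewrite lee_fin; apply: ge0_ler_powR; rewrite ?nnegrE ?(ltW p0)//.
rewrite /slab_fun; case E0 : (slab_label N x) => [j|]; last by rewrite normr0.
apply: blnorm_mono; first exact: tree_path_join_ge0.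
apply: tree_path_join_le_maximal; rewrite -slab_label_Some.
exact: E0.
Qed.

End strong_type.

(** A tree becomes a step function of the first coordinate, whose averages over
    dyadic cubes are its averages over dyadic intervals. *)
Lemma dyadic_HL_tree_strong_type (R : realType) (n : nat) (E : banachLatticeType R) :
  (0 < n)%N -> dyadic_HL n E ->
  exists p K : R, [/\ 1 < p, 0 <= K & @tree_strong_type R E p K].
Proof.
case: n => // n _ [p p1 [K HK]]; exists p, (`|K| `^ p); split=> // t t0.
have p0 : 0 < p by exact: lt_trans p1.
pose N := tree_height t; pose f : Rn R n.+1 -> E := slab_fun N (tree_value t N).
have If := @Lp_integral_slab_fun R n N E (tree_value t N) p p0.
have fp : Lp (lebesgue_Rn n.+1) p f.
  split.
    rewrite /f slab_funE; apply/strongly_measurable_simple/simple_fun_label.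
    exact: measurable_slab_label.
  by rewrite Lp_integral_lty// [X in (X < _)%E]If ltry.
have := Lp_norm_le_integral p0 (HK (slab_cubes t) f fp).
rewrite [X in (_ * X)%E]If -EFinM -(tree_avgE (fun x => `|x| `^ p) (leqnn N)) => h.
by rewrite -lee_fin; apply: le_trans h; exact: tree_max_le_maximal.
Qed.

Lemma dyadic_HL_tree_weak_type (R : realType) (n : nat) (E : banachLatticeType R) :
  (0 < n)%N -> dyadic_HL n E -> exists2 A : R, 1 <= A & @tree_weak_type R E A.
Proof.
move=> n0 /(dyadic_HL_tree_strong_type n0)[p [K [p1 K0 strong]]].
exists (K * 2 `^ (p - 1) + 1); last exact: tree_weak_of_strong.
by rewrite lerDr mulr_ge0// powR_ge0.
Qed.

Theorem corollary1p6 (R : realType) (n : nat) (C D : banachLatticeType R)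
    (mu : {measure set (Rn R n) -> \bar R})
    (lam : cube_index n -> {linear C -> D}) :
  (0 < n)%N ->
  dyadic_HL n C ->
  dyadic_HL n (dual D) ->
  locally_finite mu ->
  (forall Q : cube_index n, positive_op (lam Q)) ->
  (exists2 p : R, 1 < p & dyadic_op_bounded lam mu p) <->
  (forall p : R, 1 < p -> dyadic_op_bounded lam mu p).
Proof.
move=> n0 /(dyadic_HL_tree_weak_type n0)[A A1 weakA].
move=> /(dyadic_HL_tree_weak_type n0)[B B1 weakB] lf lam0.
split=> [[p p1 bp] q q1|bounded]; last by exists 2; [lra|apply: bounded; lra].
exact: (dyadic_op_bounded_extrapolation A1 B1 p1 q1 weakA weakB lf lam0 bp).
Qed.
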